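(* Let $K$ be a number field, let $n\ge 1$, and let $\chi(t)\in\mathcal{O}_K[t]$ be a monic separable polynomial of degree $n$. Then there is an effective constant $C=C(\chi,n,K)$, depending only on $\chi$, $n$ and $K$, such that \[\max\{C_K(M,N) : M,N\in\mathrm{Mat}_n(\mathcal{O}_K),\ M \text{ and } N \text{ are similar over } \mathcal{O}_{K_{\mathfrak{p}}} \text{ for all places } \mathfrak{p} \text{ of } K,\ \mathrm{ch}(M)=\chi\}\leq C.\]
   Context: For a commutative ring $R$, two matrices $M,N\in\mathrm{Mat}_n(R)$ are called similar over $R$ if there exists $U\in\mathrm{GL}_n(R)$ with $UM=NU$. For a number field $K$, $\mathcal{O}_K$ denotes its ring of integers; for a finite place $\mathfrak{p}$, $K_{\mathfrak{p}}$ is the completion and $\mathcal{O}_{K_{\mathfrak{p}}}$ its ring of integers; for an infinite place $\mathfrak{p}$ one sets $\mathcal{O}_{K_{\mathfrak{p}}}:=K_{\mathfrak{p}}$. $\mathrm{ch}(M)$ denotes the characteristic polynomial of $M$. For $M,N\in\mathrm{Mat}_n(\mathcal{O}_K)$ that are similar over $\mathcal{O}_{K_{\mathfrak{p}}}$ for every finite place $\mathfrak{p}$ of $K$, define \[C_K(M,N):=\min\{[L:K] : L/K \text{ is a finite extension such that } M,N \text{ are similar over } \mathcal{O}_L\}\] (such an $L$ exists by a theorem of Guralnick). *)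

(* Defs.v *)
From HB Require Import structures.
From mathcomp Require Import all_boot all_order all_algebra all_field.
From mathcomp Require Import reals Rstruct.
Set Implicit Arguments.
Unset Strict Implicit.
Unset Printing Implicit Defensive.
Import Order.TTheory GRing.Theory Num.Theory.
Local Open Scope ring_scope.

Notation RR := (Rdefinitions.R : realType).

(* A number field is a K : fieldExtType rat. *)
Definition integral (F : fieldType) (x : F) : Prop :=
  integralOver (intr : int -> F) x.

Definition mx_over (F : fieldType) (S : F -> Prop) m n (A : 'M[F]_(m, n)) :=
  forall i j, S (A i j).

(* S is meant to be a subring of F, so U ranges over GL_n(S). *)
Definition similar_over (F : fieldType) (S : F -> Prop) n (M N : 'M[F]_n) :=
  exists U : 'M[F]_n,
    [/\ U \in unitmx, mx_over S U, mx_over S (invmx U) & U *m M = N *m U].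

Definition absolute_value (F : fieldType) (v : F -> RR) : Prop :=
  [/\ forall x, 0 <= v x,
      forall x, v x = 0 <-> x = 0,
      forall x y, v (x * y) = v x * v y &
      forall x y, v (x + y) <= v x + v y].

Definition nonarchimedean (F : fieldType) (v : F -> RR) : Prop :=
  forall x y, v (x + y) <= Num.max (v x) (v y).

(* A place is given by a nontrivial absolute value. Equivalent absolute values
   have the same completion and the same ring of local integers, so quantifying
   over absolute values amounts to quantifying over places. The finite places
   are the nonarchimedean ones. *)
Definition place (F : fieldType) (v : F -> RR) : Prop :=
  absolute_value v /\ exists2 x, x != 0 & v x <> 1.

Definition cauchy_for (F : fieldType) (w : F -> RR) (u : nat -> F) : Prop :=
  forall e : RR, 0 < e -> exists k : nat, forall i j : nat,
    (k <= i)%N -> (k <= j)%N -> w (u i - u j) < e.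

Definition converges_for (F : fieldType) (w : F -> RR) (u : nat -> F) (l : F) :=
  forall e : RR, 0 < e -> exists k : nat, forall i : nat,
    (k <= i)%N -> w (u i - l) < e.

Definition completion (K : fieldType) (v : K -> RR)
    (F : fieldType) (w : F -> RR) (iota : {rmorphism K -> F}) : Prop :=
  [/\ absolute_value w,
      forall x, w (iota x) = v x,
      forall (y : F) (e : RR), 0 < e -> exists x : K, w (y - iota x) < e &
      forall u, cauchy_for w u -> exists l, converges_for w u l].

(* The unit ball if w is nonarchimedean, the whole field otherwise. *)
Definition local_integer (F : fieldType) (w : F -> RR) (x : F) : Prop :=
  nonarchimedean w -> w x <= 1.

(* The completion of (K, v) is unique up to isometric K-isomorphism, so it does
   not matter which one is used. *)
Definition similar_at (K : fieldType) (v : K -> RR) n (M N : 'M[K]_n) : Prop :=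
  exists (F : fieldType) (w : F -> RR) (iota : {rmorphism K -> F}),
    completion v w iota /\
    similar_over (local_integer w) (map_mx iota M) (map_mx iota N).

Definition similar_in_extension (K : fieldType) (L : fieldExtType K) n
    (M N : 'M[K]_n) : Prop :=
  similar_over (@integral L) (map_mx (in_alg L) M) (map_mx (in_alg L) N).

(* d = C_K(M, N); as a relation, it also says that the set of degrees whose
   minimum is taken is nonempty. *)
Definition is_CK (K : fieldType) n (M N : 'M[K]_n) (d : nat) : Prop :=
  (exists2 L : fieldExtType K, similar_in_extension L M N & \dim {:L} = d) /\
  (forall L : fieldExtType K, similar_in_extension L M N -> (d <= \dim {:L})%N).

(* Total recursive functions; cons_tuple m t is the tuple (m, t_1, ..., t_k).
   The constructors for composition, primitive recursion and (regular)
   minimization characterize the new function pointwise. *)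
Inductive recursive : forall k : nat, (k.-tuple nat -> nat) -> Prop :=
| rec_zero k (h : k.-tuple nat -> nat) :
    (forall t, h t = 0%N) -> recursive h
| rec_succ (h : 1.-tuple nat -> nat) :
    (forall t, h t = (tnth t ord0).+1) -> recursive h
| rec_proj k (i : 'I_k) (h : k.-tuple nat -> nat) :
    (forall t, h t = tnth t i) -> recursive h
| rec_comp k l (f : l.-tuple nat -> nat) (g : 'I_l -> k.-tuple nat -> nat)
    (h : k.-tuple nat -> nat) :
    recursive f -> (forall i, recursive (g i)) ->
    (forall t, h t = f [tuple g i t | i < l]) -> recursive h
| rec_primrec k (f : k.-tuple nat -> nat) (g : k.+2.-tuple nat -> nat)
    (h : k.+1.-tuple nat -> nat) :
    recursive f -> recursive g ->
    (forall t, h (cons_tuple 0%N t) = f t) ->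
    (forall m t, h (cons_tuple m.+1 t) =
                 g (cons_tuple m (cons_tuple (h (cons_tuple m t)) t))) ->
    recursive h
| rec_mu k (f : k.+1.-tuple nat -> nat) (h : k.-tuple nat -> nat) :
    recursive f ->
    (forall t, f (cons_tuple (h t) t) = 0%N) ->
    (forall t m, (m < h t)%N -> f (cons_tuple m t) <> 0%N) ->
    recursive h.

Definition computable (f : nat -> nat) : Prop :=
  recursive (fun t : 1.-tuple nat => f (tnth t ord0)).

(* Finite data for a pair (K, chi): a defining polynomial p of K over Q,
   together with the coefficients of chi written as rational polynomials in a
   root a of p which generates K. *)
Definition presents (K : fieldExtType rat) (chi : {poly K})
    (p : {poly rat}) (q : {poly {poly rat}}) : Prop :=
  exists a : K,
    [/\ <<1; a>>%VS = fullv, irreducible_poly p, horner_alg a p = 0 &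
        map_poly (horner_alg a) q = chi].

Definition encode_rat (r : rat) : seq nat :=
  [:: nat_of_bool (numq r < 0); `|numq r|%N; `|denq r|%N].

(* Lists are preceded by their length, so that encodings can be parsed. *)
Definition encode_poly (p : {poly rat}) : seq nat :=
  size p :: flatten [seq encode_rat c | c <- p].

Definition encode (n : nat) (p : {poly rat}) (q : {poly {poly rat}}) : nat :=
  CodeSeq.code
    (n :: encode_poly p ++ size q :: flatten [seq encode_poly c | c <- q]).

(* C (K, n, chi) is effective: one algorithm computes it, for all (K, n, chi) in
   the given domain D, from any presentation of (K, chi). *)
Definition effective
    (D : forall K : fieldExtType rat, nat -> {poly K} -> Prop)
    (C : forall K : fieldExtType rat, nat -> {poly K} -> nat) : Prop :=
  exists f : nat -> nat, computable f /\
    forall (K : fieldExtType rat) (n : nat) (chi : {poly K}), D K n chi ->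
    forall p q, presents chi p q -> f (encode n p q) = C K n chi.

Definition admissible (K : fieldExtType rat) (n : nat) (chi : {poly K}) : Prop :=
  [/\ (1 <= n)%N, forall i, integral chi`_i,
      chi \is monic, separable_poly chi & size chi = n.+1].

(* Main.v *)
Require Import Defs.
From HB Require Import structures.
From mathcomp Require Import all_boot all_order all_algebra all_field.
From mathcomp Require Import boolp classical_sets.
From mathcomp Require Import reals Rstruct.
From mathcomp Require Import zify ring lra.
Set Implicit Arguments.
Unset Strict Implicit.
Unset Printing Implicit Defensive.
Import Order.TTheory GRing.Theory Num.Theory.
Local Open Scope ring_scope.

(** Embed [K] in the algebraic numbers, and let [S] be a Galois stable system of
    algebraic integers generating a field [Q] that contains [K] and the roots of
    [chi].  The degree bound depends only on the size of [S] and on a bound on the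
    absolute values of its members; it comes from the finiteness of the class
    number, as follows.

    Finiteness of ideal classes, in the form of an effective box principle for the
    order generated by [S], gives an exponent [h] such that every finitely
    generated fractional ideal of [Q] becomes principal after adjoining an [h]-th
    root of an element of [Q] (QS_gcd, generated_field).  Ideals of the ring of all
    algebraic integers are handled through valuation rings: by the extension
    theorem of Chevalley an algebraic number is integral as soon as it lies in all
    of them, and an ideal contained in none of their maximal ideals is the unit
    ideal (AintP, Aint_ideal1).

    Let [m] be a multiple of the discriminant of [S].  A valuation ring above [m]
    induces a finite place of [K] (valring_place).  The matrices that conjugate [M]
    to [N] form a linear space defined over [K], so approximating a conjugator over
    the completion yields one over [K] which is invertible at this place
    (similar_at_approx).  After clearing denominators with an [h]-th root and
    combining finitely many such matrices by means of elements idempotent modulo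
    [m], one obtains an integral conjugator [U0] over [Q] whose determinant is prime
    to [m] (prime_conjugator).

    It remains to correct [U0] away from [m].  As [chi] is separable, [U0] is the sum
    of its restrictions [W i] to the eigenspaces of [M], and the sums of multiples
    of the [W i] are conjugators too.  Let [g i] be a gcd of the determinant of [U0]
    and of the entries of [m *: W i]; some power of bounded exponent of [g i] is 1
    modulo [m], and an explicit equation then produces an algebraic unit [e i]
    congruent to [g i] modulo [m] (unit_in_class).  The sum of the
    [(e i / g i) *: W i] is integral with unit determinant at every valuation
    (unit_conjugator).  Its entries lie in an extension of [K] of bounded degree
    (similar_in_bounded_extension).

    A bound that depends on [K] and [chi] only is obtained from a presentation of
    this pair of the least possible size, where the size bounds the lengths and the
    coefficients of the polynomials involved (presentation_system).  To compute
    this size from an arbitrary presentation, with generator [a], one has to decide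
    whether a presentation of given size exists.  The coordinates with respect to
    [a] of the generator [y] of such a presentation, and conversely, are bounded
    explicitly by Lagrange interpolation (bounded_coordinates), so a bounded search
    among polynomials modulo the minimal polynomial of [a] is enough
    (presentable_testP).  This search is recursive: functions on lists and rational
    numbers are realized by recursive functions on codes, with the pairing function
    that codes lists. *)

(** * Valuation rings *)

(** A valuation ring of a field: a subring containing x or its inverse, for
    every x. *)
Record valring (F : fieldType) := ValRing {
  vring :> subringClosed F;
  vringP : forall x : F, (x \in vring) || (x^-1 \in vring)
}.

Section Chevalley.

Variables (F : fieldType) (R0 a : {pred F}).
Hypothesis R0_ring : subring_closed R0.
Hypothesis a_sub : {subset a <= R0}.
Hypothesis a_add : forall x y, x \in a -> y \in a -> x + y \in a.
Hypothesis a_mul : forall r x, r \in R0 -> x \in a -> r * x \in a.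
Hypothesis a_proper : 1 \notin a.

(** The ideal generated by [a] in a ring [R]. *)
Let J (R : set F) (x : F) := exists s : seq (F * F),
  (forall u, u \in s -> u.1 \in a /\ R u.2) /\ x = \sum_(u <- s) u.1 * u.2.

Let ring (R : set F) :=
  [/\ R 1, forall x y, R x -> R y -> R (x - y) & forall x y, R x -> R y -> R (x * y)].

(** The rings containing [R0] in which the ideal generated by [a] stays proper; a
    maximal one is a valuation ring. *)
Let good (R : set F) := [/\ ring R, forall x, x \in R0 -> R x & ~ J R 1].

Let J_add R x y : J R x -> J R y -> J R (x + y).
Proof.
move=> [s [sP ->]] [t [tP ->]]; exists (s ++ t); split; last by rewrite big_cat.
by move=> u; rewrite mem_cat => /orP[/sP|/tP].
Qed.

Let J_mul R x r : ring R -> R r -> J R x -> J R (r * x).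
Proof.
move=> [_ _ RM] Rr [s [sP ->]]; exists [seq (u.1, r * u.2) | u <- s]; split.
  by move=> u /mapP[v /sP[v1 v2] ->] /=; split=> //; apply: RM.
by rewrite big_map mulr_sumr; apply: eq_bigr => u _ /=; rewrite mulrCA.
Qed.

Let J0 R : J R 0.
Proof. by exists [::]; rewrite big_nil. Qed.

Let ring0 R : ring R -> R 0.
Proof. by move=> [R1 RB _]; rewrite -(subrr 1); apply: RB. Qed.

Let ringN R x : ring R -> R x -> R (- x).
Proof. by move=> rR Rx; rewrite -sub0r; case: (rR) => _ + _; apply=> //; apply: ring0. Qed.

Let ringD R x y : ring R -> R x -> R y -> R (x + y).
Proof.
by move=> rR Rx Ry; rewrite -[y]opprK; case: (rR) => _ + _; apply=> //; apply: ringN.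
Qed.

Let ringX R x n : ring R -> R x -> R (x ^+ n).
Proof.
move=> [R1 _ RM] Rx; elim: n => [|n IHn]; first by rewrite expr0.
by rewrite exprS; apply: RM.
Qed.

Let J_sub R x : good R -> J R x -> R x.
Proof.
move=> [rR R0R _] [s [+ ->]]; elim: s => [|u s IHs] sP; first by rewrite big_nil; apply: ring0.
rewrite big_cons; apply: ringD => //; last first.
  by apply: IHs => v vs; apply: sP; rewrite inE vs orbT.
have [] := sP u; first by rewrite inE eqxx.
by move=> ua Ru; case: rR => _ _; apply=> //; apply/R0R/a_sub.
Qed.

Let good_R0 : good (fun x => x \in R0).
Proof.
split=> //; move=> [s [sP /esym s1]]; move: a_proper; rewrite -s1 => /negP; apply.
have a0 : 0 \in a.
  case: s s1 sP => [|u s _ /(_ u)[]//]; first by rewrite big_nil => /eqP; rewrite eq_sym oner_eq0.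
    by rewrite inE eqxx.
  move=> ua _; rewrite -(mul0r u.1); apply: a_mul => //.
  by rewrite -(subrr 1); case: R0_ring => R1 RB _; apply: RB.
elim: s {s1} sP => [|u s IHs] sP; first by rewrite big_nil.
rewrite big_cons; apply: a_add; last by apply: IHs => v vs; apply: sP; rewrite inE vs orbT.
by rewrite mulrC; have [|ua Ru] := sP u; [rewrite inE eqxx | apply: a_mul].
Qed.

Let max_good : exists R, good R /\ forall R', good R' -> (forall x, R x -> R' x) ->
  forall x, R' x -> R x.
Proof.
suff /Zorn_bigcup[A [PA maxA]] : forall C : set (set F),
    (C `<=` (fun R => R = set0 \/ good R))%classic -> total_on C subset ->
    (\bigcup_(X in C) X)%classic = set0 \/ good (\bigcup_(X in C) X)%classic.
  have gA : good A.
    case: PA => // A0; exfalso; apply: (maxA (fun x => x \in R0)); last by right; apply: good_R0.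
    by rewrite A0; split=> [x []|/(_ 1)]; apply; case: R0_ring.
  exists A; split=> // R' gR' AR' x R'x; apply: contrapT => nAx.
  by apply: (maxA R'); [split=> // sub; apply: nAx; apply: sub | right].
move=> C CP totC; case: (EM (exists2 R, C R & good R)) => [[R1 CR1 gR1]|noR]; last first.
  left; apply/seteqP; split=> x // -[R CR Rx].
  by have [R_0|gR] := CP R CR; [rewrite R_0 in Rx | case: noR; exists R].
right; have CP' R x : C R -> R x -> good R.
  by move=> CR Rx; have [R_0|//] := CP R CR; rewrite R_0 in Rx.
have two x y : (\bigcup_(X in C) X)%classic x -> (\bigcup_(X in C) X)%classic y ->
    exists R, [/\ C R, good R, R x & R y].
  move=> [R CR Rx] [R' CR' R'y]; have [sub|sub] := totC _ _ CR CR'.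
    by exists R'; split=> //; [apply: CP' R'y | apply: sub].
  by exists R; split=> //; [apply: CP' Rx | apply: sub].
split.
- split; first by exists R1 => //; case: gR1 => -[].
    by move=> x y Ux Uy; have [R [CR [[_ RB _] _ _] Rx Ry]] := two _ _ Ux Uy; exists R => //; apply: RB.
  by move=> x y Ux Uy; have [R [CR [[_ _ RM] _ _] Rx Ry]] := two _ _ Ux Uy; exists R => //; apply: RM.
- by move=> x R0x; exists R1 => //; case: gR1 => _ + _; apply.
move=> [s [sP s1]].
have [R [CR gR sR]] : exists R, [/\ C R, good R & forall u, u \in s -> u.1 \in a /\ R u.2].
  elim: s sP {s1} => [|u s IHs] sP; first by exists R1.
  have [v vs|R [CR gR sR]] := IHs; first by apply: sP; rewrite inE vs orbT.
  have [|ua [R' CR' R'u]] := sP u; first by rewrite inE eqxx.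
  have [sub|sub] := totC _ _ CR CR'.
    exists R'; split=> //; first exact: CP' R'u.
    move=> v; rewrite inE => /orP[/eqP->//|/sR[va Rv]]; split=> //; exact: sub.
  exists R; split=> // v; rewrite inE => /orP[/eqP->|/sR//]; split=> //; exact: sub.
by case: gR => _ _; apply; exists s.
Qed.

Section Maximal.

Variable R : set F.
Hypotheses (gR : good R)
  (maxR : forall R', good R' -> (forall x, R x -> R' x) -> forall x, R' x -> R x).

Let rR : ring R. Proof. by case: gR. Qed.

Let one_sub b : J R b -> R (1 - b)^-1 /\ 1 - b != 0.
Proof.
move=> Jb; have b1 : 1 - b != 0.
  by apply/eqP=> /eqP; rewrite subr_eq0 => /eqP b1; case: gR => _ _; rewrite b1.
split=> //; pose R' x := exists k, R (x * (1 - b) ^+ k).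
have R1b : R (1 - b) by case: rR => R1 RB _; apply: RB => //; apply: J_sub.
have up x k l : R (x * (1 - b) ^+ k) -> R (x * (1 - b) ^+ (k + l)%N).
  by move=> Rx; rewrite exprD mulrA; case: (rR) => _ _; apply=> //; apply: ringX.
apply: (maxR (R' := R')); last 1 first.
- by exists 1; rewrite expr1 mulVf //; case: rR.
- split.
  + split; first by exists 0%N; rewrite expr0 mulr1; case: rR.
      move=> x y [k Rx] [l Ry]; exists (k + l)%N; rewrite mulrBl; case: (rR) => _ RB _.
      by apply: RB; [apply: up | rewrite addnC; apply: up].
    move=> x y [k Rx] [l Ry]; exists (k + l)%N; rewrite exprD mulrACA.
    by case: (rR) => _ _; apply.
  + by move=> x R0x; exists 0%N; rewrite expr0 mulr1; case: gR => _ + _; apply.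
  + move=> [s [sP s1]].
  have [k Jk] : exists k, J R ((1 - b) ^+ k).
    suff [k Jk] : exists k, J R ((1 - b) ^+ k * \sum_(u <- s) u.1 * u.2).
      by exists k; rewrite -s1 mulr1 in Jk.
    elim: s sP {s1} => [|u s IHs] sP; first by exists 0%N; rewrite big_nil mulr0.
    have [v vs|k Jk] := IHs; first by apply: sP; rewrite inE vs orbT.
    have [|ua [l Rl]] := sP u; first by rewrite inE eqxx.
    exists (k + l)%N; rewrite big_cons mulrDr; apply: J_add; last first.
      by rewrite exprD [_ ^+ k * _]mulrC -mulrA; apply: J_mul => //; apply: ringX.
    exists [:: (u.1, u.2 * (1 - b) ^+ (k + l)%N)]; split.
      by move=> v; rewrite inE => /eqP -> /=; split=> //; rewrite addnC; apply: up.
    by rewrite big_seq1 /=; ring.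
  case: (gR) => _ _; apply; elim: k Jk => [|k IHk]; first by rewrite expr0.
  move=> Jk; apply: IHk; rewrite -[_ ^+ k]mul1r -{1}[1](subrK b) mulrDl -exprS.
  by apply: J_add => //; rewrite mulrC; apply: J_mul => //; apply: ringX.
- by move=> x Rx; exists 0%N; rewrite expr0 mulr1.
Qed.

Let poly_one x : ~ R x -> exists2 p : {poly F}, forall i, J R p`_i & p.[x] = 1.
Proof.
move=> nRx; pose R' z := exists2 p : {poly F}, forall i, R p`_i & p.[x] = z.
have RR' z : R z -> R' z.
  move=> Rz; exists z%:P; last by rewrite hornerC.
  by move=> i; rewrite coefC; case: eqP => // _; apply: ring0.
have [gR'|ngR'] := EM (good R').
  case: nRx; apply: (maxR gR') => //; exists 'X; last by rewrite hornerX.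
  by move=> i; rewrite coefX; case: eqP => _; [case: rR | apply: ring0].
have : J R' 1.
  apply: contrapT => nJ; apply: ngR'; split=> //; last first.
    by move=> z R0z; apply: RR'; case: gR => _ + _; apply.
  split; first by apply: RR'; case: rR.
    move=> _ _ [p Rp <-] [q Rq <-]; exists (p - q); last by rewrite hornerD hornerN.
    by move=> i; rewrite coefB; case: rR => _ + _; apply.
  move=> _ _ [p Rp <-] [q Rq <-]; exists (p * q); last by rewrite hornerM.
  move=> i; rewrite coefM; apply: big_ind; [exact: ring0 | by move=> *; apply: ringD|].
  by move=> j _; case: rR => _ _; apply.
move=> [s [sP ->]]; elim: s sP => [|u s IHs] sP.
  by exists 0; rewrite ?big_nil ?horner0 // => i; rewrite coef0.
have [v vs|q Jq Eq] := IHs; first by apply: sP; rewrite inE vs orbT.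
have [|ua [p Rp Ep]] := sP u; first by rewrite inE eqxx.
exists (u.1 *: p + q); last by rewrite big_cons hornerD hornerZ Eq Ep.
move=> i; rewrite coefD coefZ; apply: J_add => //; exists [:: (u.1, p`_i)].
by rewrite big_seq1; split=> // v; rewrite inE => /eqP -> /=; split.
Qed.

(** Two relations of minimal degree, one in [x] and one in its inverse: the
    longer one can be shortened with the help of the other. *)
Let no_pair x (p q : {poly F}) : x != 0 -> (size q <= size p)%N ->
  (forall i, J R p`_i) -> (forall i, J R q`_i) -> p.[x] = 1 -> q.[x^-1] = 1 ->
  exists2 p' : {poly F}, (size p' < size p)%N & (forall i, J R p'`_i) /\ p'.[x] = 1.
Proof.
move=> x0 szqp Jp Jq Ep Eq.
have p0 : p != 0 by apply/eqP=> p0; move: Ep; rewrite p0 horner0 => /eqP; rewrite eq_sym oner_eq0.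
have q0 : q != 0 by apply/eqP=> q0; move: Eq; rewrite q0 horner0 => /eqP; rewrite eq_sym oner_eq0.
set n := (size p).-1; have Dn : size p = n.+1 by rewrite prednK // size_poly_gt0.
have [Rinv nz] := one_sub (Jq 0).
pose c i := q`_i * (1 - q`_0)^-1.
have Jc i : J R (c i) by rewrite /c mulrC; apply: J_mul.
have Exn : x ^+ n = \sum_(1 <= j < n.+1) c j * x ^+ (n - j).
  have: 1 - q`_0 = \sum_(1 <= j < n.+1) q`_j * x^-1 ^+ j.
    rewrite -Eq (horner_coef_wide (n := n.+1)) -?Dn // Dn -(big_mkord xpredT (fun j => q`_j * x^-1 ^+ j)).
    by rewrite big_nat_recl // expr0 mulr1 addrAC subrr add0r big_add1.
  move=> /(congr1 (fun z => z * (1 - q`_0)^-1 * x ^+ n)); rewrite mulfV // mul1r => ->.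
  rewrite mulr_suml mulr_suml !big_nat; apply: eq_bigr => j /andP[_ jn].
  rewrite /c -[n in LHS](@subnK j) // exprD exprVn.
  have : x ^+ j != 0 by rewrite expf_neq0.
  by move=> xj; field; rewrite xj nz.
pose t := \poly_(i < n) (p`_i + p`_n * c (n - i)%N).
exists t; first by rewrite Dn ltnS size_poly.
split.
  move=> i; rewrite coef_poly; case: ltnP => _ //; apply: J_add => //.
  by apply: J_mul => //; apply: J_sub.
rewrite -Ep horner_poly (horner_coef p) Dn big_ord_recr /= Exn mulr_sumr.
under eq_bigr do rewrite mulrDl; rewrite big_split /=; congr (_ + _).
rewrite big_add1 /= big_mkord (reindex_inj rev_ord_inj) /=; apply: eq_bigr => i _.
by rewrite mulrA; congr (_ * c _ * _); have := ltn_ord i; lia.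
Qed.

Let max_val x : R x \/ R x^-1.
Proof.
have [-> | x0] := eqVneq x 0; first by left; apply: ring0.
apply: contrapT => /not_orP[nRx nRxV].
have [p Jp Ep] := poly_one nRx; have [q Jq Eq] := poly_one nRxV.
have [m] := ubnP (size p + size q).
elim: m x x0 p q {nRx nRxV} Jp Jq Ep Eq => // m IHm x x0 p q Jp Jq Ep Eq; rewrite ltnS => lem.
have [szqp|szpq] := leqP (size q) (size p).
  have [p' sz' [Jp' Ep']] := no_pair x0 szqp Jp Jq Ep Eq.
  by apply: (IHm x x0 p' q) => //; apply: leq_trans lem; rewrite ltn_add2r.
have xV0 : x^-1 != 0 by rewrite invr_eq0.
have [|q' sz' [Jq' Eq']] := no_pair xV0 (ltnW szpq) Jq Jp Eq; first by rewrite invrK.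
by apply: (IHm x x0 p q') => //; apply: leq_trans lem; rewrite ltn_add2l.
Qed.

Lemma maximal_valring : exists V : valring F, {subset R0 <= V} /\
  (forall x, x \in a -> x \in V /\ (x != 0 -> x^-1 \notin V)).
Proof.
pose P : {pred F} := fun x => `[< R x >].
have PP x : reflect (R x) (x \in P) by rewrite unfold_in; apply: asboolP.
have Pring : subring_closed P.
  by split=> [|x y /PP Rx /PP Ry|x y /PP Rx /PP Ry]; apply/PP; case: rR => *; auto.
pose PM := GRing.isSubringClosed.Build _ P Pring.
pose PR : subringClosed F := HB.pack P PM.
have PV x : (x \in PR) || (x^-1 \in PR).
  by case: (max_val x) => /PP Rx; rewrite -[_ \in PR]/(_ \in P) Rx // orbT.
exists (ValRing PV); split=> [x R0x|x ax]; first by apply/PP; case: gR => _ + _; apply.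
split; first by apply/PP; case: gR => _ + _; apply; apply: a_sub.
move=> x0; apply/PP => RxV; case: gR => _ _; apply; exists [:: (x, x^-1)].
by rewrite big_seq1 mulfV //; split=> // u; rewrite inE => /eqP ->.
Qed.

End Maximal.

(** Chevalley's extension theorem. *)
Theorem chevalley : exists V : valring F, {subset R0 <= V} /\
  (forall x, x \in a -> x \in V /\ (x != 0 -> x^-1 \notin V)).
Proof. by have [R [gR maxR]] := max_good; apply: (maximal_valring gR maxR). Qed.

End Chevalley.

(** The maximal ideal of a valuation ring. *)
Definition vmax (F : fieldType) (V : valring F) : {pred F} :=
  fun x => (x \in V) && ((x == 0) || (x^-1 \notin V)).

(** The units of a valuation ring. *)
Definition vunit (F : fieldType) (V : valring F) : {pred F} :=
  fun x => [&& x != 0, x \in V & x^-1 \in V].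

Section ValuationTheory.

Variables (F : fieldType) (V : valring F).
Implicit Types x y : F.

Lemma vmax_sub x : x \in vmax V -> x \in V.
Proof. by case/andP. Qed.

Lemma vunit_sub x : x \in vunit V -> x \in V.
Proof. by case/and3P. Qed.

Lemma vunit_neq0 x : x \in vunit V -> x != 0.
Proof. by case/and3P. Qed.

Lemma vunitE x : x \in V -> (x \in vunit V) = (x \notin vmax V).
Proof. by rewrite /vunit /vmax !unfold_in => ->; rewrite negb_or negbK. Qed.

Lemma vunitN_vmax x : x \in vunit V -> x \notin vmax V.
Proof. by move=> ux; rewrite -vunitE // vunit_sub. Qed.

Lemma vunitV x : x \in vunit V -> x^-1 \in vunit V.
Proof. by case/and3P=> x0 xV xiV; apply/and3P; rewrite invr_eq0 invrK. Qed.

Lemma vunitM x y : x \in vunit V -> y \in vunit V -> x * y \in vunit V.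
Proof.
case/and3P=> x0 xV xiV /and3P[y0 yV yiV]; apply/and3P; rewrite mulf_neq0 // invfM.
by split=> //; apply: rpredM.
Qed.

Lemma vunit_div x y : x \in vunit V -> y \in vunit V -> x / y \in vunit V.
Proof. by move=> ux /vunitV; apply: vunitM. Qed.

Lemma vunit1 : 1 \in vunit V.
Proof. by apply/and3P; rewrite oner_eq0 invr1 rpred1. Qed.

Lemma vunitX x n : x \in vunit V -> x ^+ n \in vunit V.
Proof.
by move=> ux; elim: n => [|n IHn]; rewrite ?expr0 ?vunit1 // exprS vunitM.
Qed.

Lemma vunit_prod (I : Type) (r : seq I) (P : pred I) (f : I -> F) :
  (forall i, P i -> f i \in vunit V) -> \prod_(i <- r | P i) f i \in vunit V.
Proof. by move=> uf; apply: (big_ind (fun x => x \in vunit V)) => //; [exact: vunit1 | exact: vunitM]. Qed.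

Lemma vring_vunit x : x != 0 -> x \notin V -> x^-1 \in vmax V.
Proof.
move=> x0 xV; rewrite unfold_in invr_eq0 invrK xV orbT andbT.
by have := vringP V x; rewrite (negPf xV).
Qed.

Lemma vmax0 : 0 \in vmax V.
Proof. by rewrite unfold_in eqxx rpred0. Qed.

Lemma vmax1 : 1 \notin vmax V.
Proof. exact/vunitN_vmax/vunit1. Qed.

Lemma vmaxM x y : x \in V -> y \in vmax V -> x * y \in vmax V.
Proof.
move=> xV /andP[yV y1]; rewrite unfold_in rpredM //= mulf_eq0 invfM.
have [-> //|x0] := eqVneq x 0; case/orP: y1 => [->//|yiV]; apply/orP; right.
by apply: contra yiV => xyV; rewrite -[y^-1](mulVKf x0) rpredM.
Qed.

Lemma vmaxMr x y : x \in V -> y \in vmax V -> y * x \in vmax V.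
Proof. by rewrite mulrC; apply: vmaxM. Qed.

Lemma vmax_zmod : zmod_closed (vmax V).
Proof.
split=> [|x y mx my]; first exact: vmax0.
have [-> | x0] := eqVneq x 0.
  by rewrite sub0r -mulN1r vmaxM // rpredN rpred1.
have [-> | y0] := eqVneq y 0; first by rewrite subr0.
case/orP: (vringP V (x / y)) => [xyV|].
  by rewrite -[x](divfK y0) -[X in _ - X]mul1r -mulrBl vmaxM // rpredB ?rpred1.
rewrite invf_div => yxV.
by rewrite -[y](divfK x0) -{1}[x]mul1r -mulrBl vmaxM // rpredB ?rpred1.
Qed.
HB.instance Definition _ := GRing.isZmodClosed.Build F (vmax V) vmax_zmod.

Lemma vmaxX x n : (0 < n)%N -> x \in vmax V -> x ^+ n \in vmax V.
Proof. by case: n => // n _ mx; rewrite exprSr vmaxM // rpredX // vmax_sub. Qed.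

Lemma vringX_inv x n : (0 < n)%N -> x ^+ n \in V -> x \in V.
Proof.
move=> n0 xnV; apply: contraT => xV.
have x0 : x != 0 by apply: contra xV => /eqP ->; rewrite rpred0.
have /(vmaxX n0)/(vmaxM xnV) := vring_vunit x0 xV.
by rewrite exprVn mulfV ?expf_neq0 // (negPf vmax1).
Qed.

Lemma vunitX_inv x n : (0 < n)%N -> x ^+ n \in vunit V -> x \in vunit V.
Proof.
move=> n0 /and3P[xn0 xnV xnVV]; apply/and3P; split.
- by apply: contra xn0 => /eqP ->; rewrite expr0n; case: n n0 {xnV xnVV}.
- exact: vringX_inv xnV.
- by apply: (vringX_inv n0); rewrite exprVn.
Qed.

Lemma vmax_prime x y : x \in V -> y \in V -> x * y \in vmax V ->
  (x \in vmax V) || (y \in vmax V).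
Proof.
move=> xV yV; apply: contraTT; rewrite negb_or -!vunitE ?rpredM //.
by case/andP; apply: vunitM.
Qed.

Lemma vunit_congr x y : x \in vunit V -> x - y \in vmax V -> y \in vunit V.
Proof.
move=> ux mxy; have yV : y \in V by rewrite -[y](subKr x) rpredB ?(vunit_sub ux) ?(vmax_sub mxy).
rewrite vunitE //; apply: contra (vunitN_vmax ux) => my.
by rewrite -(subrK y x) rpredD.
Qed.

Lemma vmax_congrX x y n : x \in V -> y \in V -> x - y \in vmax V ->
  x ^+ n - y ^+ n \in vmax V.
Proof.
move=> xV yV mxy; rewrite subrXX vmaxMr // rpred_sum // => i _.
by rewrite rpredM ?rpredX.
Qed.

Lemma vunit_dvd x y : x \in V -> y \in V -> x * y \in vunit V -> x \in vunit V.
Proof.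
move=> xV yV uxy; rewrite vunitE //; apply: contraL (vunitN_vmax uxy) => mx.
by rewrite negbK vmaxMr.
Qed.

(** Divisibility in a valuation ring being total, a finite family has a
    greatest common divisor among its members. *)
Lemma vring_gcd (s : seq F) : (exists2 x, x \in s & x != 0) ->
  exists2 x, x \in s /\ x != 0 & forall y, y \in s -> y / x \in V.
Proof.
elim: s => [[x]//|z s IHs] [x]; rewrite inE => /predU1P xs x0.
have [/hasP[x1 x1s x10]|/hasPn s0] := boolP (has (fun u => u != 0) s).
  have [|u [us u0] uP] := IHs; first by exists x1.
  case/orP: (vringP V (z / u)) => [zuV|].
    exists u => [|y]; first by rewrite inE us orbT.
    by rewrite inE => /predU1P[->|/uP].
  rewrite invf_div => uzV; have [z0|z0] := eqVneq z 0.
    exists u => [|y]; first by rewrite inE us orbT.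
    by rewrite inE => /predU1P[->|/uP//]; rewrite z0 mul0r rpred0.
  exists z => [|y]; first by rewrite inE eqxx.
  rewrite inE => /predU1P[->|/uP yu]; first by rewrite mulfV // rpred1.
  by rewrite -[y](divfK u0) -(mulrA (y / u)) rpredM.
have zx : z = x by case: xs => // /s0; rewrite x0.
exists z; first by rewrite inE eqxx zx.
move=> y; rewrite inE => /predU1P[->|/s0]; first by rewrite mulfV ?rpred1 // zx.
by rewrite negbK => /eqP->; rewrite mul0r rpred0.
Qed.

Lemma vring_integral (p : {poly F}) x :
  p \is monic -> p \is a polyOver V -> root p x -> x \in V.
Proof.
move=> mon_p /polyOverP Vp px0; apply: contraT => xV.
have x0 : x != 0 by apply: contra xV => /eqP ->; rewrite rpred0.
have xiV := vmax_sub (vring_vunit x0 xV).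
have p1 : (1 < size p)%N.
  rewrite ltnNge; apply/negP => sz; move: mon_p px0.
  by rewrite (size1_polyC sz) monicE lead_coefC rootE hornerC => /eqP ->; rewrite oner_eq0.
set n := (size p).-2; have Dn : size p = n.+2 by case: (size p) p1 @n => [|[]].
have xn0 : x ^+ n != 0 by rewrite expf_neq0.
have Dx : x = - (\sum_(i < n.+1) p`_i * x^-1 ^+ (n - i)).
  apply: (mulIf xn0); rewrite mulNr -exprS mulr_suml; apply/eqP; rewrite -addr_eq0.
  apply/eqP; move: px0; rewrite /root horner_coef Dn big_ord_recr /=.
  have -> : p`_n.+1 = 1 by move: mon_p; rewrite monicE /lead_coef Dn => /eqP.
  rewrite mul1r addrC => /eqP; rewrite -[X in _ = X -> _]/(0 : F) => E; rewrite -[RHS]E.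
  congr (_ + _); apply: eq_bigr => i _; rewrite -mulrA; congr (_ * _).
  have Di : (n = (n - i) + i)%N by rewrite subnK // -ltnS.
  by rewrite [in x ^+ n]Di exprD mulrA exprVn mulVf ?mul1r // expf_neq0.
by case/negP: xV; rewrite Dx rpredN rpred_sum // => i _; rewrite rpredM ?rpredX.
Qed.

Lemma vmax_congr_prod (I : Type) (r : seq I) (f g : I -> F) :
  (forall i, f i \in V) -> (forall i, g i \in V) ->
  (forall i, f i - g i \in vmax V) ->
  \prod_(i <- r) f i - \prod_(i <- r) g i \in vmax V.
Proof.
move=> fV gV fg; elim: r => [|i r IHr]; first by rewrite !big_nil subrr rpred0.
rewrite !big_cons.
rewrite (_ : _ - _ = (f i - g i) * \prod_(j <- r) f j +
  g i * (\prod_(j <- r) f j - \prod_(j <- r) g j)); last by ring.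
by apply: rpredD; [apply: vmaxMr => //; apply: rpred_prod | apply: vmaxM].
Qed.

Lemma vring_det n (A : 'M[F]_n) : A \is a mxOver V -> \det A \in V.
Proof.
move=> /mxOverP AV; rewrite rpred_sum // => s _; rewrite rpredM //.
  by rewrite rpredX // rpredN rpred1.
by rewrite rpred_prod.
Qed.

Lemma vring_adj n (A : 'M[F]_n) : A \is a mxOver V -> \adj A \is a mxOver V.
Proof.
move=> /mxOverP AV; apply/mxOverP=> i j; rewrite !mxE rpredM ?rpredX ?rpredN ?rpred1 //.
by apply: vring_det; apply/mxOverP=> k l; rewrite !mxE.
Qed.

Lemma vmax_congr_det n (A B : 'M[F]_n) : A \is a mxOver V -> B \is a mxOver V ->
  (forall i j, A i j - B i j \in vmax V) -> \det A - \det B \in vmax V.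
Proof.
move=> /mxOverP AV /mxOverP BV AB; rewrite /determinant -sumrB rpred_sum // => s _.
by rewrite -mulrBr vmaxM ?rpredX ?rpredN ?rpred1 // vmax_congr_prod.
Qed.

End ValuationTheory.

(** * Valuation rings and algebraic integers *)

Lemma integral_Aint x : integralOver (intr : int -> algC) x <-> x \in Aint.
Proof.
split=> [[p mon_p px0]|Ax].
  apply: (root_monic_Aint px0); first exact: monic_map.
  by apply/polyOverP=> i; rewrite coef_map rpred_int.
have [_ [_ _] _] := minCpolyP x.
have /floorpP[p Dp] : minCpoly x \is a polyOver Num.int by [].
have mon_p : p \is monic.
  have := minCpoly_monic x; rewrite Dp !monicE lead_coef_map_inj ?rmorph0 //; last exact: intr_inj.
  by move=> /eqP lp; apply/eqP/(@intr_inj algC); rewrite lp.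
by exists p; rewrite // -Dp root_minCpoly.
Qed.

Lemma monic_Aint_root (p : {poly algC}) x :
  p \is monic -> p \is a polyOver Aint -> root p x -> x \in Aint.
Proof.
move=> mon_p /polyOverP Ap px0; apply/integral_Aint/(integral_root_monic mon_p px0).
by apply/(integral_poly intr) => i; apply/integral_Aint/Ap.
Qed.

Section AintVal.

Variable V : valring algC.

Lemma Aint_vring x : x \in Aint -> x \in V.
Proof.
move=> Ax; apply: (@vring_integral _ V (minCpoly x)); last exact: root_minCpoly.
  exact: minCpoly_monic.
apply: polyOverS (Ax : minCpoly x \is a polyOver Num.int) => _ /intrP[m ->].
exact: rpred_int.
Qed.

End AintVal.

(** An ideal of the ring of algebraic integers that lies in the maximal ideal of
    no valuation ring contains 1. *)
Lemma Aint_ideal1 (a : {pred algC}) : {subset a <= Aint} ->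
  (forall x y, x \in a -> y \in a -> x + y \in a) ->
  (forall r x, r \in Aint -> x \in a -> r * x \in a) ->
  (forall V : valring algC, exists2 x, x \in a & x \notin vmax V) -> 1 \in a.
Proof.
move=> aA aD aM aV; apply: contraT => a1.
have [V [_ Va]] := chevalley Aint_subring aA aD aM a1.
have [x ax] := aV V; rewrite unfold_in; have [-> xV] := Va x ax.
by rewrite negb_or => /andP[/xV ->].
Qed.

(** The algebraic integers are the intersection of the valuation rings. *)
Lemma AintP x : (forall V : valring algC, x \in V) -> x \in Aint.
Proof.
move=> xV; have [-> | x0] := eqVneq x 0; first exact: Aint0.
pose R : {pred algC} := fun z => `[< exists2 p, p \is a polyOver Aint & p.[x^-1] = z >].
pose a : {pred algC} := fun z => `[< exists2 r, r \in R & z = x^-1 * r >].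
have Rring : subring_closed R.
  split=> [|_ _ /asboolP[p Ap <-] /asboolP[q Aq <-]|_ _ /asboolP[p Ap <-] /asboolP[q Aq <-]].
  - by apply/asboolP; exists 1; rewrite ?rpred1 // hornerE.
  - by apply/asboolP; exists (p - q); rewrite ?rpredB // !hornerE.
  - by apply/asboolP; exists (p * q); rewrite ?rpredM // !hornerE.
have Rx : x^-1 \in R by apply/asboolP; exists 'X; rewrite ?polyOverX // hornerX.
have [R1 RB RM] := Rring.
have RD z t : z \in R -> t \in R -> z + t \in R.
  by move=> Rz Rt; rewrite -[t]opprK RB // -sub0r RB // -(subrr 1) RB.
have [a1|a1] := boolP (1 \in a).
  have /asboolP[_ /asboolP[p Ap <-]] := a1.
  move=> E; have {}E : x = p.[x^-1] by rewrite -[LHS]mulr1 [X in _ * X]E mulVKf.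
  case Dn: (size p) (leqnn (size p)) => [|n] _.
    by case/eqP: x0; rewrite E horner_coef Dn big_ord0.
  pose q := 'X^(n.+1) - \poly_(i < n.+1) p`_(n - i).
  apply: (@monic_Aint_root q).
  - rewrite monicE lead_coefDl ?lead_coefXn // size_polyXn ltnS size_polyN.
    exact: size_poly.
  - rewrite rpredB ?rpredX ?polyOverX //; apply/polyOverP=> i; rewrite coef_poly.
    by case: ifP => _; rewrite ?(polyOverP Ap) ?rpred0.
  rewrite /root hornerD hornerN hornerXn horner_poly subr_eq0 exprS {1}E horner_coef Dn.
  rewrite mulr_suml (reindex_inj rev_ord_inj) /=; apply/eqP/eq_bigr => i _.
  have Dm : n = (i + (n - i))%N by rewrite subnKC // -ltnS.
  rewrite subSS -mulrA; congr (_ * _); rewrite [in x ^+ n]Dm exprD exprVn mulrCA mulVf ?mulr1 //.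
  by rewrite expf_neq0.
have aR : {subset a <= R} by move=> _ /asboolP[r Rr ->]; apply: RM.
have aD z t : z \in a -> t \in a -> z + t \in a.
  move=> /asboolP[r Rr ->] /asboolP[u Ru ->]; apply/asboolP.
  by exists (r + u); [apply: RD | rewrite mulrDr].
have aM r z : r \in R -> z \in a -> r * z \in a.
  move=> Rr /asboolP[u Ru ->]; apply/asboolP.
  by exists (r * u); [apply: RM | rewrite mulrCA].
have [V [_ Va]] := chevalley Rring aR aD aM a1.
have [|_] := Va x^-1; first by apply/asboolP; exists 1; rewrite ?mulr1.
by rewrite invr_eq0 x0 invrK xV => /(_ isT).
Qed.
(** * Galois number fields *)

Section GaloisNumberField.

Variables (L : splittingFieldType rat) (phi : {rmorphism L -> algC}).
Notation G := 'Gal({:L} / 1%AS)%g.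

Lemma galois1f : galois 1%AS {:L}.
Proof.
apply/and3P; split; [exact: sub1v| |exact: normalFieldf].
apply/separableP=> x _; apply: pcharf0_separable.
by move=> p; rewrite -(pchar_num rat p) pchar_lalg.
Qed.

Lemma fixed_rat x : (forall g, g \in G -> g x = x) -> exists q : rat, x = ratr q.
Proof.
move=> fx; have : x \in fixedField G by apply/fixedFieldP; rewrite ?memvf.
by rewrite (galois_fixedField galois1f) => /vlineP[q ->]; exists q; rewrite alg_num_field.
Qed.

(** A Galois invariant algebraic integer is a rational integer. *)
Lemma fixed_int x : phi x \in Aint -> (forall g, g \in G -> g x = x) ->
  exists z : int, x = z%:~R.
Proof.
move=> Ax /fixed_rat[q Dq]; move: Ax; rewrite Dq fmorph_rat => Aq.
have /intrP[z Dz] : (ratr q : algC) \in Num.int by apply: Cint_rat_Aint => //; apply: Crat_rat.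
exists z; rewrite -[z%:~R](ratr_int L); congr ratr.
by apply: (fmorph_inj (ratr : rat -> algC)); rewrite /= ratr_int.
Qed.

Lemma gal_Aint (g : gal_of {:L}) x : phi x \in Aint -> phi (g x) \in Aint.
Proof.
have [nu Dnu] := extend_algC_subfield_aut phi (g : {rmorphism L -> L}).
by rewrite Dnu Aint_aut.
Qed.

End GaloisNumberField.

(** * Finiteness of ideal classes *)

Section Order.

Variables (L : splittingFieldType rat) (phi : {rmorphism L -> algC}).
Variables (r : nat) (s : 'I_r -> L) (F : {poly int}) (B : nat).
Notation G := 'Gal({:L} / 1%AS)%g.

Hypotheses (F_monic : F \is monic) (F_size : size F = r.+1)
  (F_root : forall i, root (map_poly intr F) (s i)).
Hypothesis s_gal : forall (g : gal_of {:L}) i, exists j, g (s i) = s j.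
Hypothesis s_bound : forall i, `|phi (s i)| <= B%:R.
Hypothesis B_gt0 : (0 < B)%N.

Notation idx := {ffun 'I_r -> 'I_r}.

Definition monom (e : 'I_r -> nat) : L := \prod_i s i ^+ e i.
Notation mon e := (monom (fun i => nat_of_ord (e i))).

(** The ring generated by the [s i]; it is spanned over the integers by the
    monomials with exponents less than [r]. *)
Definition ZS : {pred L} :=
  fun x => `[< exists c : idx -> int, x = \sum_(e : idx) mon e *~ c e >].

Let intrL_inj : injective (intr : int -> L).
Proof. by move=> m n /(congr1 phi); rewrite !rmorph_int => /intr_inj. Qed.

Let intrL_eq0 (m : int) : (m%:~R == 0 :> L) = (m == 0).
Proof. by rewrite -(inj_eq intrL_inj). Qed.

Lemma ZSP x : reflect (exists c : idx -> int, x = \sum_(e : idx) mon e *~ c e) (x \in ZS).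
Proof. exact: asboolP. Qed.

Lemma ZS_zmod : zmod_closed ZS.
Proof.
split=> [|_ _ /ZSP[c ->] /ZSP[d ->]]; apply/ZSP.
  by exists (fun=> 0); rewrite big1 // => e _; rewrite mulr0z.
by exists (fun e => c e - d e); rewrite -sumrB; apply: eq_bigr => e _; rewrite mulrzBr.
Qed.
HB.instance Definition _ := GRing.isZmodClosed.Build _ ZS ZS_zmod.

Lemma monom_ZS (e : 'I_r -> nat) : monom e \in ZS.
Proof.
have [n] := ubnP (\sum_i e i)%N; elim: n e => // n IHn e; rewrite ltnS => le_n.
have [lt_r|] := boolP [forall i, e i < r]%N.
  have lt_i i : (e i < r)%N by move/forallP: lt_r.
  apply/ZSP; exists (fun f : idx => if f == [ffun i => Ordinal (lt_i i)] then 1 else 0).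
  rewrite (bigD1 [ffun i => Ordinal (lt_i i)]) //= eqxx big1 ?addr0 => [|f /negPf->].
    by apply: eq_bigr => i _; rewrite ffunE.
  by rewrite mulr0z.
rewrite negb_forall => /existsP[i]; rewrite -leqNgt => le_r.
pose e' k j := if j == i then k else e j.
have De' k : monom (e' k) = s i ^+ k * \prod_(j | j != i) s j ^+ e j.
  rewrite /monom (bigD1 i) //= /e' eqxx; congr (_ * _).
  by apply: eq_bigr => j /negPf->.
have -> : monom e = monom (e' (e i)).
  by apply: eq_bigr => j _; rewrite /e'; case: eqP => [->|].
have Dr : s i ^+ r = - \sum_(j < r) s i ^+ j *~ F`_j.
  have := F_root i; rewrite /root horner_coef (size_map_inj_poly intrL_inj) //.
  rewrite F_size big_ord_recr /= coef_map /=.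
  have -> : F`_r = 1 by move: F_monic; rewrite monicE /lead_coef F_size => /eqP.
  rewrite mul1r addrC addr_eq0 => /eqP ->; congr (- _).
  by apply: eq_bigr => j _; rewrite coef_map /= mulrzl.
have -> : monom (e' (e i)) = - \sum_(j < r) monom (e' (e i - r + j)%N) *~ F`_j.
  rewrite De' -{1}(subnK le_r) exprD Dr mulrN mulNr mulr_sumr mulr_suml; congr (- _).
  by apply: eq_bigr => j _; rewrite De' exprD mulrzAr mulrzAl.
rewrite rpredN rpred_sum // => j _; rewrite rpredMz // IHn //.
apply: leq_trans le_n; rewrite (bigD1 i) //= [X in (_ < X)%N](bigD1 i) //= /e' eqxx.
rewrite -addSn; apply: leq_add; first by have := ltn_ord j; lia.
by apply: eq_leq; apply: eq_bigr => k /negPf->.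
Qed.

Lemma ZS_mul x y : x \in ZS -> y \in ZS -> x * y \in ZS.
Proof.
move=> /ZSP[c ->] /ZSP[d ->]; rewrite mulr_suml rpred_sum // => e _.
rewrite mulr_sumr rpred_sum // => f _; rewrite mulrzAl mulrzAr !rpredMz //.
suff -> : mon e * mon f = monom (fun i => e i + f i)%N by apply: monom_ZS.
by rewrite -big_split; apply: eq_bigr => i _; rewrite exprD.
Qed.

Lemma ZS1 : 1 \in ZS.
Proof.
suff -> : 1 = monom (fun=> 0%N) by apply: monom_ZS.
by rewrite /monom big1.
Qed.
HB.instance Definition _ := GRing.isMulClosed.Build _ ZS (conj ZS1 ZS_mul).

Lemma ZS_gen i : s i \in ZS.
Proof.
suff -> : s i = monom (fun j => (j == i : nat)) by apply: monom_ZS.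
rewrite /monom (bigD1 i) //= eqxx big1 ?mulr1 // => j /negPf -> ; exact: expr0.
Qed.

Lemma s_Aint i : phi (s i) \in Aint.
Proof.
apply: (@root_monic_Aint (map_poly intr F)).
- by have := F_root i; rewrite -(fmorph_root phi) -map_poly_comp (eq_map_poly (rmorph_int _)).
- exact: monic_map.
by apply/polyOverP=> j; rewrite coef_map rpred_int.
Qed.

Lemma ZS_Aint x : x \in ZS -> phi x \in Aint.
Proof.
move=> /ZSP[c ->]; rewrite rmorph_sum rpred_sum // => e _.
rewrite rmorphMz rpredMz // rmorph_prod rpred_prod // => i _.
by rewrite rmorphXn rpredX // s_Aint.
Qed.

Lemma ZS_gal (g : gal_of {:L}) x : x \in ZS -> g x \in ZS.
Proof.
move=> /ZSP[c ->]; rewrite rmorph_sum rpred_sum // => e _.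
rewrite rmorphMz rpredMz // rmorph_prod rpred_prod // => i _.
by rewrite rmorphXn rpredX //=; have [j ->] := s_gal g i; apply: ZS_gen.
Qed.

Lemma monom_bound (g : gal_of {:L}) (e : idx) : `|phi (g (mon e))| <= (B ^ (r * r))%:R.
Proof.
rewrite !rmorph_prod normr_prod.
apply: (@le_trans _ _ (\prod_(i < r) (B ^ r)%:R)); last first.
  by rewrite prodr_const card_ord -natrX -expnM.
apply: ler_prod => i _; rewrite normr_ge0 /= !rmorphXn normrX /=.
have [j ->] := s_gal g i; rewrite ?natrX.
apply: (@le_trans _ _ (B%:R ^+ e i)); first by rewrite lerXn2r ?nnegrE.
by rewrite ler_weXn2l ?ler1n // ltnW.
Qed.

Notation N := (galNorm 1 {:L}).

Lemma norm_int x : x \in ZS -> exists z : int, N x = z%:~R.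
Proof.
move=> Zx; apply: (@fixed_int _ phi).
  rewrite rmorph_prod rpred_prod // => g _; apply: gal_Aint; exact: ZS_Aint.
move=> g Gg; have := galNorm_fixedField 1 (memvf x).
by move/(fixedFieldP (memvf _)); apply.
Qed.

(** Every nonzero element of the order divides a nonzero integer. *)
Lemma ZS_inv x : x \in ZS -> x != 0 ->
  exists2 y, y \in ZS & exists2 z : int, z != 0 & x * y = z%:~R.
Proof.
move=> Zx x0; exists (\prod_(g in G | g != 1%g) g x).
  by rewrite rpred_prod // => g _; apply: ZS_gal.
have [z Dz] := norm_int Zx; exists z.
  by apply: contra x0 => /eqP z0; rewrite -(galNorm_eq0 1 {:L}) Dz z0.
by rewrite -Dz /galNorm [RHS](bigD1 (1 : gal_of {:L})%g) ?group1 //= gal_id.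
Qed.

(** The number of intervals into which each coordinate is cut. *)
Definition hurwitz_box := ((r ^ r) * B ^ (r * r))%N.

(** The number of boxes, one coordinate for each of the [r ^ r] monomials. *)
Definition hurwitz := (hurwitz_box ^ (r ^ r))%N.

Lemma card_idx : #|{: idx}| = (r ^ r)%N.
Proof. by rewrite card_ffun !card_ord. Qed.

Lemma box_gt0 : (0 < hurwitz_box)%N.
Proof.
rewrite muln_gt0 !expn_gt0 B_gt0 !andbT; case: (r) => //.
Qed.

(** A weak form of the Euclidean algorithm: by the box principle, some bounded
    multiple of a fraction is close to an element of the order. *)
Lemma hurwitz_approx x y : x \in ZS -> y \in ZS -> y != 0 ->
  exists t w, [/\ (0 < t <= hurwitz)%N, w \in ZS &
    `|phi (N (x *+ t - w * y))| < `|phi (N y)| ].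
Proof.
move=> Zx Zy y0; have [u Zu [M M0 Dyu]] := ZS_inv Zy y0.
have /ZSP[c Dxu] := ZS_mul Zx Zu.
set Q := hurwitz_box; have Q0 : (0 < Q)%N := box_gt0.
have M0' : (0 < `|M|)%N by rewrite absz_gt0.
pose res (t : nat) (e : idx) := `|((t%:Z * c e) %% M)%Z|%N.
have lt_res t e : (res t e < `|M|)%N.
  by have := ltz_mod (t%:Z * c e) M0; rewrite -ltz_nat /res !abszE (ger0_norm (modz_ge0 _ M0)).
have box_lt t e : (res t e * Q %/ `|M| < Q)%N.
  by rewrite ltn_divLR // mulnC ltn_pmul2l.
pose box (t : 'I_(hurwitz.+1)) : {ffun idx -> 'I_Q} := [ffun e => Ordinal (box_lt t e)].
have [t1 [t2 [lt12 box12]]] : exists t1 t2 : 'I_(hurwitz.+1), (t1 < t2)%N /\ box t1 = box t2.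
  have: ~~ injectiveb box.
    apply/negP=> /injectiveP/leq_card; rewrite card_ffun card_idx !card_ord.
    by rewrite /hurwitz ltnn.
  move=> /injectivePn[t1 [t2 ne12 Ebox]].
  have [lt12|lt21|/val_inj/eqP] := ltngtP t1 t2; last by rewrite (negPf ne12).
    by exists t1, t2.
  by exists t2, t1.
pose d e : int := (res t2 e)%:Z - (res t1 e)%:Z.
have Dres t e : (t%:Z * c e = (t%:Z * c e %/ M)%Z * M + (res t e)%:Z).
  by rewrite {1}(divz_eq (t%:Z * c e) M) /res abszE (ger0_norm (modz_ge0 _ M0)).
have d_small e : (`|d e| * Q < `|M|)%N.
  have /(congr1 val) := congr1 (fun f : {ffun idx -> 'I_Q} => f e) box12.
  rewrite !ffunE /= => E.
  have E1 := divn_eq (res t1 e * Q) `|M|; have E2 := divn_eq (res t2 e * Q) `|M|.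
  have := ltn_pmod (res t1 e * Q) M0'; have := ltn_pmod (res t2 e * Q) M0'.
  move: E1 E2; rewrite E; move: (_ %/ _)%N (_ %% _)%N (_ %% _)%N => k a b.
  rewrite /d; nia.
pose w := \sum_(e : idx) mon e *~ ((t2%:Z * c e %/ M)%Z - (t1%:Z * c e %/ M)%Z).
have Zw : w \in ZS by apply/ZSP; eexists.
have Dd : (x *+ (t2 - t1)%N - w * y) * u = \sum_(e : idx) mon e *~ d e.
  rewrite mulrBl -mulrA Dyu mulrnAl Dxu -sumrMnl mulr_suml -sumrB.
  apply: eq_bigr => e _; rewrite mulrzr pmulrn -!mulrzA -mulrzBr; congr (_ *~ _).
  rewrite -subzn ?(ltnW lt12) // mulrBr.
  rewrite ![c e * _]mulrC [X in X - _ - _](Dres t2) [X in _ - X - _](Dres t1) /d; ring.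
exists (t2 - t1)%N, w; split=> //.
  by rewrite subn_gt0 lt12 (leq_trans (leq_subr _ _)) // -ltnS.
have u0 : u != 0.
  by apply: contra M0 => /eqP u0; move: Dyu; rewrite u0 mulr0 => /esym/eqP; rewrite intrL_eq0.
rewrite /galNorm !rmorph_prod !normr_prod.
apply: ltr_prod => [|g _].
  by apply/hasP; exists (1 : gal_of {:L})%g; rewrite ?mem_index_enum ?group1.
rewrite normr_ge0 /= -(ltr_pM2r (x := `|phi (g u)|)); last by rewrite normr_gt0 !fmorph_eq0.
rewrite -!normrM -!rmorphM Dd Dyu !rmorph_int !rmorph_sum /=.
have Q0' : 0 < Q%:R :> algC by rewrite ltr0n.
rewrite -(ltr_pM2l Q0').
apply: (@le_lt_trans _ _ (Q%:R * \sum_e `|(d e)%:~R| * (B ^ (r * r))%:R)).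
  rewrite ler_pM2l //; apply: le_trans (ler_norm_sum _ _ _) _; apply: ler_sum => e _.
  rewrite !rmorphMz -mulrzl normrM ler_wpM2l ?normr_ge0 //; exact: monom_bound.
rewrite mulr_sumr.
apply: (@lt_le_trans _ _ (\sum_(e : idx) (`|M|%N)%:R * (B ^ (r * r))%:R)); last first.
  rewrite sumr_const card_idx -[_ *+ _]mulr_natr -intr_norm -natr_absz -!natrM ler_nat.
  by rewrite /Q /hurwitz_box; nia.
apply: ltr_sum => [|e _].
  by apply/hasP; exists [ffun i => i]; rewrite ?mem_index_enum.
rewrite mulrA ltr_pM2r; last by rewrite ltr0n expn_gt0 B_gt0.
by rewrite -intr_norm -natr_absz -natrM ltr_nat mulnC.
Qed.

(** An ideal of the order [ZS]. *)
Definition ZSideal (J : L -> Prop) :=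
  [/\ forall x, J x -> x \in ZS, forall x y, J x -> J y -> J (x + y),
      forall a x, a \in ZS -> J x -> J (a * x) & exists2 x, J x & x != 0].

Lemma norm_nat x : x \in ZS -> exists n : nat, `|phi (N x)| = n%:R.
Proof.
by move=> Zx; have [z ->] := norm_int Zx; exists `|z|%N; rewrite rmorph_int -intr_norm natr_absz.
Qed.

(** The multiples by [hurwitz`!] of an ideal are divisible by one of its
    elements, namely one of minimal norm. *)
Lemma ideal_min J : ZSideal J -> exists2 b, J b /\ b != 0 &
  forall x, J x -> exists2 w, w \in ZS & x *+ hurwitz`! = w * b.
Proof.
move=> [JZ JD JM [x1 Jx1 x10]].
pose P n := `[< exists x, [/\ J x, x != 0 & `|phi (N x)| = n%:R] >].
have exP : exists n, P n.
  by have [n Dn] := norm_nat (JZ _ Jx1); exists n; apply/asboolP; exists x1.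
case: (ex_minnP exP) => n /asboolP[b [Jb b0 Dn]] min_n; exists b => // x Jx.
have [t [w [/andP[t0 tH] Zw lt_N]]] := hurwitz_approx (JZ _ Jx) (JZ _ Jb) b0.
have Jd : J (x *+ t - w * b).
  rewrite -mulNr; apply: JD; last by apply: JM; rewrite ?rpredN.
  by rewrite -mulr_natl; apply: JM => //; rewrite rpred_nat.
have /eqP : x *+ t - w * b = 0.
  apply/eqP; apply: contraLR lt_N => d0; have [k Dk] := norm_nat (JZ _ Jd).
  rewrite Dk Dn ltr_nat -leqNgt; apply: min_n; apply/asboolP.
  by exists (x *+ t - w * b).
rewrite subr_eq0 => /eqP Dw; have /dvdnP[q Dq] : (t %| hurwitz`!)%N by rewrite dvdn_fact ?t0.
by exists (w *+ q); rewrite ?rpredMn // Dq mulnC mulrnA Dw mulrnAl.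
Qed.

(** The number of subsets of the order modulo [hurwitz`!]. *)
Definition class_bound := (2 ^ (hurwitz`! ^ (r ^ r)))%N.

(** The ideal classes are finitely many: up to a scalar every ideal contains
    [hurwitz`!], so that it is determined by a set of residues modulo
    [hurwitz`!]. *)
Lemma ideal_class (J : nat -> L -> Prop) : (forall k, ZSideal (J k)) ->
  exists i j c, [/\ (i < j <= class_bound)%N, c != 0,
    forall x, J i x -> J j (x * c), forall x, J j x -> J i (x / c) &
    exists u w, [/\ u \in ZS, w \in ZS & c = u / w]].
Proof.
move=> idJ; set m := hurwitz`!.
have m0 : (0 < m)%N := fact_gt0 _.
have /choice[b bP] : forall k, exists b, [/\ J k b, b != 0 &
    forall x, J k x -> exists2 w, w \in ZS & x *+ m = w * b].
  by move=> k; have [b [Jb b0] Hb] := ideal_min (idJ k); exists b.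
pose Q k x := exists2 y, J k y & x * b k = y *+ m.
pose code (k : 'I_class_bound.+1) := [set v : {ffun idx -> 'I_m} |
  `[< Q k (\sum_(e : idx) mon e *+ v e) >]].
have [i [j [lt_ij Eij]]] : exists i j : 'I_class_bound.+1, (i < j)%N /\ code i = code j.
  have: ~~ injectiveb code.
    apply/negP=> /injectiveP/leq_card; rewrite card_ord -cardsT -powersetT card_powerset.
    by rewrite cardsT card_ffun card_idx card_ord ltnn.
  move=> /injectivePn[t1 [t2 ne12 Ebox]].
  have [lt12|lt21|/val_inj/eqP] := ltngtP t1 t2; last by rewrite (negPf ne12).
    by exists t1, t2.
  by exists t2, t1.
have Q_congr k x z : x \in ZS -> z \in ZS -> Q k x -> Q k (x + z *+ m).
  move=> Zx Zz [y Jy Dy]; have [Jb _ _] := bP k; have [_ JD JM _] := idJ k.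
  by exists (y + z * b k); [apply/JD/JM | rewrite mulrDl Dy mulrnDl mulrnAl].
have Q_sub x : x \in ZS -> exists v : {ffun idx -> 'I_m}, forall k,
    Q k x <-> Q k (\sum_(e : idx) mon e *+ v e).
  move=> Zx; have /ZSP[c Dx] := Zx.
  have c_lt e : (`|(c e %% m)%Z| < m)%N.
    by rewrite -ltz_nat abszE ger0_norm ?modz_ge0 ?ltz_pmod //; case: (m) m0.
  exists [ffun e => Ordinal (c_lt e)] => k; set x' := \sum_(e : idx) _.
  pose z := \sum_(e : idx) mon e *~ (c e %/ m)%Z.
  have Dx' : x = x' + z *+ m.
    rewrite Dx -sumrMnl -big_split; apply: eq_bigr => e _ /=; rewrite ffunE /=.
    rewrite [_ *+ m]pmulrn [_ *+ _]pmulrn -mulrzA -mulrzDr abszE ger0_norm.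
      by rewrite addrC -divz_eq.
    by rewrite modz_ge0 //; case: (m) m0.
  have Zx' : x' \in ZS by rewrite rpred_sum // => e _; rewrite rpredMn ?monom_ZS.
  have Zz : z \in ZS.
    by rewrite rpred_sum // => e _; rewrite rpredMz ?monom_ZS.
  split=> Qx; last by rewrite Dx'; apply: Q_congr.
  have -> : x' = x + (- z) *+ m by rewrite mulNrn Dx' addrK.
  by apply: Q_congr; rewrite ?rpredN.
have transf (k l : 'I_class_bound.+1) x : code k = code l -> J k x -> J l (x * b l / b k).
  move=> Ekl Jx; have [Jbk bk0 bkP] := bP k; have [Jbl bl0 _] := bP l.
  have [w Zw Dw] := bkP x Jx; have [v vP] := Q_sub w Zw.
  have /vP Qv : Q k w by exists x.
  have : v \in code k by rewrite inE; apply/asboolP.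
  rewrite Ekl inE => /asboolP/vP[y Jy Dy]; suff -> : x * b l / b k = y by [].
  apply: (mulIf bk0); rewrite divfK //.
  have m0L : m%:R != 0 :> L by rewrite -[m%:R]/(m%:~R) intrL_eq0 -lt0n.
  apply: (mulIf m0L); rewrite !mulr_natr -!mulrnAl Dw -Dy; ring.
have [[Jbi bi0 _] [Jbj bj0 _]] := (bP i, bP j).
exists i, j, (b j / b i); split.
- by rewrite lt_ij /= -ltnS ltn_ord.
- by rewrite mulf_neq0 ?invr_eq0.
- by move=> x /(transf i j x Eij); rewrite mulrA.
- by move=> x /(transf j i x (esym Eij)); rewrite invf_div mulrA.
by exists (b j), (b i); split=> //; [have [] := idJ j | have [] := idJ i]; auto.
Qed.

(** The field generated by the [s i]. *)
Definition QS : {pred algC} :=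
  fun x => `[< exists u w, [/\ u \in ZS, w \in ZS, w != 0 & x = phi u / phi w] >].

Lemma QSP x :
  reflect (exists u w, [/\ u \in ZS, w \in ZS, w != 0 & x = phi u / phi w]) (x \in QS).
Proof. exact: asboolP. Qed.

Lemma QS_ZS x : x \in ZS -> phi x \in QS.
Proof.
by move=> Zx; apply/QSP; exists x, 1; rewrite rpred1 oner_eq0 rmorph1 divr1.
Qed.

Lemma QS_divring : divring_closed QS.
Proof.
split=> [|_ _ /QSP[u [w [Zu Zw w0 ->]]] /QSP[v [y [Zv Zy y0 ->]]]|
  _ _ /QSP[u [w [Zu Zw w0 ->]]] /QSP[v [y [Zv Zy y0 ->]]]].
- by rewrite -(rmorph1 phi) QS_ZS ?rpred1.
- apply/QSP; exists (u * y - v * w), (w * y); split.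
  + by rewrite rpredB ?rpredM.
  + by rewrite rpredM.
  + by rewrite mulf_neq0.
  have [w0' y0'] : phi w != 0 /\ phi y != 0 by rewrite !fmorph_eq0.
  by rewrite rmorphB !rmorphM; field; rewrite w0' y0'.
have [->|v0] := eqVneq v 0.
  apply/QSP; exists 0, 1; rewrite rpred0 rpred1 oner_eq0; split=> //.
  by rewrite rmorph0 !mul0r invr0 mulr0.
apply/QSP; exists (u * y), (w * v); split.
- by rewrite rpredM.
- by rewrite rpredM.
- by rewrite mulf_neq0.
have [[w0' y0'] v0'] : (phi w != 0 /\ phi y != 0) /\ phi v != 0 by rewrite !fmorph_eq0.
by rewrite !rmorphM; field; rewrite w0' y0' v0'.
Qed.
HB.instance Definition _ := GRing.isDivringClosed.Build _ QS QS_divring.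

Lemma QS_min (T : divringClosed algC) : (forall i, phi (s i) \in T) -> {subset QS <= T}.
Proof.
move=> sT; have ZT u : u \in ZS -> phi u \in T.
  move=> /ZSP[c ->]; rewrite rmorph_sum rpred_sum // => e _; rewrite rmorphMz rpredMz //.
  by rewrite rmorph_prod rpred_prod // => i _; rewrite rmorphXn rpredX.
by move=> _ /QSP[u [w [Zu Zw _ ->]]]; rewrite rpred_div ?ZT.
Qed.

Lemma QS_common (b : seq algC) : (forall x, x \in b -> x \in QS) ->
  exists2 d, d \in ZS /\ d != 0 & forall x, x \in b -> exists2 u, u \in ZS & x = phi u / phi d.
Proof.
elim: b => [|y b IHb] bQ; first by exists 1; rewrite ?rpred1 ?oner_eq0.
have [x xb|d [Zd d0] dP] := IHb; first by apply: bQ; rewrite inE xb orbT.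
have /QSP[u [w [Zu Zw w0 Dy]]] : y \in QS by apply: bQ; rewrite inE eqxx.
have [w0' d0'] : phi w != 0 /\ phi d != 0 by rewrite !fmorph_eq0.
exists (w * d) => [|x]; first by rewrite rpredM // mulf_neq0.
rewrite inE => /predU1P[->|/dP[v Zv ->]].
  by exists (u * d); rewrite ?rpredM // Dy !rmorphM; field; rewrite w0' d0'.
by exists (v * w); rewrite ?rpredM // !rmorphM; field; rewrite w0' d0'.
Qed.

(** The powers of the ideal generated by a finite family. *)
Fixpoint ideal_pow (u : seq L) (k : nat) (x : L) : Prop :=
  if k is k'.+1 then exists2 f : nat -> L, forall l, ideal_pow u k' (f l) &
    x = \sum_(l < size u) u`_l * f l
  else x \in ZS.

Lemma ideal_powD u k x y : ideal_pow u k x -> ideal_pow u k y -> ideal_pow u k (x + y).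
Proof.
elim: k x y => [|k IHk] x y /=; first exact: rpredD.
move=> [f fP ->] [g gP ->]; exists (fun l => f l + g l); first by move=> l; apply: IHk.
by rewrite -big_split; apply: eq_bigr => l _; rewrite mulrDr.
Qed.

Lemma ideal_powM u k a x : a \in ZS -> ideal_pow u k x -> ideal_pow u k (a * x).
Proof.
move=> Za; elim: k x => [|k IHk] x /=; first exact: rpredM.
move=> [f fP ->]; exists (fun l => a * f l); first by move=> l; apply: IHk.
by rewrite mulr_sumr; apply: eq_bigr => l _; rewrite mulrCA.
Qed.

Lemma ideal_pow0 u k : ideal_pow u k 0.
Proof.
elim: k => [|k IHk] /=; first exact: rpred0.
by exists (fun=> 0) => //; rewrite big1 // => l _; rewrite mulr0.
Qed.

Lemma ideal_powX u k x : x \in u -> ideal_pow u k (x ^+ k).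
Proof.
move=> xu; elim: k => [|k IHk] /=; first exact: rpred1.
have lt_i : (index x u < size u)%N by rewrite index_mem.
exists (fun l => if l == index x u then x ^+ k else 0).
  by move=> l; case: ifP => _ //; apply: ideal_pow0.
rewrite (bigD1 (Ordinal lt_i)) //= eqxx nth_index // big1 ?addr0 ?exprS // => l.
by rewrite -val_eqE /= => /negPf ->; rewrite mulr0.
Qed.

Lemma ideal_pow_ideal u k : (forall x, x \in u -> x \in ZS) ->
  (exists2 x, x \in u & x != 0) -> ZSideal (ideal_pow u k).
Proof.
move=> uZ [x xu x0]; split.
- elim: k => [//|k IHk] y /= [f fP ->]; rewrite rpred_sum // => l _.
  by apply: rpredM; [apply/uZ/mem_nth | apply: IHk].
- by move=> y z; apply: ideal_powD.
- by move=> a y; apply: ideal_powM.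
by exists (x ^+ k); rewrite ?expf_neq0 //; apply: ideal_powX.
Qed.

Lemma ideal_pow_vring (V : valring algC) u k x y : y != 0 ->
  (forall z, z \in u -> phi z / phi y \in V) -> ideal_pow u k x -> phi x / phi y ^+ k \in V.
Proof.
move=> y0 uy; have y0' : phi y != 0 by rewrite fmorph_eq0.
elim: k x => [|k IHk] x /=; first by move=> Zx; rewrite divr1 Aint_vring ?ZS_Aint.
move=> [f fP ->]; rewrite rmorph_sum mulr_suml rpred_sum // => l _.
by rewrite rmorphM exprS invfM mulrACA rpredM ?IHk // uy // mem_nth.
Qed.

(** A common multiple of the differences of two exponents at most [class_bound]. *)
Definition root_degree := class_bound`!.

(** A fractional ideal of the field generated by the [s i] becomes principal
    over the algebraic integers, generated by a root of bounded degree of an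
    element of the field.  Being a generator is expressed valuation by
    valuation. *)
Lemma QS_gcd (b : seq algC) : (forall x, x \in b -> x \in QS) ->
  (exists2 x, x \in b & x != 0) ->
  exists g, [/\ g != 0, g ^+ root_degree \in QS &
    forall V : valring algC, (forall x, x \in b -> x / g \in V) /\
      exists2 x, x \in b & x / g \in vunit V].
Proof.
move=> bQ [x1 x1b x10]; have [d [Zd d0] dP] := QS_common bQ.
have d0' : phi d != 0 by rewrite fmorph_eq0.
have [u [uZ u0 ub bu]] : exists u : seq L, [/\ forall x, x \in u -> x \in ZS,
    exists2 x, x \in u & x != 0, forall x, x \in u -> phi x / phi d \in b &
    forall x, x \in b -> exists2 y, y \in u & x = phi y / phi d].
  have /choice[f fP] : forall x, exists y, x \in b -> y \in ZS /\ x = phi y / phi d.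
    by move=> x; have [/dP[y Zy Dx]|_] := boolP (x \in b); [exists y | exists 0].
  exists [seq f x | x <- b]; split.
  - by move=> _ /mapP[x xb ->]; have [] := fP x xb.
  - exists (f x1); first by apply/mapP; exists x1.
    have [_ Dx1] := fP x1 x1b; apply: contra x10 => /eqP y0.
    by rewrite Dx1 y0 rmorph0 mul0r.
  - by move=> _ /mapP[x xb ->]; have [_ <-] := fP x xb.
  by move=> x xb; exists (f x); [apply/mapP; exists x | have [_ Dx] := fP x xb].
have [i [j [c [/andP[lt_ij le_j] c0 cJ Jc [y [w [Zy Zw Dc]]]]]]] :=
  ideal_class (fun k => ideal_pow_ideal k uZ u0).
(* Two powers of the ideal generated by [u] have the same class, and [c] is the
   quotient.  Valuation by valuation, a generator is therefore a root of [c] of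
   order the difference of the exponents. *)
pose m := (j - i)%N; have m0 : (0 < m)%N by rewrite subn_gt0.
have c0' : phi c != 0 by rewrite fmorph_eq0.
pose g := m.-root (phi c); have Dg : g ^+ m = phi c by rewrite rootCK.
have g0 : g != 0.
  by apply: contra c0' => /eqP g0; rewrite -Dg g0 expr0n; case: (m) m0.
exists (g / phi d); split.
- by rewrite mulf_neq0 ?invr_eq0.
- have /dvdnP[q Dq] : (m %| root_degree)%N.
    by apply: dvdn_fact; rewrite m0 (leq_trans (leq_subr _ _)).
  rewrite expr_div_n rpred_div //; last by rewrite rpredX // QS_ZS.
  rewrite Dq mulnC exprM Dg rpredX // Dc rmorphM fmorphV rpred_div ?QS_ZS //.
move=> V; have [x2 [x2u x20] x2P] : exists2 x, x \in u /\ x != 0 &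
    forall z, z \in u -> phi z / phi x \in V.
  have [|_ [/mapP[x xu ->] x0] xP] := @vring_gcd _ V [seq phi x | x <- u].
    by have [x xu x0] := u0; exists (phi x); rewrite ?map_f // fmorph_eq0.
  by exists x => [|z zu]; [rewrite -(fmorph_eq0 phi) | apply: xP; apply: map_f].
have x20' : phi x2 != 0 by rewrite fmorph_eq0.
have ug : phi x2 / g \in vunit V.
  apply: (vunitX_inv m0); rewrite expr_div_n Dg.
  have Dj : j = (m + i)%N by rewrite subnK // ltnW.
  apply/and3P; split; first by rewrite mulf_neq0 ?invr_eq0 ?expf_neq0.
    have := ideal_pow_vring x20 x2P (Jc _ (ideal_powX j x2u)).
    rewrite (_ : phi (x2 ^+ j / c) / _ = phi x2 ^+ m / phi c) //.
    by rewrite rmorphM fmorphV rmorphXn Dj exprD; field; rewrite c0' expf_neq0.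
  have := ideal_pow_vring x20 x2P (cJ _ (ideal_powX i x2u)).
  rewrite (_ : phi (x2 ^+ i * c) / _ = (phi x2 ^+ m / phi c)^-1) //.
  by rewrite rmorphM rmorphXn Dj exprD; field; rewrite c0' !expf_neq0.
have Eg z : phi z / phi d / (g / phi d) = phi z / g.
  by field; rewrite g0 d0'.
split=> [_ /bu[z zu ->]|].
  rewrite Eg -[phi z](divfK x20') -(mulrA (phi z / _)) rpredM ?x2P //.
  exact: vunit_sub.
by exists (phi x2 / phi d); [apply: ub | rewrite Eg].
Qed.

Lemma QS_rat_span x : x \in QS -> exists c : idx -> rat, x = \sum_(e : idx) ratr (c e) * phi (mon e).
Proof.
move=> /QSP[u [w [Zu Zw w0 ->]]]; have [y Zy [z z0 Dwy]] := ZS_inv Zw w0.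
have /ZSP[c Duy] := ZS_mul Zu Zy.
exists (fun e => (c e)%:~R / z%:~R).
have w0' : phi w != 0 by rewrite fmorph_eq0.
have z0' : z%:~R != 0 :> algC by rewrite intr_eq0.
have Dwy' : phi w * phi y = z%:~R by rewrite -rmorphM Dwy rmorph_int.
have Duy' : phi u / phi w * z%:~R = phi (u * y) by rewrite -Dwy' mulrA divfK // rmorphM.
apply: (mulIf z0'); rewrite Duy' Duy.
rewrite rmorph_sum mulr_suml; apply: eq_bigr => e _.
by rewrite rmorphMz fmorph_div !rmorph_int /= mulrAC divfK // mulrzl.
Qed.

Lemma QS_degree x : x \in QS -> (size (minCpoly x) <= (r ^ r).+1)%N.
Proof.
move=> Qx; have Qxk k : x ^+ k \in QS by rewrite rpredX.
have /choice[c Dc] := fun k => QS_rat_span (Qxk k).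
pose A := \matrix_(k < (r ^ r).+1, j < #|{: idx}|) c k (enum_val j).
have : kermx A != 0.
  rewrite -mxrank_eq0 mxrank_ker -lt0n subn_gt0.
  by apply: leq_ltn_trans (rank_leq_col _) _; rewrite card_idx.
move=> /rowV0Pn[v /sub_kermxP vA v0].
have [p [Dp mon_p] dv_p] := minCpolyP x.
pose q := \poly_(k < (r ^ r).+1) v 0 (inord k).
have q0 : q != 0.
  apply: contra v0 => /eqP q0; apply/eqP/rowP=> k; rewrite mxE.
  by have := congr1 (fun f : {poly rat} => f`_k) q0; rewrite coef_poly ltn_ord inord_val coef0.
have : root (map_poly ratr q) x.
  rewrite /root (horner_coef_wide _ (n := (r ^ r).+1)); last first.
    by rewrite size_map_poly size_poly.
  under eq_bigr => k _ do rewrite coef_map coef_poly ltn_ord inord_val Dc mulr_sumr.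
  rewrite exchange_big /= big1 // => e _.
  have := congr1 (fun B : 'M_(1, _) => B 0 (enum_rank e)) vA.
  rewrite !mxE => /(congr1 (ratr : rat -> algC)); rewrite rmorph0 rmorph_sum /= => E.
  apply: etrans (mul0r (phi (mon e))); rewrite -[in RHS]E mulr_suml.
  by apply: eq_bigr => k _; rewrite rmorphM /= mxE enum_rankK mulrA.
rewrite dv_p => /(dvdp_leq q0) le_pq; rewrite Dp size_map_poly.
exact: leq_trans le_pq (size_poly _ _).
Qed.

End Order.

(** A field over which every finitely generated fractional ideal becomes
    principal after adjoining an [h]-th root. *)
Definition principal_by_root (Q : {pred algC}) (h : nat) : Prop :=
  forall b : seq algC, (forall x, x \in b -> x \in Q) -> (exists2 x, x \in b & x != 0) ->
  exists g, [/\ g != 0, g ^+ h \in Q &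
    forall V : valring algC, (forall x, x \in b -> x / g \in V) /\
      exists2 x, x \in b & x / g \in vunit V].

(** The outcome of this part: the properties of the field generated by a finite
    Galois stable family of algebraic integers bounded by [B]. *)
Theorem generated_field (L : splittingFieldType rat) (phi : {rmorphism L -> algC})
    (r : nat) (s : 'I_r -> L) (F : {poly int}) (B : nat) :
  F \is monic -> size F = r.+1 -> (forall i, root (map_poly intr F) (s i)) ->
  (forall (g : gal_of {:L}) i, exists j, g (s i) = s j) ->
  (forall i, `|phi (s i)| <= B%:R) -> (0 < B)%N ->
  exists Q : divringClosed algC, [/\ forall i, phi (s i) \in Q,
    forall T : divringClosed algC, (forall i, phi (s i) \in T) -> {subset Q <= T},
    principal_by_root Q (root_degree r B) &
    forall x, x \in Q -> (size (minCpoly x) <= (r ^ r).+1)%N].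
Proof.
move=> F_monic F_size F_root s_gal s_bound B_gt0.
pose P : {pred algC} := fun x => x \in QS phi s.
have dP : divring_closed P := QS_divring phi F_monic F_size F_root B_gt0.
pose PM := GRing.isDivringClosed.Build _ P dP.
pose Q : divringClosed algC := HB.pack P PM; exists Q; split.
- move=> i; apply: (QS_ZS phi F_monic F_size F_root B_gt0).
  exact: (ZS_gen phi F_monic F_size F_root B_gt0).
- by move=> T sT x; apply: QS_min.
- exact: (QS_gcd F_monic F_size F_root s_gal s_bound B_gt0).
exact: (QS_degree F_monic F_size F_root s_gal B_gt0).
Qed.

(** * Powers of an algebraic integer modulo an integer *)

(** The polynomials in [x] with integer coefficients form at most [m ^ d] classes
    modulo [m]. *)
Lemma pow_congr (x : algC) (d m : nat) : x \in Aint -> (0 < m)%N ->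
  (size (minCpoly x) <= d.+1)%N ->
  exists a b, (a < b <= m ^ d)%N /\ (x ^+ b - x ^+ a) / m%:R \in Aint.
Proof.
move=> Ax m0 le_d.
have /floorpP[p Dp] : minCpoly x \is a polyOver Num.int by [].
have mon_p : p \is monic.
  have := minCpoly_monic x; rewrite Dp !monicE lead_coef_map_inj ?rmorph0 //; last exact: intr_inj.
  by move=> /eqP lp; apply/eqP/(@intr_inj algC); rewrite lp.
have sz_p : (size p <= d.+1)%N.
  by rewrite Dp size_map_inj_poly // in le_d; apply: intr_inj.
pose R k : {poly int} := Pdiv.Ring.rmodp 'X^k p.
have szR k : (size (R k) <= d)%N.
  by rewrite -ltnS (leq_trans _ sz_p) // Pdiv.Ring.ltn_rmodpN0 // monic_neq0.
have DR k : x ^+ k = \sum_(i < d) ((R k)`_i)%:~R * x ^+ i.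
  have := Pdiv.RingMonic.rdivp_eq mon_p 'X^k => /(congr1 (fun q => (map_poly intr q : {poly algC}).[x])).
  rewrite map_polyXn hornerXn rmorphD rmorphM /= hornerD hornerM -Dp.
  have /eqP -> : root (minCpoly x) x := root_minCpoly x.
  rewrite mulr0 add0r => ->; rewrite (horner_coef_wide _ (n := d)); last first.
    by rewrite (leq_trans (size_poly _ _)) // szR.
  by apply: eq_bigr => i _; rewrite coef_map.
have c_lt k (i : 'I_d) : (`|((R k)`_i %% m)%Z| < m)%N.
  by rewrite -ltz_nat abszE ger0_norm ?modz_ge0 ?ltz_pmod //; case: (m) m0.
pose code (k : 'I_(m ^ d).+1) : {ffun 'I_d -> 'I_m} := [ffun i => Ordinal (c_lt k i)].
have [a [b [lt_ab Eab]]] : exists a b : 'I_(m ^ d).+1, (a < b)%N /\ code a = code b.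
  have: ~~ injectiveb code.
    by apply/negP=> /injectiveP/leq_card; rewrite card_ffun !card_ord ltnn.
  move=> /injectivePn[t1 [t2 ne12 Ebox]].
  have [lt12|lt21|/val_inj/eqP] := ltngtP t1 t2; last by rewrite (negPf ne12).
    by exists t1, t2.
  by exists t2, t1.
exists a, b; split; first by rewrite lt_ab -ltnS ltn_ord.
rewrite !DR -sumrB mulr_suml rpred_sum // => i _.
have m0' : m%:Z != 0 by case: (m) m0.
have Em : ((R a)`_i %% m)%Z = ((R b)`_i %% m)%Z.
  have /(congr1 val) := congr1 (fun f : {ffun 'I_d -> 'I_m} => f i) Eab; rewrite !ffunE /=.
  by move=> /(congr1 Posz); rewrite !abszE !ger0_norm ?modz_ge0.
rewrite (divz_eq (R b)`_i m) (divz_eq (R a)`_i m) Em -mulrBl -rmorphB opprD addrACA subrr addr0.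
rewrite -mulrBl rmorphM /= mulrAC mulfK; last by rewrite intr_eq0.
by rewrite rpredM ?rpredX // Aint_int.
Qed.

Lemma AintX_sub1 (y : algC) (c : algC) k q : y \in Aint ->
  c * (y ^+ k - 1) \in Aint -> c * (y ^+ (k * q) - 1) \in Aint.
Proof.
move=> Ay Ac; rewrite exprM -(expr1n _ q) subrXX mulrA rpredM // rpred_sum // => i _.
by rewrite rpredM ?rpredX // rpred1.
Qed.

(** In a finite ring, some power of every element is idempotent. *)
Lemma pow_idempotent (x : algC) (m : nat) : x \in Aint -> (0 < m)%N ->
  exists2 k, (0 < k)%N & (x ^+ k * (x ^+ k - 1)) / m%:R \in Aint.
Proof.
move=> Ax m0; have [a [b [/andP[lt_ab _] Aab]]] := pow_congr Ax m0 (leqSpred _).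
exists ((b - a) * a.+1)%N; first by rewrite muln_gt0 subn_gt0 lt_ab.
have Dk : ((b - a) * a.+1 = (b - a) * a.+1 - a + a)%N by rewrite subnK //; nia.
set K := ((b - a) * a.+1)%N in Dk *.
have -> : x ^+ K * (x ^+ K - 1) / m%:R = x ^+ (K - a) * (x ^+ a / m%:R * (x ^+ K - 1)).
  by rewrite {1}Dk exprD; ring.
rewrite rpredM ?rpredX //; apply: AintX_sub1 => //.
by rewrite mulrBr mulr1 mulrAC -exprD subnKC ?(ltnW lt_ab) // -mulrBl.
Qed.

(** An algebraic integer prime to [m] is invertible modulo [m], so that one of its
    powers is 1 modulo [m]. *)
Lemma pow_one (x : algC) (d m : nat) : x \in Aint -> (0 < m)%N ->
  (size (minCpoly x) <= d.+1)%N ->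
  (forall V : valring algC, m%:R \in vmax V -> x \in vunit V) ->
  (x ^+ (m ^ d)`! - 1) / m%:R \in Aint.
Proof.
move=> Ax m0 le_d ux; have [a [b [/andP[lt_ab le_b] Aab]]] := pow_congr Ax m0 le_d.
have /dvdnP[q ->] : (b - a %| (m ^ d)`!)%N.
  by apply: dvdn_fact; rewrite subn_gt0 lt_ab (leq_trans (leq_subr _ _)).
rewrite mulrC mulnC; apply: AintX_sub1 => //; apply: AintP => V.
have m0' : m%:R != 0 :> algC by rewrite pnatr_eq0 -lt0n.
have [mV|] := boolP (m%:R \in vmax V); last first.
  rewrite -vunitE ?rpred_nat // => /vunitV/vunit_sub uV.
  by rewrite rpredM // rpredB ?rpred1 // rpredX // Aint_vring.
have := vunit_sub (vunitV (vunitX a (ux V mV))); move/rpredM/(_ (Aint_vring V Aab)).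
have xa0 := vunit_neq0 (vunitX a (ux V mV)).
rewrite -[in x ^+ b](subnKC (ltnW lt_ab)) exprD -[X in _ - X]mulr1 -mulrBr.
by rewrite mulrA mulKf // mulrC.
Qed.

(** * Units in residue classes *)

Section UnitInClass.

Variables (s : algC) (m k : nat).
Hypotheses (m_gt0 : (0 < m)%N) (k_gt0 : (0 < k)%N) (s_Aint : s \in Aint).
Let w := (s ^+ k - 1) / m%:R.
Hypothesis w_Aint : w \in Aint.
Let q := 1 - s ^+ k.
Let g := \sum_(i < k) q ^+ i.

Let mw : m%:R * w = s ^+ k - 1.
Proof. by rewrite mulrC divfK // pnatr_eq0 -lt0n. Qed.

(** The product of the [s + m * y], over the roots [y] of this polynomial,
    is 1. *)
Definition unit_poly : {poly algC} :=
  'X^k + (w * s * g) *: 'X^(k.-1) - (m%:R * w ^+ k.+1)%:P.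

Let Dw : (s ^+ k - 1) / m%:R = w. Proof. by []. Qed.

Lemma size_unit_poly : size unit_poly = k.+1.
Proof.
rewrite /unit_poly -addrA size_polyDl size_polyXn // ltnS.
apply: leq_trans (size_polyD _ _) _; rewrite geq_max size_polyN.
rewrite (leq_trans (size_polyC_leq1 _)) // andbT.
by rewrite (leq_trans (size_scale_leq _ _)) // size_polyXn prednK.
Qed.

Lemma unit_poly_over (T : divringClosed algC) : s \in T -> unit_poly \is a polyOver T.
Proof.
move=> sT; have wT : w \in T by rewrite rpred_div ?rpred_nat // rpredB ?rpred1 ?rpredX.
have gT : g \in T by rewrite rpred_sum // => i _; rewrite rpredX // rpredB ?rpred1 ?rpredX.
apply: rpredB; last by rewrite polyOverC; apply: rpredM; [apply: rpred_nat | apply: rpredX].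
apply: rpredD; first by rewrite rpredX // polyOverX.
apply: polyOverZ; last by rewrite rpredX // polyOverX.
exact: rpredM (rpredM wT sT) gT.
Qed.

Lemma monic_unit_poly : unit_poly \is monic.
Proof.
rewrite monicE /lead_coef size_unit_poly /= /unit_poly !coefE eqxx.
have -> : (k == k.-1) = false by case: (k) k_gt0 => // k' _; rewrite /= eqn_leq ltnn.
have -> : (k == 0)%N = false by case: (k) k_gt0.
by rewrite mulr0 addr0 subr0.
Qed.

(** An algebraic integer some power of which is 1 modulo [m] is congruent modulo
    [m] to an algebraic unit, of controlled degree over it. *)
Lemma unit_in_class : exists y, [/\ y \in Aint, root unit_poly y &
  forall V : valring algC, s + m%:R * y \in vunit V].
Proof.
have [|y ry] := @closed_rootP algC unit_poly _.
  by rewrite size_unit_poly; case: (k) k_gt0.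
have gA : g \in Aint.
  by rewrite rpred_sum // => i _; rewrite rpredX // rpredB ?rpred1 ?rpredX.
have yA : y \in Aint.
  apply: (monic_Aint_root monic_unit_poly _ ry).
  apply: rpredB; last by rewrite polyOverC; apply: rpredM; [apply: rpred_nat | apply: rpredX].
  apply: rpredD; first by rewrite rpredX // polyOverX.
  apply: polyOverZ; last by rewrite rpredX // polyOverX.
  exact: rpredM (rpredM w_Aint s_Aint) gA.
exists y; split=> // V.
have sV := Aint_vring V s_Aint; have yV := Aint_vring V yA.
have gV := Aint_vring V gA; have wV := Aint_vring V w_Aint.
have mV : m%:R \in V by rewrite rpred_nat.
have eV : s + m%:R * y \in V by rewrite rpredD ?rpredM.
rewrite vunitE //; apply/negP=> emax.
(* Up to a factor, [f z] is the value of the polynomial at [- z / m]: it is 1 at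
   [s] by the choice of the coefficients, and 0 at [x], so that [s - x] is in no
   maximal ideal. *)
pose x := - (m%:R * y); have xV : x \in V by rewrite rpredN rpredM.
have sx : s - x \in vmax V by rewrite opprK.
pose f z := z ^+ k - m%:R * w * s * g * z ^+ k.-1 - (- m%:R) ^+ k * m%:R * w ^+ k.+1.
have fs : f s = 1.
  have Es : s * s ^+ k.-1 = s ^+ k by rewrite -exprS prednK.
  have Eg : (1 - q) * g = 1 - q ^+ k by rewrite -opprB mulNr -subrX1 opprB.
  have E1 : s ^+ k = 1 - q by rewrite /q; ring.
  have E2 : m%:R * w = - q by rewrite mw /q; ring.
  have E3 : (- m%:R) ^+ k * w ^+ k = q ^+ k by rewrite -exprMn mulNr E2 opprK.
  rewrite /f [w ^+ _]exprS.
  have -> : m%:R * w * s * g * s ^+ k.-1 = m%:R * w * ((s * s ^+ k.-1) * g) by ring.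
  have -> : (- m%:R) ^+ k * m%:R * (w * w ^+ k) = m%:R * w * ((- m%:R) ^+ k * w ^+ k) by ring.
  by rewrite E3 Es E2 E1 Eg; ring.
have fx : f x = 0.
  have : unit_poly.[y] = 0 by apply/eqP.
  rewrite /unit_poly !hornerE => /(congr1 (fun z => (- m%:R) ^+ k * z)).
  rewrite mulr0 => <-; rewrite /f /x -mulNr !exprMn.
  by rewrite -[in (- m%:R) ^+ k](prednK k_gt0) exprS; ring.
have : f s - f x \in vmax V.
  have -> : f s - f x = (s ^+ k - x ^+ k) - m%:R * w * s * g * (s ^+ k.-1 - x ^+ k.-1).
    by rewrite /f; ring.
  rewrite rpredB ?vmax_congrX // vmaxM ?vmax_congrX //.
  exact: rpredM (rpredM (rpredM mV wV) sV) gV.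
by rewrite fs fx subr0 (negPf (vmax1 V)).
Qed.

End UnitInClass.

(** * Matrices with a separable characteristic polynomial *)

Section Separable.

Variables (F : fieldType) (n : nat) (t : 'I_n -> F).
Hypothesis t_inj : injective t.
Implicit Types M N P R : 'M[F]_n.

(** The diagonal matrix of the eigenvalues. *)
Definition Theta : 'M[F]_n := diag_mx (\row_i t i).

(** The derivative of [\prod_i ('X - t i)] at [t i]. *)
Definition diff (i : 'I_n) := \prod_(j | j != i) (t i - t j).

(** The projection on the eigenspace of the eigenvalue [t i]. *)
Definition eproj M i : 'M[F]_n := (diff i)^-1 *: \prod_(j | j != i) (M - (t j)%:M).

Lemma diff_neq0 i : diff i != 0.
Proof.
rewrite prodf_seq_neq0; apply/allP=> j _; apply/implyP=> ne_ji.
by rewrite subr_eq0 (inj_eq t_inj) eq_sym.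
Qed.

Lemma eproj_diag P M i : P \in unitmx -> P *m M = Theta *m P ->
  eproj M i = invmx P *m delta_mx i i *m P.
Proof.
move=> uP EPM; apply: (can_inj (mulKmx uP)); rewrite !mulmxA mulmxV // mul1mx.
apply/row_matrixP=> k; rewrite row_mul.
have EkM : row k P *m M = t k *: row k P.
  by rewrite -row_mul EPM row_mul /Theta row_diag_mx -scalemxAl -rowE mxE.
have -> : row k P *m eproj M i = ((diff i)^-1 * \prod_(j | j != i) (t k - t j)) *: row k P.
  rewrite /eproj -scalemxAr -scalerA; congr (_ *: _).
  elim/big_rec2: _ => [|j a A _ IHj]; first by rewrite mulmx1 scale1r.
  rewrite mulmxA mulmxBr EkM mul_mx_scalar -scalerBl -scalemxAl IHj scalerA.
  by rewrite mulrC.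
have [->|ne_ki] := eqVneq k i.
  by rewrite mulVf ?diff_neq0 // scale1r row_mul rowE mul_delta_mx -rowE.
rewrite (bigD1 k) //= subrr mul0r mulr0 scale0r row_mul rowE mul_delta_mx_0 ?mul0mx //.
Qed.

Lemma sep_diag M : char_poly M = \prod_i ('X - (t i)%:P) ->
  exists2 P, P \in unitmx & P *m M = Theta *m P.
Proof.
move=> chM; have ev i : exists v : 'rV_n, v *m M = t i *: v /\ v != 0.
  have /eigenvalueP[v Ev v0] : eigenvalue M (t i).
    rewrite eigenvalue_root_char chM rootE horner_prod (bigD1 i) //=.
    by rewrite hornerXsubC subrr mul0r.
  by exists v.
have {ev} /choice[v vP] := ev.
pose P := \matrix_i v i; have rP i : row i P = v i by rewrite rowK.
have EPM : P *m M = Theta *m P.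
  apply/row_matrixP=> i; rewrite row_mul row_mul /Theta row_diag_mx -scalemxAl -rowE mxE rP.
  by have [] := vP i.
exists P => //; rewrite -row_free_unit -kermx_eq0; apply/eqP/row_matrixP=> l; rewrite row0.
set c := row l _; have cP : c *m P = 0 by rewrite /c -row_mul mulmx_ker row0.
apply/rowP=> i; rewrite [RHS]mxE.
have Ek k : v k *m eproj M i = (k == i)%:R *: v k.
  rewrite /eproj -scalemxAr.
  have -> : v k *m \prod_(j | j != i) (M - (t j)%:M) = (\prod_(j | j != i) (t k - t j)) *: v k.
    elim/big_rec2: _ => [|j a A _ IHj]; first by rewrite mulmx1 scale1r.
    rewrite mulmxA mulmxBr (vP k).1 mul_mx_scalar -scalerBl -scalemxAl IHj scalerA.
    by rewrite mulrC.
  rewrite scalerA; have [->|ne_ki] := eqVneq k i; first by rewrite mulVf ?diff_neq0.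
  by rewrite (bigD1 k) //= subrr mul0r mulr0.
have : c *m P *m eproj M i = c 0 i *: v i.
  rewrite (mulmx_sum_row c) mulmx_suml (bigD1 i) //= big1 ?addr0.
    by rewrite rP -scalemxAl Ek eqxx scale1r.
  by move=> k /negPf ne_ki; rewrite rP -scalemxAl Ek ne_ki scale0r scaler0.
rewrite cP mul0mx => /esym/eqP; rewrite scaler_eq0 (negPf (vP i).2) orbF => /eqP.
by [].
Qed.

Lemma mul_delta_entry (A B : 'M[F]_n) i b c :
  (A *m delta_mx i i *m B) b c = A b i * B i c.
Proof.
rewrite -mulmxA mxE (bigD1 i) //= big1 ?addr0 => [|k /negPf ne_ki].
  rewrite mxE (bigD1 i) //= big1 ?addr0 => [|k /negPf ne_ki]; first by rewrite mxE !eqxx mul1r.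
  by rewrite mxE eqxx ne_ki mul0r.
by rewrite mxE big1 ?mulr0 // => l _; rewrite mxE ne_ki mul0r.
Qed.

(** Diagonalization over a valuation ring. *)
Lemma vring_diag (V : valring F) P M : M \is a mxOver V -> (forall i, t i \in V) ->
  (forall i, diff i \in vunit V) -> P \in unitmx -> P *m M = Theta *m P ->
  exists R, [/\ R \in unitmx, R \is a mxOver V, invmx R \is a mxOver V & R *m M = Theta *m R].
Proof.
move=> MV tV uD uP EPM.
have ex_max i : exists a, P i a != 0 /\ forall b, P i b / P i a \in V.
  have [|x [/mapP[a _ ->] x0] xP] := @vring_gcd _ V [seq P i b | b : 'I_n].
    have : row i P != 0.
      apply/eqP => Pi0; have /rowP/(_ i) : (delta_mx 0 i : 'rV[F]_n) = 0.
        by rewrite -[LHS](mulmxK uP) -rowE Pi0 mul0mx.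
      by rewrite !mxE !eqxx => /eqP; rewrite oner_eq0.
    move=> /rV0Pn[b]; rewrite mxE => Pb; exists (P i b) => //.
    by apply/mapP; exists b; rewrite ?mem_enum.
  exists a; split=> // b; apply: xP; apply/mapP; exists b; rewrite ?mem_enum //.
have /choice[a aP] := ex_max.
pose R := diag_mx (\row_i (P i (a i))^-1) *m P.
have uR : R \in unitmx.
  rewrite unitmx_mul uP andbT unitmxE det_diag unitfE prodf_seq_neq0.
  by apply/allP=> i _; rewrite mxE invr_eq0 (aP i).1.
have ERM : R *m M = Theta *m R.
  by rewrite -mulmxA EPM !mulmxA /Theta diag_mxC.
have RE i b : R i b = P i b / P i (a i) by rewrite /R mul_diag_mx !mxE mulrC.
exists R; split=> //; first by apply/mxOverP=> i b; rewrite RE (aP i).2.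
apply/mxOverP=> b i.
have eV : eproj M i \is a mxOver V.
  rewrite mxOverZ ?vunit_sub ?vunitV //.
  elim/big_ind: _ => [|A C AV CV|j _].
  - by apply: mxOver_scalar; rewrite ?rpred0 ?rpred1.
  - exact: (mxOverM AV CV).
  by rewrite rpredB // mxOver_scalar // rpred0.
have := mxOverP eV b (a i); rewrite (eproj_diag i uR ERM).
have -> : (invmx R *m delta_mx i i *m R) b (a i) = invmx R b i * R i (a i).
  by rewrite mul_delta_entry.
by rewrite RE mulfV ?(aP i).1 // mulr1.
Qed.

End Separable.

(** * From a conjugator of determinant prime to [m] to an invertible one *)

Section UnitConjugator.

Variables (Q : divringClosed algC) (h d m n : nat) (t : 'I_n -> algC).
Variables M N U0 : 'M[algC]_n.
Hypotheses (h_gt0 : (0 < h)%N) (Q_gcd : principal_by_root Q h)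
  (Q_degree : forall x, x \in Q -> (size (minCpoly x) <= d.+1)%N) (m_gt0 : (0 < m)%N).
Hypotheses (t_inj : injective t) (t_Aint : forall i, t i \in Aint)
  (t_Q : forall i, t i \in Q) (m_diff : forall i, m%:R / diff t i \in Aint).
Hypotheses (M_Aint : M \is a mxOver Aint) (N_Aint : N \is a mxOver Aint)
  (M_Q : M \is a mxOver Q).
Hypotheses (chM : char_poly M = \prod_i ('X - (t i)%:P))
  (chN : char_poly N = \prod_i ('X - (t i)%:P)).
Hypotheses (U0_Aint : U0 \is a mxOver Aint) (U0_Q : U0 \is a mxOver Q)
  (U0MN : U0 *m M = N *m U0) (detU0 : \det U0 != 0)
  (detU0_unit : forall V : valring algC, m%:R \in vmax V -> \det U0 \in vunit V).

(** The restriction of [U0] to an eigenspace of [M].  The conjugators are the linear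
    combinations of these matrices. *)
Let W i := U0 *m eproj t M i.

Let m0 : m%:R != 0 :> algC. Proof. by rewrite pnatr_eq0 -lt0n. Qed.

Let prod_over (T : subringClosed algC) i : M \is a mxOver T -> (forall j, t j \in T) ->
  (\prod_(j | j != i) (M - (t j)%:M) : 'M[algC]_n) \is a mxOver T.
Proof.
move=> MT tT; elim/big_ind: _ => [|A C AV CV|j _].
- by apply: mxOver_scalar; rewrite ?rpred0 ?rpred1.
- exact: (mxOverM AV CV).
by rewrite rpredB // mxOver_scalar // rpred0.
Qed.

Let mW_Aint i : m%:R *: W i \is a mxOver Aint.
Proof.
rewrite /W /eproj -scalemxAr scalerA mxOverZ //.
by rewrite mxOverM // prod_over.
Qed.

Let W_Q i : W i \is a mxOver Q.
Proof.
rewrite /W /eproj mxOverM // mxOverZ ?prod_over //.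
by rewrite rpredV rpred_prod // => j _; rewrite rpredB.
Qed.

(** A gcd [g i] of this family divides [m *: W i] and is prime to [m]. *)
Let b i : seq algC := \det U0 :: [seq (m%:R *: W i) x.1 x.2 | x : 'I_n * 'I_n].

Let b_Q i x : x \in b i -> x \in Q.
Proof.
rewrite inE => /predU1P[->|/mapP[[a c] _ ->]].
  rewrite rpred_sum // => s _; rewrite rpredM ?rpredX ?rpredN ?rpred1 // rpred_prod // => k _.
  exact: (mxOverP U0_Q).
by apply/mxOverP; rewrite mxOverZ ?rpred_nat.
Qed.

Let b_Aint i x : x \in b i -> x \in Aint.
Proof.
rewrite inE => /predU1P[->|/mapP[[a c] _ ->]]; last exact: (mxOverP (mW_Aint i)).
rewrite rpred_sum // => s _; rewrite rpredM ?rpredX ?rpredN ?rpred1 // rpred_prod // => k _.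
exact: (mxOverP U0_Aint).
Qed.

Let ex_g i : exists g, [/\ g != 0, g ^+ h \in Q &
    forall V : valring algC, (forall x, x \in b i -> x / g \in V) /\
      exists2 x, x \in b i & x / g \in vunit V].
Proof. by apply: Q_gcd; [exact: b_Q | exists (\det U0); rewrite // inE eqxx]. Qed.

Section Conjugator.

Variable g : 'I_n -> algC.
Hypothesis gP : forall i, [/\ g i != 0, g i ^+ h \in Q &
    forall V : valring algC, (forall x, x \in b i -> x / g i \in V) /\
      exists2 x, x \in b i & x / g i \in vunit V].

Let g0 i : g i != 0. Proof. by have [] := gP i. Qed.

Let g_Aint i : g i \in Aint.
Proof.
apply: AintP => V; have [_ _ /(_ V)[_ [x xb ux]]] := gP i.
have x0 : x != 0.
  by apply: contra (vunit_neq0 ux) => /eqP ->; rewrite mul0r.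
have -> : g i = x * (x / g i)^-1 by field; rewrite x0 g0.
by rewrite rpredM ?(vunit_sub (vunitV ux)) // Aint_vring // (b_Aint xb).
Qed.

Let g_unit i (V : valring algC) : m%:R \in vmax V -> g i \in vunit V.
Proof.
move=> mV; have [_ _ /(_ V)[/(_ (\det U0)) dV _]] := gP i.
apply: (@vunit_dvd _ V (g i) (\det U0 / g i)); first exact: Aint_vring.
  by apply: dV; rewrite inE eqxx.
by rewrite mulrC divfK // detU0_unit.
Qed.

Notation k := (h * (m ^ d)`!)%N.

Let k_gt0 : (0 < k)%N. Proof. by rewrite muln_gt0 h_gt0 fact_gt0. Qed.

Let g_pow i : (g i ^+ k - 1) / m%:R \in Aint.
Proof.
have [_ gQ _] := gP i; rewrite exprM; apply: pow_one => //; first by rewrite rpredX.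
  exact: Q_degree.
by move=> V mV; rewrite vunitX ?g_unit.
Qed.

Lemma unit_root i : exists y, [/\ y \in Aint, root (unit_poly (g i) m k) y &
  forall V : valring algC, g i + m%:R * y \in vunit V].
Proof. exact: unit_in_class m_gt0 k_gt0 (g_Aint i) (g_pow i). Qed.

Variable y : 'I_n -> algC.
Hypothesis yP : forall i, [/\ y i \in Aint, root (unit_poly (g i) m k) (y i) &
  forall V : valring algC, g i + m%:R * y i \in vunit V].

Let e i := g i + m%:R * y i.
Let z i := e i / g i.
(** Above [m] the matrix [U] is integral, because [e i] is congruent to [g i]
    modulo [m] and [m *: W i] is integral; elsewhere it is integral and invertible
    because of the division by [g i]. *)
Let U := \sum_i z i *: W i.

Let UE P : P \in unitmx -> P *m M = Theta t *m P ->
  U = U0 *m invmx P *m diag_mx (\row_i z i) *m P.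
Proof.
move=> uP EPM; have -> : diag_mx (\row_i z i) = \sum_i z i *: delta_mx i i.
  by rewrite diag_mx_sum_delta; apply: eq_bigr => i _; rewrite mxE.
rewrite mulmx_sumr mulmx_suml; apply: eq_bigr => i _.
by rewrite /W (eproj_diag t_inj i uP EPM) -scalemxAr -scalemxAl !mulmxA.
Qed.

Let detU : \det U = \det U0 * \prod_i z i.
Proof.
have [P uP EPM] := sep_diag t_inj chM; rewrite (UE uP EPM) !det_mulmx det_diag.
rewrite det_inv -mulrA mulrAC mulrA; have := uP; rewrite unitmxE unitfE => dP.
under eq_bigr do rewrite mxE; by field.
Qed.

Let UMN : U *m M = N *m U.
Proof.
have [P uP EPM] := sep_diag t_inj chM; rewrite (UE uP EPM) -[LHS]mulmxA EPM.
have EMP : invmx P *m Theta t = M *m invmx P.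
  by apply: (can_inj (mulmxK uP)); rewrite mulmxKV // -mulmxA -EPM mulKmx.
rewrite !mulmxA -U0MN; congr (_ *m P).
by rewrite -(mulmxA _ (diag_mx _)) /Theta diag_mxC mulmxA -(mulmxA U0) EMP !mulmxA.
Qed.

Let U_vmax (V : valring algC) : m%:R \in vmax V -> U \is a mxOver V.
Proof.
move=> mV; have [P uP EPM] := sep_diag t_inj chM.
have sumW : \sum_i W i = U0.
  rewrite -mulmx_sumr (eq_bigr (fun i => invmx P *m delta_mx i i *m P)).
    rewrite -mulmx_suml -mulmx_sumr -mx1_sum_delta mulmx1 mulVmx // mulmx1 //.
  by move=> i _; apply: eproj_diag.
have -> : U = U0 + \sum_i (y i / g i) *: (m%:R *: W i).
  rewrite -{1}sumW -big_split; apply: eq_bigr => i _ /=.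
  rewrite scalerA -{2}[W i]scale1r -scalerDl; congr (_ *: _).
  by rewrite /z /e; field; rewrite g0.
rewrite rpredD ?rpred_sum //.
  by apply: mxOverS U0_Aint; apply: Aint_vring.
move=> i _; rewrite mxOverZ //.
  rewrite rpredM //; first by apply: Aint_vring; have [] := yP i.
  by rewrite (vunit_sub (vunitV (g_unit i mV))).
by apply: mxOverS (mW_Aint i); apply: Aint_vring.
Qed.

Let detU_vmax (V : valring algC) : m%:R \in vmax V -> \det U \in vunit V.
Proof.
move=> mV; rewrite detU vunitM ?detU0_unit // vunit_prod // => i _.
by rewrite vunit_div ?g_unit //; have [_ _] := yP i.
Qed.

(** When [m] is invertible, M and N are diagonalizable over the valuation ring,
    and the i-th eigenvalue of the conjugator is a gcd of the members of [b i]. *)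
Let U_unit (V : valring algC) : m%:R \in vunit V -> U \is a mxOver V /\ \det U \in vunit V.
Proof.
move=> mV.
have tV i : t i \in V by apply: Aint_vring.
have dV i : diff t i \in vunit V.
  apply: (@vunit_dvd _ V _ (m%:R / diff t i)).
  - by apply: rpred_prod => j _; rewrite rpredB.
  - exact: Aint_vring.
  by rewrite mulrC divfK // diff_neq0.
have sub (A : 'M[algC]_n) : A \is a mxOver Aint -> A \is a mxOver V by apply: mxOverS; apply: Aint_vring.
have [P1 uP1 EP1] := sep_diag t_inj chM; have [R1 uR1 ER1] := sep_diag t_inj chN.
have [P [uP PV PiV EP]] := vring_diag t_inj (sub _ M_Aint) tV dV uP1 EP1.
have [R [uR RV RiV ER]] := vring_diag t_inj (sub _ N_Aint) tV dV uR1 ER1.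
have [Y defY] : exists Y, Y = R *m U0 *m invmx P by eexists.
have YV : Y \is a mxOver V by rewrite defY !mxOverM // sub.
have EY : Y *m Theta t = Theta t *m Y.
  have EMP : invmx P *m Theta t = M *m invmx P.
    by apply: (can_inj (mulmxK uP)); rewrite mulmxKV // -mulmxA -EP mulKmx.
  by rewrite defY -mulmxA EMP !mulmxA -(mulmxA R) U0MN !mulmxA ER.
have Ydiag i j : i != j -> Y i j = 0.
  move=> ne_ij; have := congr1 (fun A : 'M_n => A i j) EY.
  rewrite /Theta mul_diag_mx mul_mx_diag !mxE mulrC => /eqP.
  rewrite -subr_eq0 -mulrBl mulf_eq0 subr_eq0 (inj_eq t_inj) eq_sym (negPf ne_ij) /=.
  by move/eqP.
have DY : Y = diag_mx (\row_i Y i i).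
  apply/matrixP=> i j; rewrite !mxE; have [->|ne_ij] := eqVneq i j; first by rewrite mulr1n.
  by rewrite Ydiag // mulr0n.
have DU0 : U0 = invmx R *m Y *m P.
  by rewrite defY !mulmxA mulVmx // mul1mx mulmxKV.
have unit_det (A : 'M[algC]_n) : A \in unitmx -> A \is a mxOver V -> invmx A \is a mxOver V -> \det A \in vunit V.
  move=> uA AV AiV; apply/and3P; rewrite -unitfE -unitmxE uA -det_inv.
  by split=> //; apply: vring_det.
have udP := unit_det _ uP PV PiV; have udR := unit_det _ uR RV RiV.
have detU0E : \det U0 = (\det R)^-1 * \det P * \prod_i Y i i.
  rewrite DU0 !det_mulmx det_inv {1}DY det_diag mulrAC; congr (_ * _).
  by apply: eq_bigr => i _; rewrite mxE.
have Y0 i : Y i i != 0.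
  by apply: contra detU0 => /eqP Yi; rewrite detU0E (bigD1 i) //= Yi mul0r mulr0.
have WE i : W i = Y i i *: (invmx R *m delta_mx i i *m P).
  rewrite /W (eproj_diag t_inj i uP EP) {1}DU0 -!mulmxA mulKVmx //.
  rewrite !mulmxA -[invmx R *m Y *m _]mulmxA.
  have -> : Y *m delta_mx i i = Y i i *: delta_mx i i.
    apply/matrixP=> a c; rewrite {1}DY mul_diag_mx !mxE.
    by have [->|] := eqVneq a i; rewrite ?mulr0.
  by rewrite -scalemxAr -scalemxAl.
have gV i : Y i i / g i \in vunit V.
  have [_ _ /(_ V)[bV [x xb ux]]] := gP i.
  apply/and3P; split; first by rewrite mulf_neq0 ?invr_eq0.
    have -> : Y i i / g i = (R *m (m%:R^-1 *: ((g i)^-1 *: (m%:R *: W i))) *m invmx P) i i.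
      rewrite -!scalemxAr -!scalemxAl WE -!scalemxAr -!scalemxAl !mulmxA mulmxV // mul1mx.
      rewrite mulmxK // !mxE !eqxx /=; field; rewrite ?m0 ?g0 //.
    apply/mxOverP; rewrite !mxOverM // mxOverZ ?(vunit_sub (vunitV mV)) //.
    apply/mxOverP=> a c; rewrite mxE mulrC; apply: bV; rewrite inE; apply/orP; right.
    by apply/mapP; exists (a, c); rewrite ?mem_enum.
  have -> : (Y i i / g i)^-1 = (x / Y i i) / (x / g i).
    have x0 : x != 0 by apply: contra (vunit_neq0 ux) => /eqP ->; rewrite mul0r.
    by field; rewrite x0 g0 Y0.
  rewrite rpredM ?(vunit_sub (vunitV ux)) //.
  move: xb; rewrite inE => /predU1P[->|/mapP[[a c] _ ->]] /=.
    rewrite detU0E (bigD1 i) //= mulrCA mulrAC mulfV // mul1r rpredM //.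
      by rewrite rpredM // vunit_sub // vunitV.
    by rewrite rpred_prod // => j _; apply: (mxOverP YV).
  rewrite WE scalerA mxE mulrAC mulfK // rpredM ?rpred_nat //.
  by rewrite mul_delta_entry rpredM // ?(mxOverP RiV) ?(mxOverP PV).
have zV i : Y i i * z i \in vunit V.
  have -> : Y i i * z i = e i * (Y i i / g i) by rewrite /z; ring.
  by rewrite vunitM //; have [_ _] := yP i.
have DU : U = invmx R *m diag_mx (\row_i (Y i i * z i)) *m P.
  rewrite (UE uP EP) {1}DU0 mulmxK // -!mulmxA; congr (_ *m _).
  rewrite !mulmxA; congr (_ *m _); rewrite {1}DY mul_diag_mx.
  by apply/matrixP=> a c; rewrite !mxE mulrnAr; have [->|] := eqVneq a c.
split.
  rewrite DU !mxOverM // mxOver_diag ?rpred0 //.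
  by apply/mxOverP=> a c; rewrite mxE vunit_sub.
rewrite DU !det_mulmx det_inv det_diag !vunitM ?vunitV // vunit_prod // => i _.
by rewrite mxE.
Qed.

Let U_V (V : valring algC) : U \is a mxOver V /\ \det U \in vunit V.
Proof.
have [mV|] := boolP (m%:R \in vmax V); first by split; [apply: U_vmax | apply: detU_vmax].
by rewrite -vunitE ?rpred_nat //; apply: U_unit.
Qed.

Lemma conjugator_spec : [/\ U \in unitmx, U \is a mxOver Aint, invmx U \is a mxOver Aint,
  U *m M = N *m U &
  forall T : divringClosed algC, {subset Q <= T} -> (forall i, g i \in T) ->
    (forall i, y i \in T) -> U \is a mxOver T].
Proof.
have dU0 : \det U != 0.
  rewrite detU mulf_neq0 // prodf_seq_neq0; apply/allP=> i _; apply/implyP=> _.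
  have [V _] : exists V : valring algC, {subset Aint <= V}.
    have sub0 : {subset pred0 <= Aint} by [].
    by have [//|//|//|V [AV _]] := chevalley Aint_subring sub0; exists V.
  have [_ _ /(_ V)/vunit_neq0 e0] := yP i.
  by rewrite mulf_neq0 ?invr_eq0.
have uU : U \in unitmx by rewrite unitmxE unitfE.
split=> //.
- by apply/mxOverP=> i j; apply: AintP => V; apply: (mxOverP (U_V V).1).
- apply/mxOverP=> i j; apply: AintP => V; have [UV udU] := U_V V.
  rewrite /invmx uU mxE rpredM ?(vunit_sub (vunitV udU)) //.
  by apply: (mxOverP (vring_adj UV)).
move=> T QT gT yT; rewrite rpred_sum // => i _; rewrite mxOverZ //.
  by rewrite rpred_div // rpredD // rpredM ?rpred_nat.
by apply: mxOverS (W_Q i).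
Qed.

End Conjugator.

(** The conjugator with integral inverse has its entries in an extension of
    bounded degree, in two steps: roots [g i] of elements of [Q], then roots
    [y i] of polynomials over the field generated by [g i]. *)
Theorem unit_conjugator : exists (g y : 'I_n -> algC) (U : 'M[algC]_n),
  [/\ forall i, g i ^+ h \in Q,
    forall i, exists p : {poly algC}, [/\ p != 0, (size p <= (h * (m ^ d)`!).+1)%N,
      root p (y i) & forall T : divringClosed algC, g i \in T -> p \is a polyOver T] &
    [/\ U \in unitmx, U \is a mxOver Aint, invmx U \is a mxOver Aint,
      U *m M = N *m U &
      forall T : divringClosed algC, {subset Q <= T} -> (forall i, g i \in T) ->
        (forall i, y i \in T) -> U \is a mxOver T]].
Proof.
have /choice[g gP] := ex_g.
have /choice[y yP] := unit_root gP.
exists g, y; eexists; split; last exact: (conjugator_spec gP yP).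
  by move=> i; have [] := gP i.
move=> i; exists (unit_poly (g i) m (h * (m ^ d)`!)); have [_ ry _] := yP i.
have k_gt0 : (0 < h * (m ^ d)`!)%N by rewrite muln_gt0 h_gt0 fact_gt0.
split=> //.
- by apply/monic_neq0/monic_unit_poly.
- by rewrite size_unit_poly.
by move=> T; apply: unit_poly_over.
Qed.

End UnitConjugator.

(** * Places *)

Section AbsoluteValue.

Variables (F : fieldType) (w : F -> RR).
Hypotheses (w_abs : absolute_value w) (w_na : nonarchimedean w).

Lemma abs_ge0 x : 0 <= w x. Proof. by case: w_abs. Qed.

Lemma absM x y : w (x * y) = w x * w y. Proof. by case: w_abs. Qed.

Lemma abs0 : w 0 = 0. Proof. by case: w_abs => _ /(_ 0)[_ ->]. Qed.

Lemma abs_neq0 x : x != 0 -> w x != 0.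
Proof. by move=> x0; apply: contra x0 => /eqP; case: w_abs => _ /(_ x)[+ _] _ _ => /[apply] ->. Qed.

Lemma abs1 : w 1 = 1.
Proof.
apply: (mulfI (abs_neq0 (oner_neq0 F))); by rewrite -absM !mulr1.
Qed.

Lemma absV x : x != 0 -> w x^-1 = (w x)^-1.
Proof.
move=> x0; apply: (mulfI (abs_neq0 x0)).
by rewrite -absM !mulfV ?abs1 ?abs_neq0.
Qed.

Lemma absN x : w (- x) = w x.
Proof.
have w1 : w (-1) = 1.
  apply/eqP; rewrite -(@eqrXn2 _ 2) ?abs_ge0 //; by rewrite expr2 -absM mulrNN mulr1 abs1 expr1n.
by rewrite -mulN1r absM w1 mul1r.
Qed.

Lemma abs_valring : exists V : valring F,
  (forall x, (x \in V) = (w x <= 1)) /\ forall x, (x \in vmax V) = (w x < 1).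
Proof.
pose P : {pred F} := fun x => w x <= 1.
have Pring : subring_closed P.
  split=> [|x y Px Py|x y Px Py]; rewrite unfold_in ?abs1 //.
    by apply: le_trans (w_na _ _) _; rewrite ge_max absN; apply/andP.
  by rewrite absM mulr_ile1 ?abs_ge0.
pose PM := GRing.isSubringClosed.Build _ P Pring.
pose PR : subringClosed F := HB.pack P PM.
have PV x : (x \in PR) || (x^-1 \in PR).
  have [Px|Px] := leP (w x) 1; first by rewrite [x \in PR]Px.
  have x0 : x != 0 by apply/eqP=> x0; move: Px; rewrite x0 abs0 ltr10.
  have wx0 : 0 < w x by apply: lt_trans Px; apply: ltr01.
  by rewrite [x^-1 \in PR](_ : _ = (w x^-1 <= 1)) // absV // invf_le1 // (ltW Px) orbT.
exists (ValRing PV); split=> x //.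
rewrite unfold_in; have [->|x0 /=] := eqVneq x 0.
  by rewrite abs0 ltr01 orTb andbT; apply: ltW; rewrite /= abs0 ltr01.
rewrite [x \in _](_ : _ = (w x <= 1)) // [x^-1 \in _](_ : _ = (w x^-1 <= 1)) // absV //.
have wx0 : 0 < w x by rewrite lt_def abs_ge0 abs_neq0.
rewrite -ltNge invf_gt1 //; apply: andb_idl; exact: ltW.
Qed.

End AbsoluteValue.

Section PlaceOfValring.

Variables (K : fieldExtType rat) (iota : {rmorphism K -> algC}).
Variables (V : valring algC) (m : nat).
Hypotheses (m_gt0 : (0 < m)%N) (mV : m%:R \in vmax V).

Let prime_in : exists2 p : nat, prime p & p%:R \in vmax V.
Proof.
have exn : exists n : nat, (0 < n)%N && (n%:R \in vmax V) by exists m; rewrite m_gt0.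
case: (ex_minnP exn) => n /andP[n0 nV] min_n; exists n => //.
have n1 : (1 < n)%N.
  by case: n n0 nV {min_n} => [|[|n]] // _; rewrite (negPf (vmax1 V)).
have := nV; rewrite -{1}(divnK (pdiv_dvd n)) natrM => /vmax_prime.
rewrite !rpred_nat => /(_ isT isT)/orP[] inV; last first.
  by rewrite (_ : n = pdiv n) ?pdiv_prime //; apply/eqP; rewrite eqn_leq min_n ?pdiv_gt0 // pdiv_leq.
have d0 : (0 < n %/ pdiv n)%N by rewrite divn_gt0 ?pdiv_gt0 // pdiv_leq.
have := min_n _ (introT andP (conj d0 inV)).
by rewrite leqNgt ltn_Pdiv // prime_gt1 // pdiv_prime.
Qed.

Section Prime.

Variable p : nat.
Hypotheses (p_prime : prime p) (pV : p%:R \in vmax V).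

Let P : algC := p%:R.
Let P0 : P != 0. Proof. by rewrite pnatr_eq0 -lt0n prime_gt0. Qed.

(** The elements whose value is an integral multiple of the value of [p]. *)
Let val x (a : int) := x / P ^ a \in vunit V.

Let valM x y a b : val x a -> val y b -> val (x * y) (a + b).
Proof.
by move=> vx vy; rewrite /val expfzDr // invfM mulrACA vunitM.
Qed.

Let valV x a : val x a -> val x^-1 (- a).
Proof. by move/vunitV; rewrite /val invfM invrK -invr_expz invrK. Qed.

Let valX x a k : val x a -> val (x ^+ k) (a * k%:Z).
Proof.
move=> vx; elim: k => [|k IHk]; first by rewrite mulr0 /val expr0 expr0z divr1 vunit1.
by rewrite exprS -[k.+1]addn1 PoszD mulrDr mulr1 addrC valM.
Qed.

Let val_ge0 x a : val x a -> (x \in V) = (0 <= a).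
Proof.
move=> vx; have Dx : x = (x / P ^ a) * P ^ a by rewrite divfK // expfz_neq0.
have uPinv k : (P ^ (Negz k) \notin V).
  rewrite NegzE -exprnN; have Pk : P ^+ k.+1 \in vmax V by apply: vmaxX.
  by move: Pk; rewrite unfold_in expf_eq0 (negPf P0) andbF /= => /andP[].
case: a vx Dx => k vx Dx /=.
  by rewrite lez_nat leq0n Dx rpredM ?(vunit_sub vx) // -exprnP rpredX // rpred_nat.
have -> : (0 <= Negz k) = false by [].
apply/negP=> xV; case/negP: (uPinv k).
have -> : P ^ Negz k = x * (x / P ^ (Negz k))^-1.
  have x0 : x != 0 by apply: contra (vunit_neq0 vx) => /eqP->; rewrite mul0r.
  by rewrite invf_div mulrC divfK.
by rewrite rpredM // vunit_sub // vunitV.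
Qed.

Let val_uniq x a b : val x a -> val x b -> a = b.
Proof.
move=> va vb; have x0 : x != 0 by apply: contra (vunit_neq0 va) => /eqP->; rewrite mul0r.
have one c d : val x c -> val x d -> 0 <= c - d.
  move=> vc vd; rewrite -(val_ge0 (x := x * x^-1)); last exact: valM (valV vd).
  by rewrite mulfV // rpred1.
by apply/eqP; rewrite eq_le -[a <= b]subr_ge0 -[b <= a]subr_ge0 !one.
Qed.

Let val_nat (n : nat) : (0 < n)%N -> exists a, val n%:R a.
Proof.
move=> n0; have [n' co_n Dn] := pfactor_coprime p_prime n0.
exists (logn p n : int); rewrite /val {1}Dn natrM natrX -exprnP mulfK ?expf_neq0 //.
rewrite vunitE ?rpred_nat //; apply/negP=> n'V.
have n'0 : (0 < n')%N by move: n0; rewrite Dn muln_gt0 => /andP[].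
case: (egcdnP p n'0) => km kn E _.
case/negP: (vmax1 V); have -> : 1 = km%:R * n'%:R - kn%:R * P :> algC.
  rewrite -!natrM E -natrB ?leq_addr // addnC addnK.
  by move: co_n; rewrite coprime_sym => /eqP ->.
by rewrite rpredB ?vmaxM ?rpred_nat.
Qed.

Let val_rat (q : rat) : q != 0 -> exists a, val (ratr q) a.
Proof.
move=> q0; have /val_nat[a va] : (0 < `|denq q|)%N by rewrite absz_gt0 denq_neq0.
have /val_nat[b vb] : (0 < `|numq q|)%N by rewrite absz_gt0 numq_eq0.
exists (b - a); rewrite /ratr.
have -> : (numq q)%:~R / (denq q)%:~R =
    (Num.sg (numq q))%:~R * (`|numq q|%N%:R * (`|denq q|%N%:R)^-1) :> algC.
  rewrite mulrA; congr (_ / _); first by rewrite {1}[numq q]intEsg rmorphM.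
  by rewrite -[in LHS](gtz0_abs (denq_gt0 q)).
have v1 : val (Num.sg (numq q))%:~R 0.
  rewrite /val expr0z divr1 /Num.sg numq_eq0 (negPf q0); case: ifP => _; last exact: vunit1.
  by rewrite /vunit unfold_in rmorphN1 oppr_eq0 oner_eq0 invrN1 rpredN rpred1.
by have := valM v1 (valM vb (valV va)); rewrite add0r.
Qed.

(** A common multiple of the possible ramification indices. *)
Let D := (\dim {:K})`!.

(** In a polynomial relation satisfied by [x], two terms have the same minimal
    value. *)
Let val_ex (x : K) : x != 0 -> exists a, val (iota x ^+ D) a.
Proof.
move=> x0; set X := iota x; have X0 : X != 0 by rewrite fmorph_eq0.
have [q [q0 szq rq]] : exists q : {poly rat},
    [/\ q != 0, (size q <= (\dim {:K}).+1)%N & root (map_poly ratr q) X].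
  have /polyOver1P[q Dq] := minPolyOver 1 x; exists q; split.
  - have := monic_neq0 (monic_minPoly 1 x); rewrite Dq.
    by apply: contra => /eqP ->; rewrite rmorph0.
  - have := size_minPoly 1 x; rewrite Dq size_map_poly => ->.
    by rewrite ltnS adjoin_degreeE dimv1 divn1 dimvS // subvf.
  have := root_minPoly 1 x; rewrite Dq -(fmorph_root iota) -map_poly_comp.
  by congr (root _ _); apply: eq_map_poly => c /=; rewrite alg_num_field fmorph_rat.
pose T i := ratr q`_i * X ^+ i.
have sumT : \sum_(i < size q) T i = 0.
  move: rq; rewrite /root horner_coef size_map_poly => /eqP rq0.
  by rewrite -[RHS]rq0; apply: eq_bigr => i _; rewrite coef_map.
have T0 i : q`_i != 0 -> T i != 0.
  by move=> qi; rewrite mulf_neq0 ?expf_neq0 // fmorph_eq0.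
have [|t [/mapP[i0 _ ->] Ti0] tP] := @vring_gcd _ V [seq T i | i : 'I_(size q)].
  have lt_q : ((size q).-1 < size q)%N by rewrite prednK // size_poly_gt0.
  exists (T (Ordinal lt_q)); first by apply/mapP; exists (Ordinal lt_q); rewrite ?mem_enum.
  by apply: T0; rewrite -/(lead_coef q) lead_coef_eq0.
have [j ne_ji uj] : exists2 j : 'I_(size q), j != i0 & T j / T i0 \in vunit V.
  apply: contrapT => nex; case/negP: (vmax1 V).
  have -> : 1 = - \sum_(j | j != i0) T j / T i0.
    have : \sum_(j < size q) T j / T i0 = 0 by rewrite -mulr_suml sumT mul0r.
    by rewrite (bigD1 i0) //= mulfV // => /eqP; rewrite addr_eq0 => /eqP.
  rewrite rpredN rpred_sum // => j ne_j; apply: contraT; rewrite -vunitE.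
    by move=> uj; case: nex; exists j.
  by apply: tP; apply/mapP; exists j; rewrite ?mem_enum.
have qj : q`_j != 0.
  by have := vunit_neq0 uj; apply: contra => /eqP q_j; rewrite /T q_j rmorph0 !mul0r.
have qi : q`_i0 != 0 by move: Ti0; apply: contra => /eqP q_i; rewrite /T q_i rmorph0 mul0r.
have [e [a [e0 le_e vX]]] : exists e a, [/\ (0 < e)%N, (e <= \dim {:K})%N & val (X ^+ e) a].
  have [a va] := val_rat qj; have [b vb] := val_rat qi.
  have key (i j' : nat) c d : (i < j')%N -> (j' < size q)%N -> q`_i != 0 -> q`_j' != 0 ->
      T j' / T i \in vunit V -> val (ratr q`_j') c -> val (ratr q`_i) d ->
      exists e a, [/\ (0 < e)%N, (e <= \dim {:K})%N & val (X ^+ e) a].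
    move=> lt_ij lt_j qi' qj' u vc vd; exists (j' - i)%N, (d - c); split.
    - by rewrite subn_gt0.
    - by rewrite (leq_trans (leq_subr _ _)) // -ltnS (leq_trans lt_j).
    have vT : val (T j' / T i) 0 by rewrite /val expr0z divr1.
    have := valM vT (valM vd (valV vc)); rewrite add0r; congr (val _ _).
    rewrite /T -[in X ^+ j'](subnK (ltnW lt_ij)) exprD.
    have Xi : X ^+ i != 0 by rewrite expf_neq0.
    have qj2 : ratr q`_j' != 0 :> algC by rewrite fmorph_eq0.
    have qi2 : ratr q`_i != 0 :> algC by rewrite fmorph_eq0.
    by field; rewrite Xi qj2 qi2.
  have [lt|lt|/val_inj/eqP] := ltngtP i0 j; last by rewrite eq_sym (negPf ne_ji).
    exact: (key i0 j a b).
  apply: (key j i0 b a) => //.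
  by rewrite -[_ / _]invrK invf_div vunitV.
have /dvdnP[f ->] : (e %| D)%N by rewrite dvdn_fact // e0.
by rewrite mulnC exprM; exists (a * f%:Z); apply: valX.
Qed.

Lemma prime_place : exists v : K -> RR,
  [/\ place v, nonarchimedean v & forall x, (v x <= 1) = (iota x \in V)].
Proof.
have /choice[o oP] : forall x, exists a, x != 0 -> val (iota x ^+ D) a.
  by move=> x; have [->|/val_ex[a va]] := eqVneq x 0; [exists 0 | exists a].
have D0 : (0 < D)%N by apply: fact_gt0.
have oM x y : x != 0 -> y != 0 -> o (x * y) = o x + o y.
  move=> x0 y0; apply: (val_uniq (x := iota (x * y) ^+ D)); first by apply: oP; rewrite mulf_neq0.
  by rewrite rmorphM exprMn; apply: valM; apply: oP.
have oV x : x != 0 -> (iota x \in V) = (0 <= o x).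
  move=> x0; rewrite -(val_ge0 (oP x x0)); apply/idP/idP; first by move=> ?; rewrite rpredX.
  exact: vringX_inv.
pose v x : RR := if x == 0 then 0 else 2%:R ^ (- o x).
have two0 : 2%:R != 0 :> RR by rewrite pnatr_eq0.
have v_gt0 x : x != 0 -> 0 < v x.
  by move=> x0; rewrite /v (negPf x0) exprz_gt0 // ltr0n.
have v_le x y : x != 0 -> y != 0 -> (v x <= v y) = (o y <= o x).
  move=> x0 y0; rewrite /v (negPf x0) (negPf y0) ler_eXz2l ?ltr1n //.
  by rewrite lerN2.
have v0 : v 0 = 0 by rewrite /v eqxx.
have o1 : o 1 = 0.
  by apply: (@addrI _ (o 1)); rewrite -oM ?oner_eq0 // mulr1 addr0.
have v1 : v 1 = 1 by rewrite /v oner_eq0 o1 oppr0 expr0z.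
have v_le1 x : (v x <= 1) = (iota x \in V).
  have [->|x0] := eqVneq x 0; first by rewrite v0 rmorph0 rpred0 ler01.
  by rewrite -v1 v_le ?oner_eq0 // o1 oV.
have vM x y : v (x * y) = v x * v y.
  have [->|x0] := eqVneq x 0; first by rewrite !mul0r v0 mul0r.
  have [->|y0] := eqVneq y 0; first by rewrite !mulr0 v0 mulr0.
  by rewrite /v mulf_eq0 (negPf x0) (negPf y0) /= oM // opprD expfzDr.
have v_ge0 x : 0 <= v x.
  by have [->|/v_gt0/ltW//] := eqVneq x 0; rewrite v0.
have v_na : nonarchimedean v.
  move=> x y; have [->|x0] := eqVneq x 0; first by rewrite add0r le_max lexx orbT.
  have [->|y0] := eqVneq y 0; first by rewrite addr0 le_max lexx.
  wlog le_yx : x y x0 y0 / v y <= v x => [IH|].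
    by case/orP: (le_total (v x) (v y)) => le; [rewrite addrC maxC|]; apply: IH.
  rewrite le_max; apply/orP; left; have Dxy : x + y = x * (1 + y / x) by field; rewrite x0.
  rewrite Dxy vM ler_piMr // v_le1 rmorphD rmorph1 rpredD ?rpred1 // -v_le1.
  have := le_yx; rewrite -{1}[y](divfK x0) vM -ler_pdivlMr ?v_gt0 //.
  by rewrite mulfV // gt_eqF // v_gt0.
exists v; split=> //; split.
  split=> // [x|x y].
    split=> [vx|->//]; apply/eqP; apply: contraT => /v_gt0; by rewrite vx ltxx.
  apply: le_trans (v_na x y) _; rewrite ge_max.
  by rewrite lerDl lerDr !v_ge0.
have p0 : p%:R != 0 :> K by rewrite -(fmorph_eq0 iota) rmorph_nat.
exists p%:R => // vp1; move: pV; rewrite unfold_in (negPf P0) /= => /andP[_ /negP]; apply.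
rewrite -(rmorph_nat iota) -fmorphV -v_le1.
by have := vM p%:R p%:R^-1; rewrite mulfV // v1 vp1 mul1r => <-.
Qed.

End Prime.

(** A valuation ring in which [m] is not invertible induces a finite place. *)
Lemma valring_place : exists v : K -> RR,
  [/\ place v, nonarchimedean v & forall x, (v x <= 1) = (iota x \in V)].
Proof. by have [p p_prime pV] := prime_in; apply: prime_place p_prime pV. Qed.

End PlaceOfValring.

(** * Approximation of a local conjugator *)

Section Approximation.

Variables (K F : fieldType) (v : K -> RR) (w : F -> RR) (iota : {rmorphism K -> F}).
Hypotheses (v_na : nonarchimedean v) (w_abs : absolute_value w)
  (w_iota : forall x, w (iota x) = v x)
  (dense : forall (y : F) (e : RR), 0 < e -> exists x : K, w (y - iota x) < e).

Lemma completion_nonarch : nonarchimedean w.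
Proof.
have [w0 _ _ wD] := w_abs.
move=> x y; rewrite leNgt; apply/negP=> lt_max.
pose e := (w (x + y) - Num.max (w x) (w y)) / 4%:R.
have e0 : 0 < e by rewrite divr_gt0 ?subr_gt0 // ltr0n.
have [x' Hx] := dense x e0; have [y' Hy] := dense y e0.
have Hx' : v x' < w x + e.
  rewrite -w_iota; have -> : iota x' = x + - (x - iota x') by ring.
  by apply: le_lt_trans (wD _ _) _; rewrite absN // ltrD2l.
have Hy' : v y' < w y + e.
  rewrite -w_iota; have -> : iota y' = y + - (y - iota y') by ring.
  by apply: le_lt_trans (wD _ _) _; rewrite absN // ltrD2l.
have Hxy : w (x + y) <= v (x' + y') + (w (x - iota x') + w (y - iota y')).
  have -> : x + y = iota (x' + y') + ((x - iota x') + (y - iota y')) by rewrite rmorphD; ring.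
  apply: le_trans (wD _ _) _; rewrite w_iota lerD2l; exact: wD.
have := v_na x' y'; rewrite le_max => Hmax.
have M1 : w x <= Num.max (w x) (w y) by rewrite le_max lexx.
have M2 : w y <= Num.max (w x) (w y) by rewrite le_max lexx orbT.
have De : e * 4%:R = w (x + y) - Num.max (w x) (w y) by rewrite divfK // pnatr_eq0.
move: e0 Hx Hy Hx' Hy' Hxy Hmax M1 M2 De; move: (e) (Num.max _ _) => e' mx.
move=> e0 Hx Hy Hx' Hy' Hxy Hmax M1 M2 De; case/orP: Hmax => Hmax; lra.
Qed.

(** The equation [U *m M = N *m U] is linear over [K], so its solutions in the
    completion are approximated by solutions in [K]. *)
Lemma approx_conjugator n (M N : 'M[K]_n) :
  similar_over (local_integer w) (map_mx iota M) (map_mx iota N) ->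
  exists U : 'M[K]_n, [/\ U *m M = N *m U, forall i j, v (U i j) <= 1 & v (\det U) = 1].
Proof.
have w_na := completion_nonarch; have [w0 _ _ wD] := w_abs.
move=> [U' [uU' U'int U'Vint EU']].
have [W [WE WmE]] := abs_valring w_abs w_na.
have U'W : U' \is a mxOver W by apply/mxOverP=> i j; rewrite WE; apply: U'int.
have U'VW : invmx U' \is a mxOver W by apply/mxOverP=> i j; rewrite WE; apply: U'Vint.
pose A := lin_mx (mulmxr M) - lin_mx (mulmx N) : 'M[K]_(n * n).
have EA (X : 'M[K]_n) : mxvec X *m A = mxvec (X *m M - N *m X).
  by rewrite mulmxBr !mul_vec_lin linearB.
have EAF : mxvec U' *m map_mx iota A = 0.
  have -> : map_mx iota A =
      lin_mx (mulmxr (map_mx iota M)) - lin_mx (mulmx (map_mx iota N)) :> 'M_(n * n).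
    by rewrite map_mxB; congr (_ - _); apply: map_lin_mx => X; rewrite /= map_mxM.
  by rewrite mulmxBr !mul_vec_lin /= EU' subrr.
have [Z ZA /submxP[c Dc]] : exists2 Z : 'M_(n * n), Z *m A = 0 & (mxvec U' <= map_mx iota Z)%MS.
  by exists (kermx A); [apply: mulmx_ker | rewrite map_kermx; apply/sub_kermxP].
have v0 x : 0 <= v x by rewrite -w_iota w0.
pose C := \sum_i \sum_j v (Z i j).
have C0 i j : v (Z i j) <= C.
  rewrite /C (bigD1 i) //= (bigD1 j) //= -addrA lerDl.
  by apply: addr_ge0; apply: sumr_ge0 => k _ //; apply: sumr_ge0.
have Cge0 : 0 <= C by rewrite sumr_ge0 // => i _; apply: sumr_ge0.
pose e : RR := (C + 1)^-1.
have C1 : 0 < C + 1 by rewrite ltr_wpDl.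
have e0 : 0 < e by rewrite invr_gt0.
have /choice[c' c'P] : forall i, exists x, w (c 0 i - iota x) < e by move=> i; apply: dense.
pose U := vec_mx ((\row_i c' i) *m Z).
have EU : U *m M = N *m U.
  apply/eqP; rewrite -subr_eq0 -mxvec_eq0 -EA vec_mxK -mulmxA ZA mulmx0 //.
have diffU i j : U' i j - map_mx iota U i j \in vmax W.
  have -> : U' = vec_mx (c *m map_mx iota Z) by rewrite -Dc mxvecK.
  rewrite /U map_vec_mx map_mxM -[X in _ - X]/((vec_mx _) i j).
  rewrite !mxE -sumrB rpred_sum // => l _; rewrite !mxE -mulrBl WmE absM // w_iota.
  apply: (@le_lt_trans _ _ (e * C)).
    by rewrite ler_pM ?w0 ?v0 ?C0 ?(ltW (c'P _)).
  by rewrite /e mulrC ltr_pdivrMr // mul1r ltrDl.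
have UW : map_mx iota U \is a mxOver W.
  apply/mxOverP=> i j; rewrite -[_ i j](subKr (U' i j)).
  by rewrite rpredB ?(mxOverP U'W) // vmax_sub.
have dU' : \det U' \in vunit W.
  apply/and3P; rewrite -unitfE -unitmxE uU' -det_inv; split=> //; exact: vring_det.
have := vunit_congr dU' (vmax_congr_det U'W UW diffU); rewrite det_map_mx => ud.
exists U; split=> // [i j|].
  by have := mxOverP UW i j; rewrite WE mxE w_iota.
apply/eqP; rewrite eq_le -!w_iota.
have := vunit_sub ud; rewrite WE => -> /=.
by rewrite leNgt -WmE vunitN_vmax.
Qed.

End Approximation.

Lemma similar_at_approx (K : fieldType) (v : K -> RR) n (M N : 'M[K]_n) :
  nonarchimedean v -> similar_at v M N ->
  exists U : 'M[K]_n, [/\ U *m M = N *m U, forall i j, v (U i j) <= 1 & v (\det U) = 1].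
Proof.
move=> v_na [F [w [iota [[w_abs w_iota dense _] simMN]]]].
exact: approx_conjugator simMN.
Qed.

(** * A conjugator of determinant prime to [m] *)

Section PrimeConjugator.

Variables (Q : divringClosed algC) (h m n : nat) (M N : 'M[algC]_n).
Hypotheses (h_gt0 : (0 < h)%N) (Q_gcd : principal_by_root Q h) (m_gt1 : (1 < m)%N).
Hypothesis local_conj : forall V : valring algC, m%:R \in vmax V ->
  exists U : 'M[algC]_n, [/\ U *m M = N *m U, U \is a mxOver Q, U \is a mxOver V &
    \det U \in vunit V].

(** The integral solutions of [U *m M = N *m U] over [Q]. *)
Let good (U : 'M[algC]_n) := [/\ U *m M = N *m U, U \is a mxOver Q & U \is a mxOver Aint].

(** If [g] generates the fractional ideal spanned by 1 and the entries of [U], then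
    [g^-1] is integral and clears the denominators of [U]. *)
Let integral_conj (V : valring algC) : m%:R \in vmax V ->
  exists U, good U /\ \det U \in vunit V.
Proof.
move=> mV; have [U [EU UQ UV uU]] := local_conj mV.
pose b := 1 :: [seq U x.1 x.2 | x : 'I_n * 'I_n].
have inb i j : U i j \in b.
  by rewrite inE; apply/orP; right; apply/mapP; exists (i, j); rewrite ?mem_enum.
have bQ x : x \in b -> x \in Q.
  by rewrite inE => /predU1P[->|/mapP[[i j] _ ->]]; [exact: rpred1 | exact: (mxOverP UQ)].
have b1 : exists2 x, x \in b & x != 0 by exists 1; rewrite ?inE ?eqxx ?oner_eq0.
have [g [g0 gQ gP]] := Q_gcd bQ b1.
have gA x : x \in b -> x / g \in Aint by move=> xb; apply: AintP => W; apply: (gP W).1.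
have gA1 : g^-1 \in Aint by rewrite -[g^-1]mul1r gA // inE eqxx.
have ug : g \in vunit V.
  have [_ [x xb ux]] := gP V.
  have xV : x \in V.
    by move: xb; rewrite inE => /predU1P[->|/mapP[[i j] _ ->]]; [exact: rpred1 | exact: (mxOverP UV)].
  have x0 : x != 0 by apply: contra (vunit_neq0 ux) => /eqP ->; rewrite mul0r.
  apply/and3P; split=> //; last exact: Aint_vring.
  by rewrite -[g]invrK -[g^-1](mulKf x0) invfM mulrC rpredM ?invrK // (vunit_sub (vunitV ux)).
exists (g^-1 ^+ h *: U); split; last first.
  by rewrite detZ vunitM // vunitX // vunitX // vunitV.
split; first by rewrite -scalemxAl EU scalemxAr.
  by rewrite mxOverZ // exprVn rpredV.
apply/mxOverP=> i j; rewrite mxE.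
by rewrite -[in X in _ ^+ X](prednK h_gt0) exprSr -mulrA rpredM ?rpredX // mulrC gA.
Qed.

Let good0 : good 0.
Proof. by split; rewrite ?mul0mx ?mulmx0 // mxOver0 ?rpred0. Qed.

(** Two solutions are combined by a power [e] of a determinant that is idempotent
    modulo [m]: modulo a prime divisor of [m] the combination [e *: U1 + (1 - e)
    *: U'] equals the first or the second solution. *)
Let combine (l : seq 'M[algC]_n) : (forall U, U \in l -> good U) ->
  exists2 U, good U & forall V : valring algC, m%:R \in vmax V ->
    (exists2 U', U' \in l & \det U' \notin vmax V) -> \det U \in vunit V.
Proof.
elim: l => [|U1 l IHl] lP; first by exists 0 => // V _ [].
have [U' lU'|U' [EU' QU' AU'] U'P] := IHl; first by apply: lP; rewrite inE lU' orbT.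
have [|EU1 QU1 AU1] := lP U1; first by rewrite inE eqxx.
have det_in (T : subringClosed algC) (A : 'M[algC]_n) : A \is a mxOver T -> \det A \in T.
  move=> /mxOverP AT; rewrite rpred_sum // => s _.
  by rewrite rpredM ?rpredX ?rpredN ?rpred1 // rpred_prod.
have dA := det_in _ _ AU1; have dQ := det_in _ _ QU1.
have [k k0 idem] := pow_idempotent dA (ltnW m_gt1).
pose e := \det U1 ^+ k; have eA : e \in Aint by rewrite rpredX.
have eQ : e \in Q by rewrite rpredX.
exists (e *: U1 + (1 - e) *: U').
  split; first by rewrite mulmxDl mulmxDr -!scalemxAl -!scalemxAr EU1 EU'.
    by rewrite rpredD ?mxOverZ // rpredB ?rpred1.
  by rewrite rpredD ?mxOverZ // rpredB ?rpred1.
move=> V mV [U2 U2l uU2]; have sub := Aint_vring V.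
have eV := sub _ eA; have e1V : 1 - e \in V by rewrite rpredB ?rpred1.
have U1V : U1 \is a mxOver V by apply: mxOverS AU1.
have U'V : U' \is a mxOver V by apply: mxOverS AU'.
have UV : e *: U1 + (1 - e) *: U' \is a mxOver V by rewrite rpredD ?mxOverZ.
have m0 : m%:R != 0 :> algC by rewrite pnatr_eq0 -lt0n ltnW.
have ee : e * (e - 1) \in vmax V.
  by rewrite -[_ * _](divfK m0) vmaxM // sub.
have [dV|dV] := boolP (\det U1 \in vmax V).
  have eV' : e \in vmax V by apply: vmaxX.
  have U'u : \det U' \in vunit V.
    apply: U'P => //; exists U2 => //; move: U2l; rewrite inE => /predU1P[U2E|//].
    by rewrite U2E dV in uU2.
  apply: (vunit_congr U'u); apply: vmax_congr_det => // i j.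
  have -> : U' i j - (e *: U1 + (1 - e) *: U') i j = (U' i j - U1 i j) * e by rewrite !mxE; ring.
  by rewrite vmaxM // rpredB ?(mxOverP U'V) ?(mxOverP U1V).
have ud : \det U1 \in vunit V by rewrite vunitE ?sub.
have eV' : 1 - e \in vmax V.
  have ue : e \in vunit V by apply: vunitX.
  have := vmaxM (vunit_sub (vunitV ue)) ee; rewrite mulKf ?(vunit_neq0 ue) // => e1.
  by rewrite -opprB rpredN.
apply: (vunit_congr ud); apply: vmax_congr_det => // i j.
have -> : U1 i j - (e *: U1 + (1 - e) *: U') i j = (U1 i j - U' i j) * (1 - e) by rewrite !mxE; ring.
by rewrite vmaxM // rpredB ?(mxOverP U'V) ?(mxOverP U1V).
Qed.

(** The determinants of the integral conjugators and [m] generate the unit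
    ideal; finitely many of them suffice, and they combine into one. *)
Theorem prime_conjugator : exists U, [/\ U *m M = N *m U, U \is a mxOver Q,
  U \is a mxOver Aint, \det U != 0 &
  forall V : valring algC, m%:R \in vmax V -> \det U \in vunit V].
Proof.
pose a : {pred algC} := fun x => `[< exists (l : seq (algC * 'M[algC]_n)) (r : algC),
  [/\ forall u, u \in l -> u.1 \in Aint /\ good u.2, r \in Aint &
      x = \sum_(u <- l) u.1 * \det u.2 + r * m%:R] >].
have det_A (A : 'M[algC]_n) : A \is a mxOver Aint -> \det A \in Aint.
  move=> /mxOverP AA; rewrite rpred_sum // => s _.
  by rewrite rpredM ?rpredX ?rpredN ?rpred1 // rpred_prod.
have a1 : 1 \in a.
  apply: Aint_ideal1.
  - move=> _ /asboolP[l [r [lP rA ->]]]; rewrite rpredD ?rpredM ?rpred_nat //.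
    rewrite big_seq rpred_sum // => u /lP[uA [_ _ gA]]; by rewrite rpredM ?det_A.
  - move=> _ _ /asboolP[l [r [lP rA ->]]] /asboolP[l' [r' [lP' rA' ->]]].
    apply/asboolP; exists (l ++ l'), (r + r'); split; [|exact: rpredD|].
      by move=> u; rewrite mem_cat => /orP[/lP|/lP'].
    by rewrite big_cat mulrDl /= addrACA.
  - move=> c _ cA /asboolP[l [r [lP rA ->]]]; apply/asboolP.
    exists [seq (c * u.1, u.2) | u <- l], (c * r); split; [|exact: rpredM|].
      by move=> _ /mapP[u /lP[uA gu] ->] /=; split=> //; apply: rpredM.
    by rewrite big_map mulrDr mulr_sumr mulrA; congr (_ + _); apply: eq_bigr => u _; rewrite mulrA.
  move=> V; have [mV|mV] := boolP (m%:R \in vmax V); last first.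
    exists m%:R => //; apply/asboolP; exists [::], 1; rewrite big_nil add0r mul1r.
    by split=> //; apply: rpred1.
  have [U [gU uU]] := integral_conj mV; exists (\det U); last exact: vunitN_vmax.
  apply/asboolP; exists [:: (1, U)], 0; rewrite big_seq1 mul1r mul0r addr0.
  by split=> [u||//]; [rewrite inE => /eqP ->; split=> //; apply: rpred1 | apply: rpred0].
have /asboolP[l [r [lP rA E1]]] := a1.
have lgood U : U \in [seq u.2 | u <- l] -> good U by move=> /mapP[u /lP[_ gu] ->].
have [U [EU QU AU] UP] := combine lgood.
have {}UP V : m%:R \in vmax V -> \det U \in vunit V.
  move=> mV; apply: UP => //; apply: contrapT => nex; case/negP: (vmax1 V).
  rewrite E1 rpredD ?vmaxM ?Aint_vring // big_seq rpred_sum // => u ul.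
  have [uA _] := lP u ul; rewrite vmaxM ?Aint_vring //; apply: contraT => udet.
  by case: nex; exists u.2 => //; apply: map_f.
exists U; split=> //; apply/eqP=> d0.
have m0 : m%:R != 0 :> algC by rewrite pnatr_eq0 -lt0n ltnW.
(* If the determinant vanished, no valuation ring would lie above [m]. *)
suff : m%:R^-1 \in Aint.
  move=> /Cint_rat_Aint; rewrite rpredV rpred_nat => /(_ isT).
  move=> /intrP[z Dz].
  have : z%:~R * m%:R = 1 :> algC by rewrite -Dz mulVf.
  rewrite -[m%:R]/(m%:~R) -intrM -[1]/(1%:~R) => /intr_inj zm.
  move/(congr1 absz): zm; rewrite abszM => /eqP; rewrite muln_eq1 => /andP[_ /eqP m1].
  by move: m_gt1; rewrite -[m]/(`|m%:Z|%N) m1.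
apply: AintP => V; apply: contraT => mV.
have : m%:R \in vmax V by rewrite -[m%:R]invrK vring_vunit ?invr_eq0.
by move/UP/vunit_neq0; rewrite d0 eqxx.
Qed.

End PrimeConjugator.

(** * Extensions of bounded degree inside the algebraic numbers *)

(** The image of a field in the algebraic numbers. *)
Definition fimage (L : fieldType) (j : {rmorphism L -> algC}) : {pred algC} :=
  fun x => `[< exists y, j y = x >].

Lemma fimageP (L : fieldType) (j : {rmorphism L -> algC}) x :
  reflect (exists y, j y = x) (x \in fimage j).
Proof. exact: asboolP. Qed.

Lemma fimage_divring (L : fieldType) (j : {rmorphism L -> algC}) : divring_closed (fimage j).
Proof.
split=> [|_ _ /fimageP[x <-] /fimageP[y <-]|_ _ /fimageP[x <-] /fimageP[y <-]]; apply/fimageP.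
- by exists 1; rewrite rmorph1.
- by exists (x - y); rewrite rmorphB.
by exists (x / y); rewrite fmorph_div.
Qed.
HB.instance Definition _ (L : fieldType) (j : {rmorphism L -> algC}) :=
  GRing.isDivringClosed.Build algC (fimage j) (fimage_divring j).

Lemma integral_fmorph (L : fieldType) (f : {rmorphism L -> algC}) x :
  integral x <-> f x \in Aint.
Proof.
rewrite -integral_Aint; split=> -[p mon_p rp]; exists p => //; move: rp;
  rewrite -(fmorph_root f) -map_poly_comp; congr (is_true (root _ _));
  by apply: eq_map_poly => c /=; rewrite rmorph_int.
Qed.

Section Extensions.

Variable K : fieldExtType rat.

Lemma adjoin_one (L0 : fieldExtType K) (j : {rmorphism L0 -> algC}) (z : algC) (q : {poly L0}) :
  q != 0 -> root (map_poly j q) z ->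
  exists (L1 : fieldExtType K) (j1 : {rmorphism L1 -> algC}),
    [/\ forall x, exists y, j1 y = j x, exists y, j1 y = z,
        forall a : K, j1 a%:A = j a%:A &
        (\dim {:L1} <= (size q).-1 * \dim {:L0})%N].
Proof.
move=> q0 qz.
pose P k := `[< exists p : {poly L0}, [/\ p != 0, root (map_poly j p) z & size p = k] >].
have exP : exists k, P k by exists (size q); apply/asboolP; exists q.
case: (ex_minnP exP) => k /asboolP[p [p0 pz Dk]] min_k.
have irr_p : irreducible_poly p.
  apply/(subfx_irreducibleP pz p0) => p' p'z p'0; rewrite Dk; apply: min_k.
  by apply/asboolP; exists p'.
pose L2 : fieldExtType L0 := SubFieldExtType pz irr_p.
pose L1 : fieldExtType K := baseFieldType L2.
pose j1 : {rmorphism L1 -> algC} := @subfx_inj _ _ j z p : {rmorphism L2 -> algC}.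
exists L1, j1; split.
- by move=> x; exists (x%:A : L2); apply: subfx_inj_base.
- by exists (subfx_root j z p); apply: subfx_inj_root.
- move=> a; rewrite /= [a%:A](_ : _ = ((a%:A : L0)%:A : L2)) //.
  exact: subfx_inj_base.
have -> : \dim {:L1} = (\dim {:L2} * \dim {:L0})%N.
  rewrite -dim_baseVspace; congr (\dim _).
  apply/vspaceP=> x; rewrite [LHS]memvf [RHS]mem_baseVspace.
  exact/esym/(memvf (x : L2)).
rewrite leq_mul2r; apply/orP; right.
have -> : \dim {:L2} = (size p).-1 by rewrite dimvf.
rewrite Dk -!subn1 leq_sub2r // min_k //; by apply/asboolP; exists q.
Qed.

(** A number field over which a finite family of algebraic numbers have degree at
    most [k] has an extension of bounded degree containing this family. *)
Lemma adjoin_family (L0 : fieldExtType K) (j : {rmorphism L0 -> algC}) (k : nat) (zs : seq algC) :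
  (forall z, z \in zs -> exists p : {poly algC}, [/\ p != 0, (size p <= k.+1)%N,
    root p z & p \is a polyOver (fimage j)]) ->
  exists (L1 : fieldExtType K) (j1 : {rmorphism L1 -> algC}),
    [/\ {subset fimage j <= fimage j1}, {subset zs <= fimage j1},
        forall a : K, j1 a%:A = j a%:A & (\dim {:L1} <= k ^ size zs * \dim {:L0})%N].
Proof.
elim: zs L0 j => [|z zs IHzs] L0 j zsP.
  by exists L0, j; split; rewrite ?expn0 ?mul1n.
have [|p [p0 szp pz /polyOverP Lp]] := zsP z; first by rewrite inE eqxx.
have /choice[c Dc] : forall i, exists x, j x = p`_i by move=> i; apply/fimageP.
pose q := \poly_(i < size p) c i.
have Dq : map_poly j q = p.
  apply/polyP=> i; rewrite coef_map coef_poly.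
  by case: ltnP => [_|le_p]; rewrite /= ?Dc // rmorph0 nth_default.
have q0 : q != 0 by rewrite -(map_poly_eq0 j) Dq.
have qz : root (map_poly j q) z by rewrite Dq.
have [L1 [j1 [sub1 zL1 j1K dim1]]] := adjoin_one q0 qz.
have sub01 : {subset fimage j <= fimage j1}.
  by move=> _ /fimageP[x <-]; apply/fimageP; have [y <-] := sub1 x; exists y.
have zsP1 z' : z' \in zs -> exists p : {poly algC}, [/\ p != 0, (size p <= k.+1)%N,
    root p z' & p \is a polyOver (fimage j1)].
  move=> z'zs; have [|p' [p'0 szp' p'z Lp']] := zsP z'; first by rewrite inE z'zs orbT.
  by exists p'; split=> //; apply: polyOverS Lp'.
have [L2 [j2 [sub2 zsL2 j2K dim2]]] := IHzs L1 j1 zsP1.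
exists L2, j2; split.
- by move=> x /sub01/sub2.
- by move=> x; rewrite inE => /predU1P[->|/zsL2//]; apply/sub2/fimageP.
- by move=> a; rewrite j2K.
apply: leq_trans dim2 _; rewrite /= expnS -mulnA mulnCA leq_mul2l; apply/orP; right.
apply: leq_trans dim1 _; rewrite leq_mul2r -(size_map_poly j) Dq; apply/orP; right.
by rewrite -subn1 leq_subLR add1n.
Qed.

End Extensions.

(** * Discriminants of Galois stable lists *)

Lemma prod_seq_le_exp (I : eqType) (u : seq I) (P : pred I) (f : I -> algC) (b : algC) (k : nat) :
  1 <= b -> (size u <= k)%N -> (forall x, x \in u -> P x -> 0 <= f x <= b) ->
  \prod_(x <- u | P x) f x <= b ^+ k.
Proof.
move=> b1 szk fP; apply: (@le_trans _ _ (\prod_(x <- u) b)); last first.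
  by rewrite big_const_seq count_predT iter_mulr_1 ler_weXn2l.
rewrite big_mkcond big_seq [X in _ <= X]big_seq; apply: ler_prod => x xu.
by case: ifP => Px; [apply: fP | rewrite ler01].
Qed.

(** The product of the differences between [x] and the other members of [u]. *)
Definition prod_diff (F : fieldType) (u : seq F) (x : F) : F := \prod_(y <- u | y != x) (x - y).

(** The discriminant of a list, up to sign. *)
Definition discr (F : fieldType) (u : seq F) : F := \prod_(x <- u) prod_diff u x.

Lemma discr_neq0 (F : fieldType) (u : seq F) : discr u != 0.
Proof.
rewrite prodf_seq_neq0; apply/allP=> x _ /=; rewrite prodf_seq_neq0; apply/allP=> y _.
by apply/implyP; rewrite subr_eq0 eq_sym.
Qed.

Lemma gal_perm_eq (L : splittingFieldType rat) (u : seq L) (g : gal_of {:L}) :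
  uniq u -> (forall x, x \in u -> g x \in u) -> perm_eq (map g u) u.
Proof.
move=> u_uniq u_gal.
have um : uniq (map g u) by rewrite map_inj_uniq //; apply: fmorph_inj.
have sub : {subset map g u <= u} by move=> w /mapP[x xu ->]; apply: u_gal.
have le_u : (size u <= size (map g u))%N by rewrite size_map.
have [_ E] := uniq_min_size um sub le_u.
exact: uniq_perm um u_uniq E.
Qed.

Section StableList.

Variables (L : splittingFieldType rat) (phi : {rmorphism L -> algC}).
Variables (u : seq L) (k B : nat).
Hypotheses (u_uniq : uniq u) (u_size : (size u <= k)%N) (B_gt0 : (0 < B)%N).
Hypothesis u_gal : forall (g : gal_of {:L}) x, x \in u -> g x \in u.
Hypothesis u_Aint : forall x, x \in u -> phi x \in Aint.
Hypothesis u_bound : forall x, x \in u -> `|phi x| <= B%:R.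

Let gal_perm (g : gal_of {:L}) : perm_eq (map g u) u.
Proof. exact: gal_perm_eq (u_gal g). Qed.

Lemma prod_diff_gal (g : gal_of {:L}) x : g (prod_diff u x) = prod_diff u (g x).
Proof.
rewrite /prod_diff rmorph_prod -[in RHS](perm_big _ (gal_perm g)) /= big_map.
by apply: eq_big => [y|y _]; rewrite ?(inj_eq (fmorph_inj _)) // rmorphB.
Qed.

Lemma discr_gal (g : gal_of {:L}) : g (discr u) = discr u.
Proof.
rewrite /discr rmorph_prod -[in RHS](perm_big _ (gal_perm g)) /= big_map.
by apply: eq_bigr => y _; rewrite prod_diff_gal.
Qed.

Lemma prod_diff_Aint x : x \in u -> phi (prod_diff u x) \in Aint.
Proof.
move=> xu; rewrite rmorph_prod big_seq_cond rpred_prod // => y /andP[yu _].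
by rewrite rmorphB rpredB ?u_Aint.
Qed.

Lemma discr_Aint : phi (discr u) \in Aint.
Proof. by rewrite rmorph_prod big_seq rpred_prod //; apply: prod_diff_Aint. Qed.

Let B2 : 1 <= (2 * B)%:R :> algC. Proof. by rewrite ler1n muln_gt0. Qed.

Lemma prod_diff_bound x : x \in u -> `|phi (prod_diff u x)| <= (2 * B)%:R ^+ k.
Proof.
move=> xu; rewrite rmorph_prod normr_prod; apply: prod_seq_le_exp => // y yu _.
rewrite normr_ge0 /= rmorphB (le_trans (ler_normB _ _)) // natrM mulr_natl mulr2n.
by rewrite lerD ?u_bound.
Qed.

Lemma prod_prod_diff_bound (P : pred L) :
  `|phi (\prod_(y <- u | P y) prod_diff u y)| <= ((2 * B) ^ (k * k))%:R.
Proof.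
rewrite expnM natrX rmorph_prod normr_prod natrX; apply: prod_seq_le_exp => // [|y yu _].
  by rewrite exprn_ege1.
by rewrite normr_ge0 prod_diff_bound.
Qed.

(** The discriminant is a rational integer. *)
Lemma discr_int : exists D : int,
  [/\ discr u = D%:~R, D != 0 & (`|D| <= (2 * B) ^ (k * k))%N].
Proof.
have [D DD] := fixed_int discr_Aint (fun g _ => discr_gal g); exists D; split=> //.
  by apply: contra (discr_neq0 u) => /eqP D0; rewrite DD D0.
by have := prod_prod_diff_bound predT; rewrite -/(discr u) DD rmorph_int -intr_norm -natr_absz ler_nat.
Qed.

End StableList.

(** * The bound for a given Galois system *)

Section Discriminant.

Variables (L : splittingFieldType rat) (phi : {rmorphism L -> algC}).
Variables (r : nat) (s : 'I_r -> L) (B : nat).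
Hypothesis s_gal : forall (g : gal_of {:L}) i, exists j, g (s i) = s j.
Hypothesis s_Aint : forall i, phi (s i) \in Aint.
Hypothesis s_bound : forall i, `|phi (s i)| <= B%:R.
Hypothesis B_gt0 : (0 < B)%N.

Let u := undup (codom s).

Let uP x : reflect (exists i, x = s i) (x \in u).
Proof. by rewrite mem_undup; apply: codomP. Qed.

Let u_gal (g : gal_of {:L}) x : x \in u -> g x \in u.
Proof. by move=> /uP[i ->]; apply/uP; apply: s_gal. Qed.

Let u_Aint x : x \in u -> phi x \in Aint. Proof. by move=> /uP[i ->]. Qed.

Let u_bound x : x \in u -> `|phi x| <= B%:R. Proof. by move=> /uP[i ->]. Qed.

(** A multiple of the discriminant of every system of [r] integers bounded by [B].
    The summand 2 makes it greater than 1. *)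
Definition conductor_of (r B : nat) := ((2 * B) ^ (r * r)).+2`!.

Lemma conductor_discr : (conductor_of r B)%:R / phi (discr u) \in Aint.
Proof.
have szu : (size u <= r)%N.
  by apply: leq_trans (size_undup _) _; rewrite size_codom card_ord.
have [z [Dz z0 le_z]] := discr_int (undup_uniq _) szu B_gt0 u_gal u_Aint u_bound.
have /dvdnP[q ->] : (`|z| %| conductor_of r B)%N.
  by rewrite dvdn_fact // absz_gt0 z0 (leq_trans le_z) // ltnW.
rewrite Dz rmorph_int natrM natr_absz.
have z0' : z%:~R != 0 :> algC by rewrite intr_eq0.
have [z_ge0|z_lt0] := leP 0 z.
  by rewrite ger0_norm // mulfK ?rpred_nat.
by rewrite ltr0_norm // rmorphN mulrN mulNr mulfK // rpredN rpred_nat.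
Qed.

(** The differences of distinct eigenvalues are among those of which the
    discriminant is the product. *)
Lemma discr_diff n (t : 'I_n -> algC) i : injective t -> (forall i, exists j, t i = phi (s j)) ->
  phi (discr u) / diff t i \in Aint.
Proof.
move=> t_inj /choice[c Dc].
have c_inj : injective (fun i => s (c i)).
  by move=> i1 i2 E; apply: t_inj; rewrite !Dc E.
have su k : s (c k) \in u by apply/uP; exists (c k).
pose T := [seq s (c j) | j <- enum 'I_n & j != i].
have uT : uniq T by rewrite map_inj_uniq // filter_uniq // enum_uniq.
have TP y : y \in T -> (y \in u) && (y != s (c i)).
  by move=> /mapP[j]; rewrite mem_filter => /andP[ne_ji _] ->; rewrite su (inj_eq c_inj).
have -> : diff t i = phi (\prod_(y <- T) (s (c i) - y)).
  rewrite /T big_map big_filter big_enum_cond rmorph_prod; apply: eq_bigr => j _.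
  by rewrite rmorphB -!Dc.
have T0 : phi (\prod_(y <- T) (s (c i) - y)) != 0.
  rewrite fmorph_eq0 prodf_seq_neq0; apply/allP=> y /TP/andP[_ ne_y] /=.
  by rewrite subr_eq0 eq_sym.
have -> : discr u = (\prod_(y <- T) (s (c i) - y)) *
   ((\prod_(y <- u | (y != s (c i)) && (y \notin T)) (s (c i) - y)) *
    \prod_(x <- u | x != s (c i)) prod_diff u x).
  rewrite mulrA /discr (bigD1_seq (s (c i))) ?undup_uniq //=; congr (_ * _).
  rewrite /prod_diff (bigID (mem T)) /=; congr (_ * _).
  rewrite -big_filter; apply/perm_big/uniq_perm; rewrite ?filter_uniq ?undup_uniq //.
  move=> y; rewrite mem_filter; apply/idP/idP; last first.
    by move=> yT; have /andP[yu ->] := TP y yT; rewrite yu andbT; apply: yT.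
  by case/andP=> /andP[].
rewrite rmorphM mulrAC mulfV // mul1r rmorphM rpredM //.
  rewrite rmorph_prod big_seq_cond rpred_prod // => y /andP[yu _].
  by rewrite rmorphB rpredB ?u_Aint.
rewrite rmorph_prod big_seq_cond rpred_prod // => x /andP[xu _].
exact: prod_diff_Aint.
Qed.

End Discriminant.

(** The degree of the extension obtained by adjoining the [r] members of the
    system, then at most [r] roots of order [h], then at most [r] units. *)
Definition extension_bound (r B : nat) : nat :=
  let h := root_degree r B in
  (h * (conductor_of r B ^ (r ^ r))`!) ^ r * (h ^ r * r ^ r).

(** The Galois stable system [s] of algebraic integers generates a field that
    contains the image of [K] and the eigenvalues [t].  The degree bound depends
    only on the size of the system and on a bound on its archimedean absolute
    values. *)
Theorem similar_in_bounded_extension (L : splittingFieldType rat) (phi : {rmorphism L -> algC})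
    (r : nat) (s : 'I_r -> L) (F : {poly int}) (B : nat)
    (K : fieldExtType rat) (iota : {rmorphism K -> algC}) (n : nat) (M N : 'M[K]_n)
    (t : 'I_n -> algC) :
  F \is monic -> size F = r.+1 -> (forall i, root (map_poly intr F) (s i)) ->
  (forall (g : gal_of {:L}) i, exists j, g (s i) = s j) ->
  (forall i, `|phi (s i)| <= B%:R) -> (0 < B)%N ->
  (forall T : divringClosed algC, (forall i, phi (s i) \in T) -> forall x, iota x \in T) ->
  injective t -> (forall i, exists j, t i = phi (s j)) ->
  map_poly iota (char_poly M) = \prod_i ('X - (t i)%:P) ->
  map_poly iota (char_poly N) = \prod_i ('X - (t i)%:P) ->
  mx_over (@integral K) M -> mx_over (@integral K) N ->
  (forall v : K -> RR, place v -> similar_at v M N) ->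
  exists2 L : fieldExtType K, similar_in_extension L M N & (\dim {:L} <= extension_bound r B)%N.
Proof.
move=> F_monic F_size F_root s_gal s_bound B_gt0 iotaT t_inj ts chM chN intM intN simMN.
have [Q [sQ Q_min Q_gcd Q_degree]] := generated_field F_monic F_size F_root s_gal s_bound B_gt0.
have iotaQ x : iota x \in Q by apply: iotaT.
set h := root_degree r B in Q_gcd *; have h_gt0 : (0 < h)%N := fact_gt0 _.
set m := conductor_of r B; have m_gt1 : (1 < m)%N.
  by rewrite /m /conductor_of factS; have := fact_gt0 ((2 * B) ^ (r * r)).+1; nia.
have m_gt0 := ltnW m_gt1.
have s_Aint i : phi (s i) \in Aint.
  apply: (@root_monic_Aint (map_poly intr F)); last 1 first.
  - by apply/polyOverP=> j; rewrite coef_map rpred_int.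
  - by have := F_root i; rewrite -(fmorph_root phi) -map_poly_comp (eq_map_poly (rmorph_int _)).
  exact: monic_map.
have t_Aint i : t i \in Aint by have [j ->] := ts i.
have t_Q i : t i \in Q by have [j ->] := ts i.
have m_diff i : m%:R / diff t i \in Aint.
  have d0 : phi (discr (undup (codom s))) != 0 by rewrite fmorph_eq0 discr_neq0.
  rewrite -[m%:R](divfK d0) -mulrA rpredM //; first exact: conductor_discr.
  exact: discr_diff.
have overA (A : 'M[K]_n) : mx_over (@integral K) A -> map_mx iota A \is a mxOver Aint.
  by move=> intA; apply/mxOverP=> i j; rewrite mxE; apply/integral_fmorph/intA.
have overQ (A : 'M[K]_n) : map_mx iota A \is a mxOver Q.
  by apply/mxOverP=> i j; rewrite mxE.
have local_conj (V : valring algC) : m%:R \in vmax V -> exists U : 'M[algC]_n,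
    [/\ U *m map_mx iota M = map_mx iota N *m U, U \is a mxOver Q, U \is a mxOver V &
    \det U \in vunit V].
  move=> mV; have [v [pv v_na vV]] := valring_place iota m_gt0 mV.
  have [U [EU vU vdU]] := similar_at_approx v_na (simMN v pv).
  have v_abs : absolute_value v by case: pv.
  have dU0 : \det U != 0.
    by apply/eqP=> dU0; move: vdU; rewrite dU0 (abs0 v_abs) => /eqP; rewrite eq_sym oner_eq0.
  exists (map_mx iota U); split; first by rewrite -!map_mxM EU.
  - exact: overQ.
  - by apply/mxOverP=> i j; rewrite mxE -vV vU.
  rewrite det_map_mx; apply/and3P; rewrite fmorph_eq0 -fmorphV -!vV (absV v_abs) // vdU.
  by rewrite invr1 lexx.
have [U0 [EU0 U0Q U0A dU0 U0P]] := prime_conjugator h_gt0 Q_gcd m_gt1 local_conj.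
have chM1 : char_poly (map_mx iota M) = \prod_i ('X - (t i)%:P) by rewrite -map_char_poly.
have chN1 : char_poly (map_mx iota N) = \prod_i ('X - (t i)%:P) by rewrite -map_char_poly.
have [g [y [U [gQ yP [uU UA UVA EU UT]]]]] := unit_conjugator h_gt0 Q_gcd Q_degree m_gt0 t_inj
  t_Aint t_Q m_diff (overA M intM) (overA N intN) (overQ M) chM1 chN1 U0A U0Q EU0 dU0 U0P.
(* The extension is built inside the algebraic numbers in three steps, from [K] as
   an extension of itself. *)
pose j0 : {rmorphism K^o -> algC} := iota.
have le_nr : (n <= r)%N.
  have /choice[c Dc] := ts; rewrite -(card_ord n) -[r](card_ord r).
  by apply: (@leq_card _ _ c) => i1 i2 E; apply: t_inj; rewrite !Dc E.
have [|L1 [j1 [sub1 sL1 j1K dim1]]] := @adjoin_family K K^o j0 r [seq phi (s i) | i : 'I_r].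
  move=> _ /mapP[i _ ->]; exists (map_poly intr F); split.
  - exact/monic_neq0/monic_map.
  - by rewrite (leq_trans (size_poly _ _)) ?F_size.
  - by have := F_root i; rewrite -(fmorph_root phi) -map_poly_comp (eq_map_poly (rmorph_int _)).
  by apply/polyOverP=> k; rewrite coef_map rpred_int.
have QL1 : {subset Q <= fimage j1}.
  by apply: Q_min => i; apply: sL1; apply/mapP; exists i; rewrite ?mem_enum.
have [|L2 [j2 [sub2 gL2 j2K dim2]]] := @adjoin_family K L1 j1 h [seq g i | i : 'I_n].
  move=> _ /mapP[i _ ->]; exists ('X^h - (g i ^+ h)%:P); split.
  - by rewrite -size_poly_gt0 size_XnsubC.
  - by rewrite size_XnsubC.
  - by rewrite /root !hornerE subrr.
  by rewrite rpredB ?rpredX ?polyOverX // polyOverC QL1.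
have gL i : g i \in fimage j2 by apply: gL2; apply/mapP; exists i; rewrite ?mem_enum.
have [|L3 [j3 [sub3 yL3 j3K dim3]]] :=
    @adjoin_family K L2 j2 (h * (m ^ (r ^ r))`!) [seq y i | i : 'I_n].
  by move=> _ /mapP[i _ ->]; have [p [p0 szp py pT]] := yP i; exists p; split=> //; apply: pT.
have {}UT : U \is a mxOver (fimage j3).
  apply: (UT (fimage j3)) => [x|i|i].
  - by move/QL1/sub2/sub3.
  - exact/sub3/gL.
  by apply: yL3; apply/mapP; exists i; rewrite ?mem_enum.
have /choice[f fP] : forall x, exists z : L3, x \in fimage j3 -> j3 z = x.
  by move=> x; have [/fimageP[z Dz]|_] := boolP (x \in fimage j3); [exists z | exists 0].
pose U3 := map_mx f U; have DU3 : map_mx j3 U3 = U.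
  by apply/matrixP=> i j; rewrite !mxE fP // (mxOverP UT).
have jK (A : 'M[K]_n) : map_mx j3 (map_mx (in_alg L3) A) = map_mx iota A.
  apply/matrixP=> i j; rewrite !mxE /= j3K j2K j1K /j0 /=.
  by rewrite -[_%:A](_ : A i j = _) // [RHS]mulr1.
exists L3.
  exists U3; split.
  - by rewrite -(map_unitmx j3) DU3.
  - by move=> i j; apply/(integral_fmorph j3); have := mxOverP UA i j; rewrite -DU3 mxE.
  - move=> i j; apply/(integral_fmorph j3); have := mxOverP UVA i j.
    by rewrite -DU3 -map_invmx mxE.
  by apply: (map_mx_inj (f := j3)); rewrite !map_mxM DU3 !jK.
have dimK : \dim {: K^o} = 1%N by rewrite dimvf.
apply: (leq_trans dim3); rewrite /extension_bound /=; apply: leq_mul.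
  by rewrite size_map size_enum_ord leq_pexp2l // muln_gt0 h_gt0 fact_gt0.
apply: (leq_trans dim2); apply: leq_mul.
  by rewrite size_map size_enum_ord leq_pexp2l.
by apply: (leq_trans dim1); rewrite dimK muln1 size_map size_enum_ord.
Qed.

(** * Embeddings of number fields *)

Lemma primitive_element (K : fieldExtType rat) : exists z : K, <<1; z>>%VS = fullv.
Proof.
exists (separable_generator 1%AS {:K}); rewrite -eq_adjoin_separable_generator ?sub1v //.
apply/separableP=> x _; apply: pcharf0_separable => p.
by rewrite -(pchar_num rat p) pchar_lalg.
Qed.

(** A number field embeds in the algebraic numbers. *)
Lemma number_field_embedding (K : fieldExtType rat) : exists iota : {rmorphism K -> algC}, True.
Proof.
have [z Kz] := primitive_element K.
have /polyOver1P[p Dp] := minPolyOver 1 z.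
have p1 : (1 < size p)%N.
  by rewrite -(size_map_poly (in_alg K)) -Dp size_minPoly ltnS adjoin_degreeE dimv1 divn1 adim_gt0.
have [x rx] : exists x, root (map_poly (ratr : rat -> algC) p) x.
  by apply/closed_rootP; rewrite size_map_poly; case: (size p) p1 => [|[]].
have gen (u : K) : exists g : {poly rat}, (map_poly (in_alg K) g).[z] = u.
  have := memvf u; rewrite -Kz => /Fadjoin_polyP[g /polyOver1P[g' ->] ->].
  by exists g'.
have ker (g : {poly rat}) : (map_poly (in_alg K) g).[z] = 0 -> (map_poly (ratr : rat -> algC) g).[x] = 0.
  move=> gz0; have : minPoly 1 z %| map_poly (in_alg K) g.
    by rewrite minPoly_dvdp ?rootE ?gz0 //; apply/polyOver1P; exists g.
  rewrite Dp dvdp_map => /dvdpP[h ->]; rewrite rmorphM hornerM (eqP rx) mulr0 //.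
have /choice[f fP] := gen.
pose i (u : K) : algC := (map_poly ratr (f u)).[x].
have iE (g : {poly rat}) : i (map_poly (in_alg K) g).[z] = (map_poly ratr g).[x].
  apply/eqP; rewrite -subr_eq0 /i -hornerN -hornerD -rmorphB; apply/eqP/ker.
  by rewrite rmorphB hornerD hornerN fP subrr.
have iB : zmod_morphism i.
  move=> u v; have [g <-] := gen u; have [h <-] := gen v.
  by rewrite -hornerN -hornerD -rmorphB !iE rmorphB hornerD hornerN.
have iM : monoid_morphism i.
  split=> [|u v]; last first.
    have [g <-] := gen u; have [h <-] := gen v.
    by rewrite -hornerM -rmorphM !iE rmorphM hornerM.
  have := iE 1; rewrite !rmorph1 !hornerE => ->; by [].
pose iA := GRing.isZmodMorphism.Build _ _ i iB.
pose iMm := GRing.isMonoidMorphism.Build _ _ i iM.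
by exists (HB.pack i iA iMm : {rmorphism K -> algC}).
Qed.

(** Finitely many algebraic numbers lie in a Galois number field. *)
Lemma galois_closure (zs : seq algC) : exists (L : splittingFieldType rat)
  (phi : {rmorphism L -> algC}), forall z, z \in zs -> exists x, phi x = z.
Proof.
have [P [P1 zsP]] : exists P : {poly rat}, P \is monic /\ forall z, z \in zs -> root (map_poly ratr P) z.
  elim: zs => [|z zs [P [P1 zsP]]]; first by exists 1; rewrite monic1.
  have [q [Dq mon_q] _] := minCpolyP z.
  exists (q * P); split=> [|z']; first exact: rpredM.
  rewrite rmorphM /= rootM inE => /predU1P[->|/zsP->]; last by rewrite orbT.
  by rewrite -Dq root_minCpoly.
have [rs Drs] := closed_field_poly_normal (map_poly (ratr : rat -> algC) P).
have {}Drs : map_poly (ratr : rat -> algC) P = \prod_(z <- rs) ('X - z%:P).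
  by rewrite {1}Drs (monicP _) ?scale1r ?monic_map.
have [Qs [QsC [s1 Ds1 gens1]]] := num_field_exists rs.
have split_ax : SplittingField.axiom Qs.
  exists (map_poly (in_alg Qs) P); first by apply/polyOver1P; exists P.
  exists s1 => //; suff -> : map_poly (in_alg Qs) P = \prod_(z <- s1) ('X - z%:P) by apply: eqpxx.
  apply: (map_poly_inj QsC); rewrite -map_poly_comp rmorph_prod.
  rewrite (eq_map_poly (g := ratr)) => [|c]; last by rewrite /= alg_num_field fmorph_rat.
  rewrite Drs -Ds1 big_map; apply: eq_bigr => z _.
  by rewrite /= map_polyXsubC.
pose Lm := FieldExt_isSplittingField.Build rat Qs split_ax.
pose L : splittingFieldType rat := HB.pack Qs Lm.
exists L, (QsC : {rmorphism L -> algC}) => z /zsP.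
by rewrite Drs root_prod_XsubC -Ds1 => /mapP[x _ ->]; exists x.
Qed.

(** * Bounds on roots *)

(** Cauchy's bound. *)
Lemma monic_root_bound (p : {poly algC}) x : p \is monic -> root p x ->
  `|x| <= 1 + \sum_(i < (size p).-1) `|p`_i|.
Proof.
move=> mon_p px; have S0 : 0 <= \sum_(i < (size p).-1) `|p`_i| by apply: sumr_ge0.
have [x1|x1] := real_leP (normr_real x) (real1 _); first by apply: le_trans x1 _; rewrite lerDl.
case Dn: (size p).-1 S0 => [|n] S0.
  have := size_poly_gt0 p; rewrite monic_neq0 // => sp.
  have sp1 : size p = 1%N by rewrite -(prednK sp) Dn.
  move: px mon_p; rewrite (size1_polyC (eq_leq sp1)) monicE lead_coefC rootE hornerC => /eqP ->.
  by rewrite eq_sym oner_eq0.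
have sp : size p = n.+2 by rewrite -Dn prednK // size_poly_gt0 monic_neq0.
have x0 : 0 < `|x| by apply: lt_trans x1; apply: ltr01.
have lead : p`_n.+1 = 1 by move: mon_p; rewrite monicE /lead_coef sp => /eqP.
apply: (@le_trans _ _ (\sum_(i < n.+1) `|p`_i|)); last by rewrite lerDr ler01.
rewrite -(ler_pM2r (exprn_gt0 n x0)) -exprS -normrX.
have -> : x ^+ n.+1 = - \sum_(i < n.+1) p`_i * x ^+ i.
  apply/eqP; rewrite -addr_eq0; move: px.
  by rewrite /root horner_coef sp big_ord_recr /= lead mul1r addrC.
rewrite normrN mulr_suml; apply: le_trans (ler_norm_sum _ _ _) _.
apply: ler_sum => i _; rewrite normrM ler_wpM2l // normrX.
by apply: ler_weXn2l; [apply: ltW | rewrite -ltnS].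
Qed.

(** The leading coefficient of an integer polynomial clears the denominators of
    its roots. *)
Lemma lead_root_Aint (p : {poly algC}) x : p \is a polyOver Num.int -> p != 0 -> root p x ->
  lead_coef p * x \in Aint.
Proof.
move=> /polyOverP intp p0 px; apply: AintP => V.
have pV i : p`_i \in V by have /intrP[z ->] := intp i; apply: rpred_int.
case/orP: (vringP V x) => [xV|xiV]; first by rewrite rpredM ?pV.
have [->|x0] := eqVneq x 0; first by rewrite mulr0 rpred0.
have [n Dn] : exists n, size p = n.+2.
  case Dn: (size p) => [|[|n]]; last by exists n.
    by move: p0; rewrite -size_poly_eq0 Dn.
  move: px p0; rewrite (size1_polyC (eq_leq Dn)) rootE hornerC polyC_eq0.
  by move=> ->.
have xn0 : x ^+ n != 0 by rewrite expf_neq0.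
have -> : lead_coef p * x = - \sum_(i < n.+1) p`_i * x^-1 ^+ (n - i).
  apply: (mulIf xn0); rewrite -mulrA -exprS mulNr mulr_suml; apply/eqP; rewrite -addr_eq0.
  apply/eqP; move: px; rewrite /root horner_coef Dn big_ord_recr /= /lead_coef Dn /= addrC => /eqP E.
  rewrite -[RHS]E; congr (_ + _); apply: eq_bigr => i _; rewrite -mulrA; congr (_ * _).
  have Di : (n = (n - i) + i)%N by rewrite subnK // -ltnS.
  by rewrite [in x ^+ n]Di exprD mulrA exprVn mulVf ?mul1r // expf_neq0.
by rewrite rpredN rpred_sum // => i _; rewrite rpredM ?rpredX.
Qed.

(** * The Galois system of a presentation *)

(** The numerator and the denominator of [c] are at most [N]. *)
Definition rat_bounded (N : nat) (c : rat) : bool := (`|numq c| <= N)%N && (`|denq c| <= N)%N.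

Definition poly_bounded (N : nat) (p : {poly rat}) : Prop :=
  (size p <= N)%N /\ forall i, rat_bounded N p`_i.

Section RationalBounds.

Variable N : nat.

Lemma rat_bounded_norm c : rat_bounded N c -> `|ratr c : algC| <= N%:R.
Proof.
case/andP=> le_num _; rewrite /ratr normf_div -!intr_norm -!natr_absz.
rewrite ler_pdivrMr ?ltr0n ?absz_gt0 ?denq_neq0 // -natrM ler_nat.
by apply: leq_trans le_num _; rewrite leq_pmulr // absz_gt0 denq_neq0.
Qed.

Lemma rat_bounded_inv c : c != 0 -> rat_bounded N c -> `|(ratr c)^-1 : algC| <= N%:R.
Proof.
move=> c0 /andP[_ le_den]; rewrite /ratr invf_div normf_div -!intr_norm -!natr_absz.
have n0 : (0 < `|numq c|)%N by rewrite absz_gt0 numq_eq0.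
rewrite ler_pdivrMr ?ltr0n // -natrM ler_nat.
by apply: leq_trans le_den _; rewrite leq_pmulr.
Qed.

Lemma rat_bounded_fact c : rat_bounded N c -> exists z : int,
  (N`!)%:R * ratr c = z%:~R :> algC /\ (`|z| <= N`! * N)%N.
Proof.
case/andP=> le_num le_den; have d0 : (0 < `|denq c|)%N by rewrite absz_gt0 denq_neq0.
have /dvdnP[k Dk] : (`|denq c| %| N`!)%N by rewrite dvdn_fact // d0.
exists (k%:Z * numq c); split; last first.
  rewrite abszM Dk leq_mul //; by rewrite leq_pmulr.
rewrite Dk /ratr natrM rmorphM /= -[(`|denq c|%N)%:R]/(`|denq c|%:Z%:~R) gez0_abs ?denq_ge0 //.
have : (denq c)%:~R != 0 :> algC by rewrite intr_eq0 denq_neq0.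
by move=> dc; field.
Qed.

(** A bound on the absolute values of the roots of [p]. *)
Definition root_bound := (1 + N * (N * N))%N.

(** A common denominator of the roots of [p]. *)
Definition root_denominator := ((N`! * N)`!)%N.

Variables (p : {poly rat}) (x : algC).
Hypotheses (p0 : p != 0) (p_bounded : poly_bounded N p) (px : root (map_poly ratr p) x).

Lemma poly_bounded_root : `|x| <= root_bound%:R.
Proof.
have [szp cp] := p_bounded; pose P := map_poly (ratr : rat -> algC) p.
have Px : root P x := px.
have P0 : P != 0 by rewrite map_poly_eq0.
have l0 : lead_coef P != 0 by rewrite lead_coef_eq0.
have mon : (lead_coef P)^-1 *: P \is monic by rewrite monicE lead_coefZ mulVf.
have rx : root ((lead_coef P)^-1 *: P) x by rewrite rootZ // invr_eq0.
apply: le_trans (monic_root_bound mon rx) _; rewrite size_scale ?invr_eq0 // size_map_poly.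
rewrite /root_bound natrD lerD2l.
apply: (@le_trans _ _ (\sum_(i < (size p).-1) (N * N)%:R)).
  apply: ler_sum => i _; rewrite coefZ normrM natrM ler_pM //.
    by rewrite lead_coef_map rat_bounded_inv ?lead_coef_eq0 // lead_coefE.
  by rewrite coef_map rat_bounded_norm.
rewrite sumr_const card_ord -mulrnA ler_nat mulnC leq_mul2r; apply/orP; right.
by apply: leq_trans szp; apply: leq_pred.
Qed.

Lemma poly_bounded_Aint : root_denominator%:R * x \in Aint.
Proof.
have [szp cp] := p_bounded.
pose P := (N`!)%:R *: map_poly (ratr : rat -> algC) p.
have f0 : (N`!)%:R != 0 :> algC by rewrite pnatr_eq0 -lt0n fact_gt0.
have P0 : P != 0 by rewrite scaler_eq0 (negPf f0) map_poly_eq0.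
have intP : P \is a polyOver Num.int.
  apply/polyOverP=> i; rewrite coefZ coef_map /=.
  by have [z [-> _]] := rat_bounded_fact (cp i); apply: rpred_int.
have rx : root P x by rewrite rootZ.
have := lead_root_Aint intP P0 rx; rewrite lead_coefZ lead_coef_map /=.
have [z [Ez le_z]] := rat_bounded_fact (cp (size p).-1); rewrite lead_coefE Ez => Az.
have z0 : z != 0.
  rewrite -(intr_eq0 algC) -Ez mulf_neq0 // fmorph_eq0 -lead_coefE lead_coef_eq0 //.
have /dvdnP[k Dk] : (`|z| %| root_denominator)%N by rewrite dvdn_fact // absz_gt0 z0.
rewrite Dk natrM natr_absz -mulrA rpredM ?rpred_nat //.
have [z_ge0|z_lt0] := leP 0 z; first by rewrite ger0_norm.
by rewrite ltr0_norm // rmorphN mulNr rpredN.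
Qed.

End RationalBounds.

(** A presentation of a number field and of a polynomial over it by polynomials
    whose size and coefficients are bounded by [N].  The polynomial [p] need not
    be irreducible. *)
Definition bounded_presentation (K : fieldExtType rat) (chi : {poly K}) (N : nat) (y : K)
    (p : {poly rat}) (q : seq {poly rat}) : Prop :=
  [/\ (<<1; y>> = fullv)%VS, p != 0, horner_alg y p = 0 &
      forall i, chi`_i = horner_alg y (nth 0 q i)] /\
  [/\ poly_bounded N p, (size q <= N)%N & forall i, poly_bounded N (nth 0 q i)].

(** The numbers of conjugates of [y] and of roots of the conjugates of [chi] are
    together at most [N * N]. *)
Definition system_size (N : nat) := (N * N)%N.

(** The first summand bounds the multiples of the conjugates of [y], the second one
    the roots of the conjugates of [chi]. *)
Definition system_bound (N : nat) :=
  (root_denominator N * root_bound N + (1 + N * (N * (N * root_bound N ^ N))))%N.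

Lemma horner_algE (A : fieldExtType rat) (x : A) (p : {poly rat}) :
  horner_alg x p = (map_poly (in_alg A) p).[x].
Proof. by []. Qed.

Lemma rmorph_horner_alg (A : fieldExtType rat) (f : {rmorphism A -> algC}) (x : A) (p : {poly rat}) :
  f (horner_alg x p) = (map_poly ratr p).[f x].
Proof.
rewrite horner_algE -horner_map -map_poly_comp; congr (_.[_]).
by apply: eq_map_poly => c; rewrite /= alg_num_field fmorph_rat.
Qed.

Lemma gal_horner_alg (L : splittingFieldType rat) (g : gal_of {:L}) (x : L) (p : {poly rat}) :
  g (horner_alg x p) = horner_alg (g x) p.
Proof.
rewrite !horner_algE -horner_map -map_poly_comp; congr (_.[_]).
by apply: eq_map_poly => c; rewrite /= !alg_num_field fmorph_rat.
Qed.

(** The conjugates of [x] over the rationals. *)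
Definition conjugates (L : splittingFieldType rat) (x : L) : seq L :=
  undup [seq (g : gal_of {:L}) x | g <- enum {: gal_of {:L}}].

Lemma conjugatesP (L : splittingFieldType rat) (x z : L) :
  reflect (exists g : gal_of {:L}, g x = z) (z \in conjugates x).
Proof.
rewrite mem_undup; apply: (iffP mapP) => [[g _ ->]|[g <-]]; first by exists g.
by exists g; rewrite ?mem_enum.
Qed.

Lemma conjugates_refl (L : splittingFieldType rat) (x : L) : x \in conjugates x.
Proof. by apply/conjugatesP; exists 1%g; rewrite gal_id. Qed.

Lemma conjugates_gal (L : splittingFieldType rat) (g : gal_of {:L}) (x z : L) :
  z \in conjugates x -> g z \in conjugates x.
Proof. by case/conjugatesP=> h <-; apply/conjugatesP; exists (h * g)%g; rewrite galM ?memvf. Qed.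

Lemma size_conjugates (L : splittingFieldType rat) (x : L) (p : {poly rat}) :
  p != 0 -> horner_alg x p = 0 -> (size (conjugates x) <= size p)%N.
Proof.
move=> p0 px; rewrite -(size_map_poly (in_alg L)) ltnW // max_poly_roots ?undup_uniq //.
  by rewrite map_poly_eq0.
apply/allP=> _ /conjugatesP[g <-].
by rewrite rootE -horner_algE -gal_horner_alg px rmorph0.
Qed.

(** The conjugates of [y], multiplied by a common denominator, and the roots of the
    conjugates of [chi] form a Galois stable system of algebraic integers. *)
Theorem presentation_system (K : fieldExtType rat) (n : nat) (chi : {poly K}) (N : nat) (y : K)
    (p : {poly rat}) (q : seq {poly rat}) :
  admissible n chi -> bounded_presentation chi N y p q ->
  exists (L : splittingFieldType rat) (phi : {rmorphism L -> algC})
    (s : 'I_(system_size N) -> L) (F : {poly int}) (iota : {rmorphism K -> algC}) (t : 'I_n -> algC),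
  [/\ [/\ F \is monic, size F = (system_size N).+1 & forall i, root (map_poly intr F) (s i)],
      [/\ forall (g : gal_of {:L}) i, exists j, g (s i) = s j,
        forall i, `|phi (s i)| <= (system_bound N)%:R & (0 < system_bound N)%N],
      forall T : divringClosed algC, (forall i, phi (s i) \in T) -> forall x, iota x \in T &
      [/\ injective t, forall i, exists j, t i = phi (s j) &
        map_poly iota chi = \prod_i ('X - (t i)%:P)]].
Proof.
case=> n_gt0 int_chi mon_chi sep_chi sz_chi [[gen_y p0 py chiq] [bp szq bq]].
have [iota _] := number_field_embedding K.
set r := system_size N; set B := system_bound N.
have [rs Drs] := closed_field_poly_normal (map_poly iota chi).
have {}Drs : map_poly iota chi = \prod_(z <- rs) ('X - z%:P).
  by rewrite {1}Drs (monicP _) ?scale1r ?monic_map.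
have szrs : size rs = n.
  by have := size_prod_XsubC rs id; rewrite -Drs size_map_poly sz_chi => -[->].
have uniq_rs : uniq rs by rewrite -separable_prod_XsubC -Drs separable_map.
have [L [phi phiP]] := galois_closure (iota y :: rs).
have /choice[pre preP] : forall z, exists x, z \in iota y :: rs -> phi x = z.
  move=> z; have [zin|_] := boolP (z \in iota y :: rs); last by exists 0.
  by have [x Dx] := phiP z zin; exists x.
pose y0 := pre (iota y); have Dy0 : phi y0 = iota y by rewrite preP ?inE ?eqxx.
pose t (i : 'I_n) := rs`_i.
have t_rs i : t i \in rs by rewrite mem_nth // szrs.
pose t' (i : 'I_n) := pre (t i).
have Dt' i : phi (t' i) = t i by rewrite preP // inE t_rs orbT.
have t_inj : injective t.
  by move=> i j /eqP; rewrite nth_uniq ?szrs // => /eqP/val_inj.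
have chi_t : map_poly iota chi = \prod_i ('X - (t i)%:P).
  by rewrite Drs (big_nth 0) szrs big_mkord.
pose E (x : L) := \poly_(k < n.+1) horner_alg x (nth 0 q k).
have DE0 : E y0 = \prod_i ('X - (t' i)%:P).
  apply: (map_poly_inj phi); rewrite rmorph_prod.
  under eq_bigr => i _ do rewrite /= map_polyXsubC Dt'.
  rewrite -chi_t; apply/polyP=> k; rewrite !coef_map /= coef_poly.
  case: ltnP => lt_k; last by rewrite rmorph0 nth_default ?sz_chi // rmorph0.
  by rewrite chiq !rmorph_horner_alg Dy0.
have gE (g : gal_of {:L}) x : map_poly g (E x) = E (g x).
  apply/polyP=> k; rewrite coef_map !coef_poly /=; case: ifP => _; last exact: rmorph0.
  exact: gal_horner_alg.
pose Y := conjugates y0.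
have py0 : horner_alg y0 p = 0.
  by apply/eqP; rewrite -(fmorph_eq0 phi) rmorph_horner_alg Dy0 -rmorph_horner_alg py rmorph0.
have Yroot x : x \in Y -> root (map_poly ratr p) (phi x).
  case/conjugatesP=> g <-.
  by rewrite rootE -rmorph_horner_alg -gal_horner_alg py0 !rmorph0.
have szY : (size Y <= N)%N by apply: leq_trans bp.1; apply: size_conjugates.
have /choice[c cP] : forall x, exists g : gal_of {:L}, x \in Y -> g y0 = x.
  by move=> x; have [/conjugatesP[g Dg]|_] := boolP (x \in Y); [exists g | exists 1%g].
(* As [chi] is monic, [q] describes its leading coefficient. *)
have lt_nN : (n < N)%N.
  apply: leq_trans szq; rewrite ltnNge; apply/negP=> le_qn.
  have := chiq n; rewrite (@nth_default _ 0 q) // rmorph0 => chin.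
  by have := mon_chi; rewrite monicE lead_coefE sz_chi /= chin eq_sym oner_eq0.
pose Z := root_denominator N.
pose lst := [seq Z%:R * x | x <- Y] ++ [seq (c x) (t' i) | x <- Y, i <- enum 'I_n].
have szlst : (size lst <= r)%N.
  rewrite size_cat size_map size_allpairs size_enum_ord /r /system_size.
  by rewrite -mulnS leq_mul.
have in_lst1 x : x \in Y -> Z%:R * x \in lst by move=> xY; rewrite mem_cat map_f.
have in_lst2 x i : x \in Y -> (c x) (t' i) \in lst.
  move=> xY; rewrite mem_cat; apply/orP; right; apply/allpairsP; exists (x, i).
  by rewrite mem_enum.
have lstP x : x \in lst -> (exists2 u, u \in Y & x = Z%:R * u) \/
    (exists2 u, u \in Y & exists i, x = (c u) (t' i)).
  rewrite mem_cat => /orP[/mapP[u uY ->]|/allpairsP[[u i] [uY _ ->]]]; first by left; exists u.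
  by right; exists u => //; exists i.
have DE x : x \in Y -> E x = \prod_i ('X - ((c x) (t' i))%:P).
  move=> xY; rewrite -{1}(cP x xY) -gE DE0 rmorph_prod; apply: eq_bigr => i _.
  by rewrite /= map_polyXsubC.
have galY (g : gal_of {:L}) x : x \in Y -> g x \in Y by apply: conjugates_gal.
have gal_lst (g : gal_of {:L}) x : x \in lst -> g x \in lst.
  case/lstP=> -[u uY]; first by move=> ->; rewrite rmorphM rmorph_nat in_lst1 ?galY.
  case=> i ->; have : root (E (g u)) (g ((c u) (t' i))).
    rewrite -gE fmorph_root DE // rootE horner_prod (bigD1 i) //=.
    by rewrite hornerXsubC subrr mul0r.
  rewrite DE ?galY // rootE horner_prod => /prodf_eq0[j _].
  by rewrite hornerXsubC subr_eq0 => /eqP ->; rewrite in_lst2 ?galY.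
have Yb x : x \in Y -> `|phi x| <= (root_bound N)%:R.
  by move=> xY; apply: (poly_bounded_root p0 bp (Yroot x xY)).
have YA x : x \in Y -> Z%:R * phi x \in Aint.
  by move=> xY; apply: (poly_bounded_Aint p0 bp (Yroot x xY)).
have lstA x : x \in lst -> phi x \in Aint.
  case/lstP=> -[u uY]; first by move=> ->; rewrite rmorphM rmorph_nat YA.
  case=> i ->; apply: gal_Aint; rewrite Dt'.
  apply: (@monic_Aint_root (map_poly iota chi)); first exact: monic_map.
    by apply/polyOverP=> k; rewrite coef_map; apply/integral_fmorph/int_chi.
  by rewrite Drs root_prod_XsubC.
have lstB x : x \in lst -> `|phi x| <= B%:R.
  case/lstP=> -[u uY].
    move=> ->; rewrite rmorphM rmorph_nat normrM normr_nat /B /system_bound natrD.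
    by rewrite ler_wpDr ?ler0n // natrM ler_wpM2l ?ler0n ?Yb.
  case=> i ->; rewrite /B /system_bound natrD ler_wpDl ?ler0n //.
  have monE : map_poly phi (E u) \is monic by rewrite monic_map // DE // monic_prod_XsubC.
  have rE : root (map_poly phi (E u)) (phi ((c u) (t' i))).
    rewrite fmorph_root DE // rootE horner_prod (bigD1 i) //=.
    by rewrite hornerXsubC subrr mul0r.
  apply: le_trans (monic_root_bound monE rE) _; rewrite natrD lerD2l.
  have szE : (size (map_poly phi (E u))).-1 = n.
    by rewrite size_map_poly DE // size_prod_XsubC -[index_enum _]enumT size_enum_ord.
  rewrite szE; apply: (@le_trans _ _ (\sum_(k < n) (N * (N * root_bound N ^ N))%:R)); last first.
    rewrite sumr_const card_ord -mulrnA ler_nat mulnC leq_mul2r; apply/orP; right.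
    exact: ltnW.
  apply: ler_sum => k _; rewrite coef_map coef_poly ltnS ltnW //= rmorph_horner_alg.
  have [szk bk] := bq k; rewrite (horner_coef_wide _ (n := N)) ?size_map_poly //.
  apply: le_trans (ler_norm_sum _ _ _) _.
  apply: (@le_trans _ _ (\sum_(l < N) (N * root_bound N ^ N)%:R)); last first.
    by rewrite sumr_const card_ord -mulrnA ler_nat mulnC.
  apply: ler_sum => l _; rewrite coef_map normrM natrM ler_pM //; first exact: rat_bounded_norm.
  rewrite normrX natrX; apply: (@le_trans _ _ ((root_bound N)%:R ^+ l)).
    by rewrite lerXn2r ?nnegrE ?Yb.
  by rewrite ler_weXn2l ?ler1n // ltnW.
pose s (i : 'I_r) := lst`_i.
have sP i : s i \in lst \/ s i = 0.
  by rewrite /s; have [lt_i|le_i] := ltnP i (size lst); [left; apply: mem_nth | right; apply: nth_default].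
have s_ex x : x \in lst -> exists j, x = s j.
  move=> xl; have lt_x : (index x lst < r)%N by apply: leq_trans szlst; rewrite index_mem.
  by exists (Ordinal lt_x); rewrite /s nth_index.
(* The family is padded with zeros, hence the power of X. *)
pose u := undup lst.
pose Fl : {poly L} := (\prod_(x <- u) ('X - x%:P)) * 'X^(r - size u).
have szu : (size u <= r)%N by apply: leq_trans (size_undup _) szlst.
have monFl : Fl \is monic by rewrite rpredM ?monic_prod_XsubC ?rpredX ?monicX.
have szFl : size Fl = r.+1.
  by rewrite size_Mmonic ?monic_neq0 ?monic_prod_XsubC ?monicXn // size_prod_XsubC size_polyXn addSn addnS /= subnKC.
have gFl (g : gal_of {:L}) : map_poly g Fl = Fl.
  rewrite rmorphM rmorph_prod /= map_polyXn; congr (_ * _).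
  have u_gal x : x \in u -> g x \in u by rewrite !mem_undup; apply: gal_lst.
  rewrite -[RHS](perm_big _ (gal_perm_eq (undup_uniq _) u_gal)) /= big_map.
  by apply: eq_bigr => x _; rewrite /= map_polyXsubC.
have AFl k : phi Fl`_k \in Aint.
  have : map_poly phi Fl \is a polyOver Aint.
    rewrite rmorphM rmorph_prod /= map_polyXn rpredM ?rpredX ?polyOverX //.
    rewrite big_seq rpred_prod // => x; rewrite mem_undup => xl.
    by rewrite map_polyXsubC polyOverXsubC lstA.
  by move/polyOverP/(_ k); rewrite coef_map.
have /choice[f fP] : forall k, exists z : int, Fl`_k = z%:~R.
  move=> k; apply: (fixed_int (AFl k)) => g _.
  by rewrite -[in RHS](gFl g) coef_map.
have inj_intr : injective (intr : int -> L).
  by move=> k l /(congr1 phi); rewrite !rmorph_int => /intr_inj.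
pose F := \poly_(k < r.+1) f k.
have DF : map_poly intr F = Fl.
  apply/polyP=> k; rewrite coef_map coef_poly; case: ltnP => lt_k; first by rewrite fP.
  by rewrite nth_default ?szFl.
exists L, phi, s, F, iota, t; split.
- split.
  + by rewrite monicE -(inj_eq inj_intr) -lead_coef_map_inj // DF (monicP monFl).
  + by rewrite -(size_map_inj_poly inj_intr) // DF.
  move=> i; rewrite DF rootM; apply/orP.
  rewrite /s; have [lt_i|le_i] := ltnP i (size lst); [left | right].
    by rewrite root_prod_XsubC mem_undup mem_nth.
  rewrite nth_default // /root hornerXn expr0n subn_eq0 leqNgt.
  by rewrite (leq_ltn_trans (size_undup _)) // (leq_ltn_trans le_i).
- split.
  + move=> g i; case: (sP i) => [si|si].
      by have [j Dj] := s_ex _ (gal_lst g _ si); exists j.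
    by exists i; rewrite si rmorph0.
  + by move=> i; case: (sP i) => [/lstB//|->]; rewrite rmorph0 normr0 ler0n.
  by rewrite /B /system_bound add1n addnS ltnS leq0n.
- move=> T sT x.
  have Y0 : y0 \in Y by apply: conjugates_refl.
  have yT : iota y \in T.
    have [j Dj] := s_ex _ (in_lst1 _ Y0).
    have Z0 : Z%:R != 0 :> algC by rewrite pnatr_eq0 -lt0n fact_gt0.
    have -> : iota y = phi (Z%:R * y0) / Z%:R by rewrite rmorphM rmorph_nat Dy0 mulrC mulKf.
    by rewrite rpred_div ?rpred_nat // Dj.
  have := memvf x; rewrite -gen_y => /Fadjoin_polyP[g /polyOver1P[g' ->] ->].
  rewrite -horner_algE rmorph_horner_alg horner_coef rpred_sum // => i _.
  by rewrite coef_map rpredM ?rpredX // rpred_rat.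
split=> // i.
have Y0 : y0 \in Y by apply: conjugates_refl.
have : root (E y0) (t' i).
  rewrite DE0 rootE horner_prod (bigD1 i) //=.
  by rewrite hornerXsubC subrr mul0r.
rewrite DE // rootE horner_prod => /prodf_eq0[j _].
rewrite hornerXsubC subr_eq0 => /eqP Dj; have [k Dk] := s_ex _ (in_lst2 _ j Y0).
by exists k; rewrite -Dk -Dj Dt'.
Qed.

(** * Bounded coordinates in a number field *)

Section Interpolation.

Variables (L : splittingFieldType rat) (phi : {rmorphism L -> algC}).
Variables (u : seq L) (z : L -> L) (k B : nat).
Hypotheses (u_uniq : uniq u) (u_size : (size u <= k)%N) (B_gt0 : (0 < B)%N).
Hypothesis u_gal : forall (g : gal_of {:L}) x, x \in u -> g x \in u.
Hypothesis z_gal : forall (g : gal_of {:L}) x, g (z x) = z (g x).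
Hypothesis u_Aint : forall x, x \in u -> phi x \in Aint.
Hypothesis z_Aint : forall x, x \in u -> phi (z x) \in Aint.
Hypothesis u_bound : forall x, x \in u -> `|phi x| <= B%:R.
Hypothesis z_bound : forall x, x \in u -> `|phi (z x)| <= B%:R.

Let gal_perm (g : gal_of {:L}) : perm_eq (map g u) u.
Proof. exact: gal_perm_eq (u_gal g). Qed.

Let cofactor x : L := \prod_(y <- u | y != x) prod_diff u y.

Let basis x : {poly L} := \prod_(y <- u | y != x) ('X - y%:P).

(* The Lagrange interpolation polynomial, multiplied by the discriminant. *)
Let interpolant : {poly L} := \sum_(x <- u) (z x * cofactor x) *: basis x.

Let cofactor_gal (g : gal_of {:L}) x : g (cofactor x) = cofactor (g x).
Proof.
rewrite /cofactor rmorph_prod -[in RHS](perm_big _ (gal_perm g)) /= big_map.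
by apply: eq_big => [y|y _]; rewrite ?(inj_eq (fmorph_inj _)) ?prod_diff_gal.
Qed.

Let basis_gal (g : gal_of {:L}) x : map_poly g (basis x) = basis (g x).
Proof.
rewrite /basis rmorph_prod -[in RHS](perm_big _ (gal_perm g)) /= big_map.
by apply: eq_big => [y|y _]; rewrite ?(inj_eq (fmorph_inj _)) //= map_polyXsubC.
Qed.

Let interpolant_gal (g : gal_of {:L}) : map_poly g interpolant = interpolant.
Proof.
rewrite /interpolant rmorph_sum -[in RHS](perm_big _ (gal_perm g)) /= big_map.
apply: eq_bigr => x _.
by rewrite /= map_polyZ /= rmorphM /= basis_gal cofactor_gal z_gal.
Qed.

Let discriminantE x : x \in u -> discr u = cofactor x * prod_diff u x.
Proof. by move=> xu; rewrite /discr (bigD1_seq x) //= mulrC. Qed.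

Let basis_other x y : x \in u -> y \in u -> y != x -> (basis y).[x] = 0.
Proof.
move=> xu yu yx; rewrite horner_prod -big_filter (big_rem x) /=.
  by rewrite hornerXsubC subrr mul0r.
by rewrite mem_filter xu eq_sym yx.
Qed.

Let basis_same x : (basis x).[x] = prod_diff u x.
Proof. by rewrite horner_prod; apply: eq_bigr => y _; rewrite hornerXsubC. Qed.

Let interpolantE x : x \in u -> interpolant.[x] = discr u * z x.
Proof.
move=> xu; rewrite horner_sum (bigD1_seq x) //= big1_seq ?addr0.
  by rewrite hornerZ basis_same (discriminantE xu); ring.
by move=> y /andP[yx yu]; rewrite hornerZ basis_other ?mulr0.
Qed.

Let cofactor_Aint x : phi (cofactor x) \in Aint.
Proof. by rewrite rmorph_prod big_seq_cond rpred_prod // => y /andP[yu _]; apply: prod_diff_Aint. Qed.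

Let basis_Aint x i : phi (basis x)`_i \in Aint.
Proof.
have /polyOverP/(_ i) : map_poly phi (basis x) \is a polyOver Aint.
  rewrite rmorph_prod big_seq_cond; apply: rpred_prod => y /andP[yu _].
  by rewrite /= map_polyXsubC polyOverXsubC u_Aint.
by rewrite coef_map.
Qed.

Let interpolant_Aint i : phi interpolant`_i \in Aint.
Proof.
rewrite coef_sum rmorph_sum big_seq rpred_sum // => x xu.
by rewrite coefZ !rmorphM !rpredM ?z_Aint.
Qed.

Let cofactor_bound x : `|phi (cofactor x)| <= ((2 * B) ^ (k * k))%:R.
Proof. exact: prod_prod_diff_bound. Qed.

Let basis_bound x i : `|phi (basis x)`_i| <= ((1 + B) ^ k)%:R.
Proof.
suff bnd (v : seq L) j : {subset v <= u} ->
    `|phi (\prod_(y <- v | y != x) ('X - y%:P))`_j| <= ((1 + B) ^ size v)%:R.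
  by apply: le_trans (bnd u i _) _; rewrite // ler_nat leq_pexp2l.
elim: v j => [|y v IHv] j sub.
  by rewrite big_nil coef1; case: eqP; rewrite ?rmorph1 ?rmorph0 ?normr1 ?normr0 ?ler01.
have {}IHv l : `|phi (\prod_(y <- v | y != x) ('X - y%:P))`_l| <= ((1 + B) ^ size v)%:R.
  by apply: IHv => w wv; rewrite sub // inE wv orbT.
have le_v : ((1 + B) ^ size v)%:R <= ((1 + B) ^ (size v).+1)%:R :> algC.
  by rewrite ler_nat leq_pexp2l.
rewrite big_cons; case: ifP => _; last exact: le_trans (IHv j) le_v.
rewrite mulrBl coefB coefXM coefCM rmorphB rmorphM.
apply: le_trans (ler_normB _ _) _; rewrite expnS mulnDl mul1n natrD natrM lerD //.
  by case: ifP => _; [rewrite rmorph0 normr0 ler0n | apply: IHv].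
by rewrite normrM ler_pM ?u_bound ?sub ?mem_head.
Qed.

(** A bound on the discriminant of the nodes and on the coefficients of the
    interpolation polynomial. *)
Definition interpolation_bound : nat := ((2 * B) ^ (k * k) * (1 + k * (B * (1 + B) ^ k)))%N.

Let interpolant_bound i : `|phi interpolant`_i| <= interpolation_bound%:R.
Proof.
apply: (@le_trans _ _ ((2 * B) ^ (k * k) * (k * (B * (1 + B) ^ k)))%:R); last first.
  by rewrite ler_nat leq_mul2l leq_addl orbT.
rewrite coef_sum rmorph_sum; apply: le_trans (ler_norm_sum _ _ _) _.
apply: (@le_trans _ _ (\sum_(x <- u) ((2 * B) ^ (k * k) * (B * (1 + B) ^ k))%:R)); last first.
  rewrite big_const_seq count_predT iter_addr_0 -mulrnA ler_nat.
  by rewrite mulnC mulnCA leq_mul2l leq_mul2r u_size !orbT.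
rewrite big_seq [X in _ <= X]big_seq; apply: ler_sum => x xu.
rewrite coefZ rmorphM normrM mulnA natrM ler_pM ?basis_bound //.
by rewrite rmorphM normrM mulnC natrM ler_pM ?z_bound ?cofactor_bound.
Qed.

(** Integral Lagrange interpolation on a Galois stable set of nodes. *)
Lemma integral_interpolation : exists (G : {poly int}) (D : int),
  [/\ D != 0, (`|D| <= interpolation_bound)%N, (size G <= k)%N,
      forall i, (`|(G`_i)%R| <= interpolation_bound)%N &
      forall x, x \in u -> (map_poly intr G).[x] = D%:~R * z x].
Proof.
have [D [DD D0 le_D]] := discr_int u_uniq u_size B_gt0 u_gal u_Aint u_bound.
have /choice[f fP] : forall i, exists c : int, interpolant`_i = c%:~R.
  move=> i; apply: (fixed_int (interpolant_Aint i)) => g _.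
  by rewrite -[in RHS](interpolant_gal g) coef_map.
have szI : (size interpolant <= k)%N.
  apply: leq_trans u_size; apply: leq_trans (size_sum _ _ _) _.
  apply/bigmax_leqP_seq => x xu _.
  apply: leq_trans (size_scale_leq _ _) _; rewrite /basis -big_filter size_prod_XsubC.
  by rewrite size_filter -(count_predC (pred1 x) u) count_uniq_mem // xu add1n.
have DI : map_poly intr (\poly_(i < k) f i) = interpolant.
  apply/polyP=> i; rewrite coef_map coef_poly /=; case: ltnP => lt_i; first by rewrite fP.
  by rewrite nth_default // (leq_trans szI).
exists (\poly_(i < k) f i), D; split.
- exact: D0.
- by apply: leq_trans le_D _; rewrite leq_pmulr // addn_gt0.
- exact: size_poly.
- move=> i; have := interpolant_bound i; rewrite -DI coef_map /= rmorph_int.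
  by rewrite -intr_norm -natr_absz ler_nat.
by move=> x xu; rewrite DI interpolantE // DD.
Qed.

End Interpolation.

Lemma rat_bounded_frac (N : nat) (a b : int) : b != 0 -> (`|a| <= N)%N -> (`|b| <= N)%N ->
  rat_bounded N (a%:~R / b%:~R).
Proof.
case: (divqP a b) => [|k q k0]; first by rewrite eqxx.
move=> _.
rewrite !abszM /rat_bounded => le_n le_d; rewrite (leq_trans _ le_n) ?(leq_trans _ le_d) //.
  by rewrite leq_pmull // absz_gt0.
by rewrite leq_pmull // absz_gt0.
Qed.

(** The powers of the denominator account for the passage from [a] and [y] to
    algebraic integers. *)
Definition coordinate_bound (N : nat) : nat :=
  let Z := root_denominator N in
  (N + interpolation_bound N (Z * root_bound N) * Z ^ N.+1)%N.

(** If [a] generates a number field and [y] belongs to it, then [y] is a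
    polynomial in [a] whose coefficients are bounded explicitly in terms of the
    coefficients of polynomials vanishing at [a] and at [y]. *)
Theorem bounded_coordinates (K : fieldExtType rat) (N : nat) (a y : K) (p q : {poly rat}) :
  <<1; a>>%VS = fullv -> p != 0 -> poly_bounded N p -> horner_alg a p = 0 ->
  q != 0 -> poly_bounded N q -> horner_alg y q = 0 ->
  exists2 g, poly_bounded (coordinate_bound N) g & y = horner_alg a g.
Proof.
move=> gen_a p0 bp pa q0 bq qy.
have [iota _] := number_field_embedding K.
have [L [phi phiP]] := galois_closure [:: iota a].
have [a0 Da0] := phiP _ (mem_head _ _).
have [h Dy] : exists h, y = horner_alg a h.
  have := memvf y; rewrite -gen_a => /Fadjoin_polyP[g /polyOver1P[g' ->] ->].
  by exists g'.
pose Y := conjugates a0.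
have root_phi (f : {poly rat}) x : horner_alg x f = 0 -> root (map_poly ratr f) (phi x).
  by move=> fx; rewrite rootE -rmorph_horner_alg fx rmorph0.
have root_conj (f : {poly rat}) (e : {poly rat}) x : x \in Y ->
    horner_alg (horner_alg a e) f = 0 -> root (map_poly ratr f) (phi (horner_alg x e)).
  case/conjugatesP=> g <- fa; apply: root_phi; rewrite -!gal_horner_alg; apply/eqP; rewrite fmorph_eq0.
  rewrite -(fmorph_eq0 phi) rmorph_horner_alg rmorph_horner_alg Da0.
  by rewrite -!rmorph_horner_alg fa rmorph0.
have Yp x : x \in Y -> root (map_poly ratr p) (phi x).
  move=> xY; have := root_conj p 'X x xY; rewrite /= !horner_algX; exact.
have Yq x : x \in Y -> root (map_poly ratr q) (phi (horner_alg x h)).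
  by move=> xY; apply: root_conj; rewrite // -Dy.
have pa0 : horner_alg a0 p = 0.
  by apply/eqP; rewrite -(fmorph_eq0 phi) rmorph_horner_alg Da0 -rmorph_horner_alg pa rmorph0.
have szY : (size Y <= N)%N by apply: leq_trans bp.1; apply: size_conjugates.
set Z := root_denominator N; set R := root_bound N.
have Z_gt0 : (0 < Z)%N by apply: fact_gt0.
have Z0 : Z%:R != 0 :> L by rewrite -(fmorph_eq0 phi) rmorph_nat pnatr_eq0 -lt0n.
(* The nodes are the conjugates of [Z * a], the values those of [Z * y]. *)
pose u := [seq Z%:R * x | x <- Y].
pose z (x : L) : L := Z%:R * horner_alg (x / Z%:R) h.
have zE x : z (Z%:R * x) = Z%:R * horner_alg x h by rewrite /z [_ * x]mulrC mulfK.
have u_uniq : uniq u by rewrite map_inj_uniq ?undup_uniq //; apply: mulfI.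
have u_size : (size u <= N)%N by rewrite size_map.
have B_gt0 : (0 < Z * R)%N by rewrite muln_gt0 Z_gt0.
have u_gal (g : gal_of {:L}) x : x \in u -> g x \in u.
  by move=> /mapP[v vY ->]; rewrite rmorphM rmorph_nat map_f // conjugates_gal.
have z_gal (g : gal_of {:L}) x : g (z x) = z (g x).
  by rewrite /z rmorphM rmorph_nat /= gal_horner_alg rmorphM fmorphV rmorph_nat.
have bnd x : `|phi x| <= R%:R -> `|phi (Z%:R * x)| <= (Z * R)%:R.
  by move=> le_x; rewrite rmorphM rmorph_nat normrM normr_nat natrM ler_wpM2l ?ler0n.
have int x : Z%:R * phi x \in Aint -> phi (Z%:R * x) \in Aint.
  by rewrite rmorphM rmorph_nat.
have u_Aint x : x \in u -> phi x \in Aint.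
  by move=> /mapP[v vY ->]; apply/int/(poly_bounded_Aint p0 bp)/Yp.
have z_Aint x : x \in u -> phi (z x) \in Aint.
  by move=> /mapP[v vY ->]; rewrite zE; apply/int/(poly_bounded_Aint q0 bq)/Yq.
have u_bound x : x \in u -> `|phi x| <= (Z * R)%:R.
  by move=> /mapP[v vY ->]; apply/bnd/(poly_bounded_root p0 bp)/Yp.
have z_bound x : x \in u -> `|phi (z x)| <= (Z * R)%:R.
  by move=> /mapP[v vY ->]; rewrite zE; apply/bnd/(poly_bounded_root q0 bq)/Yq.
have [G [D [D0 D_le szG G_le GE]]] :=
  integral_interpolation u_uniq u_size B_gt0 u_gal z_gal u_Aint z_Aint u_bound z_bound.
set M := interpolation_bound N (Z * R) in D_le G_le.
have M_gt0 : (0 < M)%N by rewrite muln_gt0 expn_gt0 muln_gt0 B_gt0 addn_gt0.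
have DZ0 : D * Z%:Z != 0 by rewrite mulf_neq0 // -lt0n.
exists (\poly_(i < N) ((G`_i * Z%:Z ^+ i)%:~R / (D * Z%:Z)%:~R)).
  split; first by apply: leq_trans (size_poly _ _) _; apply: leq_addr.
  move=> i; rewrite coef_poly; case: ltnP => [lt_i|_]; last first.
    rewrite /rat_bounded /= /coordinate_bound -/Z -/R -/M.
    by apply: leq_trans (leq_addl _ _); rewrite muln_gt0 M_gt0 expn_gt0 Z_gt0.
  apply: rat_bounded_frac => //; rewrite /coordinate_bound -/Z -/R -/M abszM.
    apply: leq_trans (leq_addl _ _); rewrite abszX leq_mul // leq_pexp2l //.
    by apply: leqW; apply: ltnW.
  by apply: leq_trans (leq_addl _ _); rewrite leq_mul // -{1}(expn1 Z) leq_pexp2l.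
apply: (fmorph_inj iota); rewrite Dy !rmorph_horner_alg -Da0 -!rmorph_horner_alg; congr (phi _).
have a0u : Z%:R * a0 \in u by rewrite map_f // conjugates_refl.
have := GE _ a0u; rewrite zE => E.
have DZL : (D * Z%:Z)%:~R != 0 :> L.
  by rewrite -(rmorph_int (in_alg L)) fmorph_eq0 intr_eq0.
apply: (mulfI DZL); rewrite {1}rmorphM /= -mulrA -E.
rewrite horner_algE !(horner_coef_wide _ (n := N)) ?size_map_poly ?size_poly //; last first.
  exact: leq_trans (size_poly _ _) szG.
rewrite mulr_sumr; apply: eq_bigr => i _; rewrite !coef_map coef_poly ltn_ord /=.
rewrite -[_%:A]/(in_alg L _) fmorph_div !rmorph_int mulrA [_%:~R * (_ / _)]mulrC divfK //.
by rewrite rmorphM rmorphXn /= exprMn mulrA.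
Qed.

(** * Closure properties of the recursive functions *)

(** The function of the list of its [k] arguments given by [F] is recursive. *)
Definition recursive_on (k : nat) (F : seq nat -> nat) : Prop :=
  recursive (fun t : k.-tuple nat => F t).

(** The function of two arguments given by [f] is recursive. *)
Definition recursive2 (f : nat -> nat -> nat) : Prop :=
  recursive_on 2 (fun s => f (nth 0%N s 0) (nth 0%N s 1)).

(** The function of three arguments given by [f] is recursive. *)
Definition recursive3 (f : nat -> nat -> nat -> nat) : Prop :=
  recursive_on 3 (fun s => f (nth 0%N s 0) (nth 0%N s 1) (nth 0%N s 2)).

Section RecursiveFunctions.

Local Open Scope nat_scope.

Lemma computableE f : computable f <-> recursive_on 1 (fun s => f (nth 0 s 0)).
Proof.
rewrite /computable /recursive_on; suff -> : (fun t : 1.-tuple nat => f (tnth t ord0)) =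
  (fun t : 1.-tuple nat => f (nth 0 t 0)) by [].
by apply: funext => t; rewrite (tnth_nth 0).
Qed.

Lemma eq_computable f g : f =1 g -> computable f -> computable g.
Proof. by move=> /funext ->. Qed.

Lemma eq_recursive2 f g : f =2 g -> recursive2 f -> recursive2 g.
Proof. by move=> E; have -> : f = g by apply: funext => x; apply: funext => y; apply: E. Qed.

Lemma recursive_nth k i : i < k -> recursive_on k (fun s => nth 0 s i).
Proof. by move=> lt_ik; apply: (@rec_proj k (Ordinal lt_ik)) => t; rewrite (tnth_nth 0). Qed.

Lemma recursive_comp1 k f g :
  computable f -> recursive_on k g -> recursive_on k (fun s => f (g s)).
Proof.
move=> rf rg; apply: (rec_comp rf (g := fun=> fun t : k.-tuple nat => g t)) => // t.
by rewrite tnth_mktuple.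
Qed.

Lemma recursive_comp2 k f g h : recursive2 f -> recursive_on k g -> recursive_on k h ->
  recursive_on k (fun s => f (g s) (h s)).
Proof.
move=> rf rg rh.
apply: (rec_comp rf (g := fun i (t : k.-tuple nat) => if val i == 0 then g t else h t)).
  by case=> -[|[|]].
by move=> t; rewrite (nth_mktuple _ _ (ord0 : 'I_2)) (nth_mktuple _ _ (ord_max : 'I_2)).
Qed.

Lemma recursive_const k c : recursive_on k (fun=> c).
Proof.
elim: c => [|c IHc]; first exact: rec_zero.
have rS : computable S by apply: rec_succ => t.
exact: (recursive_comp1 rS IHc).
Qed.

Lemma computable_succ : computable S. Proof. exact: rec_succ. Qed.

Lemma computable_id : computable id.
Proof. by apply/computableE; apply: recursive_nth. Qed.

Lemma computable_const c : computable (fun=> c).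
Proof. by apply/computableE; apply: recursive_const. Qed.

Lemma computable_comp f g : computable f -> computable g -> computable (fun x => f (g x)).
Proof. by move=> rf /computableE rg; apply/computableE; apply: (recursive_comp1 rf rg). Qed.

Lemma computable_comp2 f g h : recursive2 f -> computable g -> computable h ->
  computable (fun x => f (g x) (h x)).
Proof.
by move=> rf /computableE rg /computableE rh; apply/computableE; apply: (recursive_comp2 rf rg rh).
Qed.

Lemma recursive2_comp f g h : recursive2 f -> recursive2 g -> recursive2 h ->
  recursive2 (fun x y => f (g x y) (h x y)).
Proof. exact: recursive_comp2. Qed.

Lemma recursive2_comp1 f g : computable f -> recursive2 g -> recursive2 (fun x y => f (g x y)).
Proof. exact: recursive_comp1. Qed.

Lemma recursive2_fst : recursive2 (fun x _ => x). Proof. exact: recursive_nth. Qed.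

Lemma recursive2_snd : recursive2 (fun _ y => y). Proof. exact: recursive_nth. Qed.

Lemma recursive2_const c : recursive2 (fun _ _ => c). Proof. exact: recursive_const. Qed.

Lemma computable_rec a g (h : nat -> nat) : recursive2 g ->
  h 0 = a -> (forall m, h m.+1 = g m (h m)) -> computable h.
Proof.
move=> rg h0 hS; apply/computableE.
apply: (@rec_primrec 0 (fun=> a) (fun t => g (nth 0 t 0) (nth 0 t 1))) rg _ _.
- exact: recursive_const.
- by move=> t; apply: h0.
by move=> m t; apply: hS.
Qed.

Lemma recursive2_rec f g (h : nat -> nat -> nat) : computable f -> recursive3 g ->
  (forall x, h 0 x = f x) -> (forall m x, h m.+1 x = g m (h m x) x) -> recursive2 h.
Proof.
move=> rf rg h0 hS.
move/computableE: rf => rf.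
apply: (rec_primrec rf rg) => [t|m t]; [exact: h0 | exact: hS].
Qed.

Lemma recursive2_iter f : computable f -> recursive2 (fun m x => iter m f x).
Proof.
move=> rf; apply: (recursive2_rec (g := fun _ r _ => f r)) computable_id _ _ _ => //.
by apply: (recursive_comp1 rf); apply: recursive_nth.
Qed.

Lemma recursive2_add : recursive2 addn.
Proof.
apply: eq_recursive2 (recursive2_iter computable_succ) => m n.
by elim: m => //= m ->.
Qed.

Lemma recursive2_mul : recursive2 muln.
Proof.
apply: (recursive2_rec (g := fun _ r x => x + r)) (computable_const 0) _ _ _ => //.
by apply: recursive_comp2 recursive2_add _ _; apply: recursive_nth.
Qed.

Lemma computable_pred : computable predn.
Proof. exact: (computable_rec (g := fun m _ => m)) recursive2_fst _ _. Qed.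

Lemma recursive2_sub : recursive2 subn.
Proof.
have r : recursive2 (fun m x => x - m).
  apply: (recursive2_rec (g := fun _ r _ => r.-1)) computable_id _ _ _ => // [|x|m x].
  - by apply: (recursive_comp1 computable_pred); apply: recursive_nth.
  - by rewrite subn0.
  by rewrite subnS.
exact: (recursive2_comp r recursive2_snd recursive2_fst).
Qed.

Lemma recursive2_exp : recursive2 expn.
Proof.
have r : recursive2 (fun m x => x ^ m).
  apply: (recursive2_rec (g := fun _ r x => x * r)) (computable_const 1) _ _ _ => // [|m x].
    by apply: recursive_comp2 recursive2_mul _ _; apply: recursive_nth.
  by rewrite expnS.
exact: (recursive2_comp r recursive2_snd recursive2_fst).
Qed.

Lemma computable_odd : computable (fun x => nat_of_bool (odd x)).
Proof.
apply: (computable_rec (a := 0) (g := fun _ r => 1 - r)) => //.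
  exact: recursive2_comp recursive2_sub (recursive2_const _) recursive2_snd.
by move=> m; rewrite /=; case: (odd m).
Qed.

Lemma computable_half : computable half.
Proof.
apply: (computable_rec (a := 0) (g := fun m r => odd m + r)) => // [|m].
  exact: recursive2_comp recursive2_add (recursive2_comp1 computable_odd recursive2_fst) recursive2_snd.
by rewrite /= uphalf_half.
Qed.

(** The pairing function is the one which codes lists: a code of a pair is also
    the code of the list with the given head and tail. *)
Definition cpair (a b : nat) : nat := 2 ^ a * b.*2.+1.

(** The projections; both are 0 at 0, which codes no pair. *)
Definition cfst (c : nat) : nat := head 0 (CodeSeq.decode c).

Definition csnd (c : nat) : nat := CodeSeq.code (behead (CodeSeq.decode c)).

Lemma cpair_code a s : cpair a (CodeSeq.code s) = CodeSeq.code (a :: s).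
Proof. by []. Qed.

Lemma decode_cpair a b : CodeSeq.decode (cpair a b) = a :: CodeSeq.decode b.
Proof. by rewrite -{1}(CodeSeq.decodeK b) cpair_code CodeSeq.codeK. Qed.

Lemma cfstE a b : cfst (cpair a b) = a. Proof. by rewrite /cfst decode_cpair. Qed.

Lemma csndE a b : csnd (cpair a b) = b.
Proof. by rewrite /csnd decode_cpair /= CodeSeq.decodeK. Qed.

Lemma cpair_csnd c : c != 0 -> c = cpair (cfst c) (csnd c).
Proof.
rewrite -{1 2}(CodeSeq.decodeK c) /cfst /csnd.
by case: (CodeSeq.decode c) => // a s _; rewrite cpair_code.
Qed.

Lemma recursive2_pair : recursive2 cpair.
Proof.
apply: recursive2_comp recursive2_mul _ _.
  exact: recursive2_comp recursive2_exp (recursive2_const _) recursive2_fst.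
apply: recursive2_comp1 computable_succ _.
have -> : (fun _ y => y.*2) = (fun _ y => y + y) :> (nat -> nat -> nat).
  by apply: funext => x; apply: funext => y; rewrite addnn.
exact: recursive2_comp recursive2_add recursive2_snd recursive2_snd.
Qed.

Lemma iter_half c m : c != 0 -> m <= cfst c -> iter m half c = cpair (cfst c - m) (csnd c).
Proof.
move=> c0; rewrite {2}(cpair_csnd c0); elim: m => [|m IHm] lt_ma; first by rewrite subn0.
rewrite iterS IHm; last exact: ltnW.
by rewrite -(subnSK lt_ma) /cpair expnS -mulnA mul2n doubleK.
Qed.

Lemma computable_fst : computable cfst.
Proof.
have r : recursive2 (fun m x => x * (1 - odd (iter m half x))).
  apply: recursive2_comp recursive2_mul recursive2_snd _.
  apply: recursive2_comp recursive2_sub (recursive2_const _) _.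
  exact: recursive2_comp1 computable_odd (recursive2_iter computable_half).
apply/computableE; apply: (rec_mu r) => t; rewrite /=; set c := nth 0 t 0.
  have [->//|c0] := eqVneq c 0.
  rewrite iter_half // subnn.
  by rewrite /cpair mul1n /= odd_double muln0.
move=> m; have [->//|c0] := eqVneq c 0.
move=> lt_m; rewrite (iter_half c0 (ltnW lt_m)).
rewrite -(subnSK lt_m) /cpair expnS -mulnA mul2n odd_double muln1.
exact/eqP.
Qed.

Lemma computable_snd : computable csnd.
Proof.
have r : computable (fun c => half (iter (cfst c) half c)).
  apply: computable_comp computable_half _.
  exact: computable_comp2 (recursive2_iter computable_half) computable_fst computable_id.
apply: eq_computable r => c; have [->//|c0] := eqVneq c 0.
rewrite iter_half // subnn /cpair mul1n.
by rewrite -[_.*2.+1]/(true + _) half_bit_double.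
Qed.

Lemma computable_pair f g : computable f -> computable g -> computable (fun x => cpair (f x) (g x)).
Proof. exact: computable_comp2 recursive2_pair. Qed.

Lemma computable_iter n f g : computable n -> computable f -> computable g ->
  computable (fun x => iter (n x) f (g x)).
Proof. by move=> rn rf rg; apply: computable_comp2 (recursive2_iter rf) rn rg. Qed.

Lemma computable_if b f g : computable b -> computable f -> computable g ->
  computable (fun x => if b x != 0 then f x else g x).
Proof.
move=> rb rf rg.
have r0 : computable (fun x => 1 - b x).
  exact: computable_comp2 recursive2_sub (computable_const 1) rb.
have r : computable (fun x => (1 - (1 - b x)) * f x + (1 - b x) * g x).
  apply: computable_comp2 recursive2_add _ _; apply: computable_comp2 recursive2_mul _ _ => //.
  exact: computable_comp2 recursive2_sub (computable_const 1) r0.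
apply: eq_computable r => x; case: (b x) => [|n] /=; first by rewrite mul0n mul1n.
by rewrite subSS sub0n mul1n mul0n addn0.
Qed.

End RecursiveFunctions.

(** * Realizable functions *)

(** A type whose elements are numbered, possibly with repetitions, by the
    natural numbers. *)
Structure numbered := Numbered {
  numbered_sort :> Type;
  num : nat -> numbered_sort;
  num_surj : forall x, exists n, num n = x }.

(** A function is realizable if a recursive function computes a number of its
    value from any number of its argument. *)
Definition realizable (A B : numbered) (f : A -> B) : Prop :=
  exists2 h, computable h & forall n, f (num A n) = num B (h n).

Section Instances.

Lemma nat_num_surj (x : nat) : exists n, id n = x. Proof. by exists x. Qed.
Canonical nat_numbered := Numbered nat_num_surj.

Lemma bool_num_surj (x : bool) : exists n, (n != 0)%N = x.
Proof. by exists (nat_of_bool x); case: x. Qed.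
Canonical bool_numbered := Numbered bool_num_surj.

Variables A B : numbered.

Lemma prod_num_surj (x : A * B) : exists n, (num A (cfst n), num B (csnd n)) = x.
Proof.
case: x => a b; have [i <-] := num_surj a; have [j <-] := num_surj b.
by exists (cpair i j); rewrite cfstE csndE.
Qed.
Canonical prod_numbered := Numbered prod_num_surj.

Lemma seq_num_surj (s : seq A) : exists n, map (num A) (CodeSeq.decode n) = s.
Proof.
elim: s => [|a s [n <-]]; first by exists 0%N.
by have [i <-] := num_surj a; exists (cpair i n); rewrite decode_cpair.
Qed.
Canonical seq_numbered := Numbered seq_num_surj.

End Instances.

(** Rational numbers are numbered by triples standing for the positive part and the
    negative part of a numerator, and for the predecessor of a denominator. *)
Definition mkrat (t : nat * (nat * nat)) : rat := (t.1%:R - t.2.1%:R) / t.2.2.+1%:R.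

Lemma mkrat_surj (x : rat) : exists n, mkrat (num _ n) = x.
Proof.
have [a [b Dn]] : exists a b : nat, numq x = a%:Z - b%:Z.
  by case: (numq x) => n; [exists n, 0%N; rewrite subr0 | exists 0%N, n.+1; rewrite sub0r NegzE].
have [d Dd] : exists d : nat, denq x = d.+1%:Z.
  by have := denq_gt0 x; case: (denq x) => // -[|d] // _; exists d.
have [n Dt] := num_surj ((a, (b, d)) : prod_numbered nat_numbered (prod_numbered nat_numbered nat_numbered)).
exists n; rewrite Dt /mkrat /= -[RHS]divq_num_den Dn Dd.
by rewrite rmorphB.
Qed.
Canonical rat_numbered := Numbered mkrat_surj.

Section Combinators.

Variable A : numbered.

Lemma eq_realizable (B : numbered) (f g : A -> B) : f =1 g -> realizable f -> realizable g.
Proof. by move=> /funext ->. Qed.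

Lemma realizable_id : realizable (fun x : A => x).
Proof. by exists id; first exact: computable_id. Qed.

Lemma realizable_const (B : numbered) (b : B) : realizable (fun _ : A => b).
Proof. by have [n <-] := num_surj b; exists (fun=> n); first exact: computable_const. Qed.

Lemma realizable_comp (B C : numbered) (g : B -> C) (f : A -> B) :
  realizable g -> realizable f -> realizable (fun x => g (f x)).
Proof.
move=> [k rk gk] [h rh fh]; exists (fun n => k (h n)); first exact: computable_comp rk rh.
by move=> n; rewrite fh gk.
Qed.

Lemma realizable_pair (B C : numbered) (f : A -> B) (g : A -> C) :
  realizable f -> realizable g -> realizable (fun x => (f x, g x)).
Proof.
move=> [h rh fh] [k rk gk]; exists (fun n => cpair (h n) (k n)); first exact: computable_pair.
by move=> n; rewrite fh gk /= cfstE csndE.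
Qed.

Lemma realizable_fst (B C : numbered) (f : A -> B * C) :
  realizable f -> realizable (fun x => (f x).1).
Proof.
move=> [h rh fh]; exists (fun n => cfst (h n)); first exact: computable_comp computable_fst rh.
by move=> n; rewrite fh.
Qed.

Lemma realizable_snd (B C : numbered) (f : A -> B * C) :
  realizable f -> realizable (fun x => (f x).2).
Proof.
move=> [h rh fh]; exists (fun n => csnd (h n)); first exact: computable_comp computable_snd rh.
by move=> n; rewrite fh.
Qed.

Lemma realizable_if (B : numbered) (b : A -> bool) (f g : A -> B) :
  realizable b -> realizable f -> realizable g -> realizable (fun x => if b x then f x else g x).
Proof.
move=> [l rl bl] [h rh fh] [k rk gk]; exists (fun n => if l n != 0%N then h n else k n).
  exact: computable_if.
by move=> n; rewrite bl fh gk /=; case: (l n).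
Qed.

Lemma realizable_nat1 (g : nat -> nat) (f : A -> nat) :
  computable g -> realizable f -> realizable (fun x => g (f x)).
Proof. by move=> rg; apply: realizable_comp; exists g. Qed.

Lemma realizable_nat2 (op : nat -> nat -> nat) (f g : A -> nat) :
  recursive2 op -> realizable f -> realizable g -> realizable (fun x => op (f x) (g x)).
Proof.
move=> rop [h rh fh] [k rk gk]; exists (fun n => op (h n) (k n)); first exact: computable_comp2.
by move=> n; rewrite fh gk.
Qed.

Lemma realizable_succ (f : A -> nat) : realizable f -> realizable (fun x => (f x).+1).
Proof. exact: realizable_nat1 computable_succ. Qed.

Lemma realizable_pred (f : A -> nat) : realizable f -> realizable (fun x => (f x).-1).
Proof. exact: realizable_nat1 computable_pred. Qed.

Lemma realizable_addn (f g : A -> nat) :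
  realizable f -> realizable g -> realizable (fun x => f x + g x)%N.
Proof. exact: realizable_nat2 recursive2_add. Qed.

Lemma realizable_muln (f g : A -> nat) :
  realizable f -> realizable g -> realizable (fun x => f x * g x)%N.
Proof. exact: realizable_nat2 recursive2_mul. Qed.

Lemma realizable_subn (f g : A -> nat) :
  realizable f -> realizable g -> realizable (fun x => f x - g x)%N.
Proof. exact: realizable_nat2 recursive2_sub. Qed.

Lemma realizable_expn (f g : A -> nat) :
  realizable f -> realizable g -> realizable (fun x => f x ^ g x)%N.
Proof. exact: realizable_nat2 recursive2_exp. Qed.

Lemma realizable_true (f : A -> nat) : realizable f -> realizable (fun x => f x != 0%N).
Proof. by move=> [h rh fh]; exists h => // n; rewrite fh. Qed.

Lemma realizable_nat_of_bool (b : A -> bool) :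
  realizable b -> realizable (fun x => nat_of_bool (b x)).
Proof. by move=> rb; apply: (realizable_if rb (realizable_const 1%N) (realizable_const 0%N)). Qed.

Lemma realizable_neg (b : A -> bool) : realizable b -> realizable (fun x => ~~ b x).
Proof.
move=> rb; apply: eq_realizable (realizable_if rb (realizable_const false) (realizable_const true)).
by move=> x; case: (b x).
Qed.

Lemma realizable_and (b c : A -> bool) :
  realizable b -> realizable c -> realizable (fun x => b x && c x).
Proof. by move=> rb rc; apply: (realizable_if rb rc (realizable_const false)). Qed.

Lemma realizable_or (b c : A -> bool) :
  realizable b -> realizable c -> realizable (fun x => b x || c x).
Proof. by move=> rb rc; apply: (realizable_if rb (realizable_const true) rc). Qed.

Lemma realizable_leq (f g : A -> nat) :
  realizable f -> realizable g -> realizable (fun x => f x <= g x)%N.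
Proof.
move=> rf rg; apply: eq_realizable (realizable_neg (realizable_true (realizable_subn rf rg))).
by move=> x; rewrite negbK.
Qed.

Lemma realizable_eqn (f g : A -> nat) :
  realizable f -> realizable g -> realizable (fun x => f x == g x).
Proof.
move=> rf rg; apply: eq_realizable (realizable_and (realizable_leq rf rg) (realizable_leq rg rf)).
by move=> x; rewrite eqn_leq.
Qed.

Lemma realizable_iter (B : numbered) (n : A -> nat) (step : A -> B -> B) (b : A -> B) :
  realizable n -> realizable (fun z : A * B => step z.1 z.2) -> realizable b ->
  realizable (fun x => iter (n x) (step x) (b x)).
Proof.
move=> [k rk nk] [h rh sh] [l rl bl].
exists (fun m => csnd (iter (k m) (fun c => cpair (cfst c) (h c)) (cpair m (l m)))).
  apply: computable_comp computable_snd _; apply: computable_iter => //.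
    exact: computable_pair computable_fst rh.
  exact: computable_pair computable_id rl.
move=> m; rewrite nk bl /=; set c := iter _ _ (cpair _ _).
suff [_ <-] : cfst c = m /\ num B (csnd c) = iter (k m) (step (num A m)) (num B (l m)) by [].
rewrite /c; elim: (k m) => [|i [IH1 IH2]]; first by rewrite cfstE csndE.
by rewrite /= cfstE csndE -(sh _) /= IH1 IH2.
Qed.

Lemma realizable_cons (B : numbered) (f : A -> B) (s : A -> seq B) :
  realizable f -> realizable s -> realizable (fun x => f x :: s x).
Proof.
move=> [h rh fh] [k rk gk]; exists (fun n => cpair (h n) (k n)); first exact: computable_pair.
by move=> n; rewrite fh gk /= decode_cpair.
Qed.

Lemma realizable_behead (B : numbered) (s : A -> seq B) :
  realizable s -> realizable (fun x => behead (s x)).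
Proof.
move=> [h rh sh]; exists (fun n => csnd (h n)); first exact: computable_comp computable_snd rh.
by move=> n; rewrite sh /= /csnd CodeSeq.codeK behead_map.
Qed.

Lemma realizable_head (B : numbered) (b : A -> B) (s : A -> seq B) :
  realizable b -> realizable s -> realizable (fun x => head (b x) (s x)).
Proof.
move=> [k rk bk] [h rh sh]; exists (fun n => if h n != 0%N then cfst (h n) else k n).
  exact: computable_if rh (computable_comp computable_fst rh) rk.
move=> n; rewrite bk sh /= /cfst; have [->//|] := eqVneq (h n) 0%N.
by rewrite -{1}(CodeSeq.decodeK (h n)); case: (CodeSeq.decode (h n)).
Qed.

(** Iterating the second projection on a list removes its elements one by one. *)
Lemma realizable_size (B : numbered) (s : A -> seq B) :
  realizable s -> realizable (fun x => size (s x)).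
Proof.
move=> [h rh sh]; exists (fun n => size (CodeSeq.decode (h n))); last first.
  by move=> n; rewrite sh /= size_map.
apply: (computable_comp (f := fun c => size (CodeSeq.decode c))) rh.
have iterE m c : iter m csnd c = CodeSeq.code (drop m (CodeSeq.decode c)).
  elim: m => [|m IHm]; first by rewrite drop0 CodeSeq.decodeK.
  by rewrite iterS IHm /csnd CodeSeq.codeK -drop1 drop_drop add1n.
apply/computableE; apply: (rec_mu (recursive2_iter computable_snd)) => [t|t m] /=.
  by rewrite iterE drop_size.
move=> lt_m; rewrite iterE -[CodeSeq.code _](CodeSeq.decodeK (CodeSeq.code _)) CodeSeq.codeK.
by rewrite (drop_nth 0%N lt_m) /=; apply/eqP; rewrite muln_eq0 expn_eq0.
Qed.

End Combinators.

Section ListCombinators.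

Variables A B C : numbered.

Lemma realizable_foldl (f : A -> C -> B -> C) (z : A -> C) (s : A -> seq B) :
  realizable (fun w : A * C * B => f w.1.1 w.1.2 w.2) -> realizable z -> realizable s ->
  realizable (fun x => foldl (f x) (z x) (s x)).
Proof.
move=> rf rz rs; pose d := num B 0.
pose step x (st : C * seq B) := (f x st.1 (head d st.2), behead st.2).
apply: (eq_realizable (f := fun x => (iter (size (s x)) (step x) (z x, s x)).1)).
  move=> x; elim: (s x) (z x) => [//|b t IHt] c.
  by rewrite [size _]/= iterSr; apply: IHt.
apply: realizable_fst; apply: realizable_iter; first exact: realizable_size.
  apply: realizable_pair; last exact/realizable_behead/realizable_snd/realizable_snd/realizable_id.
  have ra : realizable (fun w : A * (C * seq B) => (w.1, w.2.1, head d w.2.2)).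
    apply: realizable_pair; last first.
      apply: realizable_head; first exact: realizable_const.
      exact/realizable_snd/realizable_snd/realizable_id.
    apply: realizable_pair; first exact/realizable_fst/realizable_id.
    exact/realizable_fst/realizable_snd/realizable_id.
  exact: (realizable_comp rf ra).
exact: realizable_pair.
Qed.

End ListCombinators.

Section MoreListCombinators.

Variables A B C : numbered.

Lemma realizable_rev (s : A -> seq B) : realizable s -> realizable (fun x => rev (s x)).
Proof.
move=> rs; apply: (eq_realizable (f := fun x => foldl (fun t b => b :: t) [::] (s x))).
  move=> x; rewrite /rev; elim: (s x) [::] => //= b t IHt u.
apply: realizable_foldl => //; last exact: realizable_const.
apply: realizable_cons; first exact/realizable_snd/realizable_id.
exact/realizable_snd/realizable_fst/realizable_id.
Qed.

Lemma realizable_foldr (f : A -> B -> C -> C) (z : A -> C) (s : A -> seq B) :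
  realizable (fun w : A * B * C => f w.1.1 w.1.2 w.2) -> realizable z -> realizable s ->
  realizable (fun x => foldr (f x) (z x) (s x)).
Proof.
move=> rf rz rs.
apply: (eq_realizable (f := fun x => foldl (fun c b => f x b c) (z x) (rev (s x)))).
  by move=> x; rewrite foldl_rev.
apply: realizable_foldl => //; last exact: realizable_rev.
have ra : realizable (fun w : A * C * B => (w.1.1, w.2, w.1.2)).
  apply: realizable_pair; last exact/realizable_snd/realizable_fst/realizable_id.
  apply: realizable_pair; first exact/realizable_fst/realizable_fst/realizable_id.
  exact/realizable_snd/realizable_id.
exact: (realizable_comp rf ra).
Qed.

Lemma realizable_nth (b : A -> B) (s : A -> seq B) (i : A -> nat) :
  realizable b -> realizable s -> realizable i -> realizable (fun x => nth (b x) (s x) (i x)).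
Proof.
move=> rb rs ri; apply: (eq_realizable (f := fun x => head (b x) (iter (i x) behead (s x)))).
  move=> x; rewrite -nth0; have -> : iter (i x) behead (s x) = drop (i x) (s x).
    by elim: (i x) => [|k IHk]; rewrite ?drop0 // iterS IHk -drop1 drop_drop.
  by rewrite nth_drop addn0.
apply: realizable_head => //; apply: realizable_iter => //.
exact/realizable_behead/realizable_snd/realizable_id.
Qed.

End MoreListCombinators.

Section Tabulation.

Variables A B : numbered.

Lemma realizable_mkseq (f : A -> nat -> B) (n : A -> nat) :
  realizable (fun w : A * nat => f w.1 w.2) -> realizable n ->
  realizable (fun x => mkseq (f x) (n x)).
Proof.
move=> rf rn; pose step x (st : nat * seq B) := (st.1.+1, f x st.1 :: st.2).
apply: (eq_realizable (f := fun x => rev (iter (n x) (step x) (0%N, [::])).2)).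
  move=> x; have [] : (iter (n x) (step x) (0%N, [::])).1 = n x /\
      (iter (n x) (step x) (0%N, [::])).2 = rev (mkseq (f x) (n x)).
    elim: (n x) => // k [IH1 IH2]; rewrite !iterS /step /= -/(step x) IH1 IH2.
    by rewrite /mkseq -addn1 iotaD map_cat rev_cat addn1.
  by move=> _ ->; rewrite revK.
apply/realizable_rev/realizable_snd; apply: realizable_iter => //; last exact: realizable_const.
apply: realizable_pair; first exact/realizable_succ/realizable_fst/realizable_snd/realizable_id.
apply: realizable_cons; last exact/realizable_snd/realizable_snd/realizable_id.
have ra : realizable (fun w : A * (nat * seq B) => (w.1, w.2.1)).
  apply: realizable_pair; first exact/realizable_fst/realizable_id.
  exact/realizable_fst/realizable_snd/realizable_id.
exact: (realizable_comp rf ra).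
Qed.

(** Bounded search. *)
Lemma realizable_has (P : A -> B -> bool) (s : A -> seq B) :
  realizable (fun w : A * B => P w.1 w.2) -> realizable s -> realizable (fun x => has (P x) (s x)).
Proof.
move=> rP rs; apply: (eq_realizable (f := fun x => foldr (fun b c => P x b || c) false (s x))).
  by move=> x; elim: (s x) => //= b t ->.
apply: realizable_foldr => //; last exact: realizable_const.
apply: realizable_or; last exact/realizable_snd/realizable_id.
exact: (realizable_comp rP (realizable_fst (realizable_id _))).
Qed.

Lemma realizable_all (P : A -> B -> bool) (s : A -> seq B) :
  realizable (fun w : A * B => P w.1 w.2) -> realizable s -> realizable (fun x => all (P x) (s x)).
Proof.
move=> rP rs; apply: (eq_realizable (f := fun x => foldr (fun b c => P x b && c) true (s x))).
  by move=> x; elim: (s x) => //= b t ->.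
apply: realizable_foldr => //; last exact: realizable_const.
apply: realizable_and; last exact/realizable_snd/realizable_id.
exact: (realizable_comp rP (realizable_fst (realizable_id _))).
Qed.

Lemma realizable_find (P : A -> B -> bool) (s : A -> seq B) :
  realizable (fun w : A * B => P w.1 w.2) -> realizable s -> realizable (fun x => find (P x) (s x)).
Proof.
move=> rP rs.
apply: (eq_realizable (f := fun x => foldr (fun b k => if P x b then 0%N else k.+1) 0%N (s x))).
  by move=> x; elim: (s x) => //= b t ->.
apply: realizable_foldr => //; last exact: realizable_const.
apply: realizable_if; last exact/realizable_succ/realizable_snd/realizable_id.
  exact: (realizable_comp rP (realizable_fst (realizable_id _))).
exact: realizable_const.
Qed.

End Tabulation.

Ltac realize_extra := fail.

(** Decomposes a realizability goal along the structure of the function. *)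
Ltac realize := repeat (cbv beta zeta; first
  [ assumption
  | simple apply realizable_const | simple apply realizable_id
  | match goal with
    | H : realizable ?f |- realizable (fun x => ?f _) => apply (realizable_comp H)
    end
  | realize_extra
  | simple apply realizable_fst | simple apply realizable_snd | simple apply realizable_pair
  | simple apply realizable_if
  | simple apply realizable_leq | simple apply realizable_eqn | simple apply realizable_and
  | simple apply realizable_or
  | simple apply realizable_nat_of_bool | simple apply realizable_neg
  | simple apply realizable_succ | simple apply realizable_pred
  | simple apply realizable_addn | simple apply realizable_muln
  | simple apply realizable_subn | simple apply realizable_expn | simple apply realizable_cons
  | simple apply realizable_behead | simple apply realizable_head | simple apply realizable_size
  | simple apply realizable_rev | simple apply realizable_nth | simple apply realizable_mkseq
  | simple apply realizable_has | simple apply realizable_all | simple apply realizable_find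
  | simple apply realizable_iter | simple apply realizable_foldr ]).

Section Arithmetic.

Variable A : numbered.

Lemma realizable_iota (m n : A -> nat) :
  realizable m -> realizable n -> realizable (fun x => iota (m x) (n x)).
Proof.
move=> rm rn; apply: (eq_realizable (f := fun x => mkseq (fun i => m x + i)%N (n x))).
  by move=> x; rewrite /mkseq -[in RHS](addn0 (m x)) iotaDl.
by realize.
Qed.

Lemma realizable_fact (f : A -> nat) : realizable f -> realizable (fun x => (f x)`!).
Proof.
pose step (st : nat * nat) := (st.1.+1, st.1.+1 * st.2)%N.
move=> rf; apply: (eq_realizable (f := fun x => (iter (f x) step (0, 1)%N).2)).
  move=> x; suff -> : iter (f x) step (0, 1)%N = (f x, (f x)`!) by [].
  by elim: (f x) => // n IHn; rewrite iterS IHn.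
by rewrite /step; realize.
Qed.

Lemma realizable_divmod (f g : A -> nat) : realizable f -> realizable g ->
  realizable (fun x => (f x %/ g x, f x %% g x)%N).
Proof.
pose step d (st : nat * nat) := if st.2.+1 == d then (st.1.+1, 0)%N else (st.1, st.2.+1).
move=> rf rg; apply: (eq_realizable (f := fun x => iter (f x) (step (g x)) (0, 0)%N)).
  move=> x; have [->|d_gt0] := posnP (g x).
    by rewrite divn0 modn0; elim: (f x) => // n IHn; rewrite iterS IHn.
  suff: let st := iter (f x) (step (g x)) (0, 0)%N in (st.1 * g x + st.2 = f x)%N /\ (st.2 < g x)%N.
    case: (iter _ _ _) => q r /= [<- lt_r].
    by rewrite divnMDl // divn_small // addn0 modnMDl modn_small.
  elim: (f x) => // n /=; case: (iter _ _ _) => q r [E lt_r] /=; rewrite /step /=.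
  case: eqP => [Er|/eqP ne_r] /=; first by rewrite mulSn addn0 -{1}Er -E addSn addnC.
  by rewrite addnS E; split; rewrite // ltn_neqAle ne_r.
by rewrite /step; realize.
Qed.

Lemma realizable_divn (f g : A -> nat) :
  realizable f -> realizable g -> realizable (fun x => f x %/ g x)%N.
Proof. by move=> rf rg; apply: realizable_fst (realizable_divmod rf rg). Qed.

Lemma realizable_modn (f g : A -> nat) :
  realizable f -> realizable g -> realizable (fun x => f x %% g x)%N.
Proof. by move=> rf rg; apply: realizable_snd (realizable_divmod rf rg). Qed.

Lemma realizable_mkrat (t : A -> nat * (nat * nat)) : realizable t -> realizable (fun x => mkrat (t x)).
Proof. by move=> [h rh th]; exists h => // n; rewrite th. Qed.

(** An operation on rational numbers is realizable as soon as it is computed on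
    triples. *)
Lemma realizable_rat1 (op : rat -> rat) (t : nat * (nat * nat) -> nat * (nat * nat)) (f : A -> rat) :
  realizable t -> (forall u, op (mkrat u) = mkrat (t u)) ->
  realizable f -> realizable (fun x => op (f x)).
Proof.
move=> [k rk tk] opE [h rh fh]; exists (fun n => k (h n)); first exact: computable_comp rk rh.
by move=> n; rewrite fh opE tk.
Qed.

Lemma realizable_rat2 (op : rat -> rat -> rat)
    (t : nat * (nat * nat) -> nat * (nat * nat) -> nat * (nat * nat)) (f g : A -> rat) :
  realizable (fun w : nat * (nat * nat) * (nat * (nat * nat)) => t w.1 w.2) ->
  (forall u v, op (mkrat u) (mkrat v) = mkrat (t u v)) ->
  realizable f -> realizable g -> realizable (fun x => op (f x) (g x)).
Proof.
move=> [l rl tl] opE [h rh fh] [k rk gk]; exists (fun n => l (cpair (h n) (k n))).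
  exact: computable_comp rl (computable_pair rh rk).
move=> n; rewrite fh gk opE.
by rewrite -[RHS]/(mkrat (num _ (l (cpair (h n) (k n))))) -tl /= cfstE csndE.
Qed.

Lemma realizable_natr (f : A -> nat) : realizable f -> realizable (fun x => (f x)%:R : rat).
Proof.
move=> rf; apply: (eq_realizable (f := fun x => mkrat (f x, (0, 0))%N)).
  by move=> x; rewrite /mkrat subr0 divr1.
by apply: realizable_mkrat; realize.
Qed.

Lemma realizable_addr (f g : A -> rat) :
  realizable f -> realizable g -> realizable (fun x => f x + g x).
Proof.
pose t (u v : nat * (nat * nat)) := (u.1 * v.2.2.+1 + v.1 * u.2.2.+1,
  (u.2.1 * v.2.2.+1 + v.2.1 * u.2.2.+1, u.2.2 * v.2.2 + u.2.2 + v.2.2))%N.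
apply: (realizable_rat2 (t := t)); first by rewrite /t; realize.
move=> [a [b c]] [a' [b' c']]; rewrite /mkrat /t /=.
have c0 : c.+1%:R != 0 :> rat by rewrite pnatr_eq0.
have c0' : c'.+1%:R != 0 :> rat by rewrite pnatr_eq0.
have -> : (c * c' + c + c').+1%:R = c.+1%:R * c'.+1%:R :> rat.
  by rewrite -natrM; congr _%:R; lia.
rewrite !(natrD, natrM); move: c.+1%:R c'.+1%:R c0 c0' => d d' d0 d0'.
by field; rewrite d0 d0'.
Qed.

Lemma realizable_mulr (f g : A -> rat) :
  realizable f -> realizable g -> realizable (fun x => f x * g x).
Proof.
pose t (u v : nat * (nat * nat)) := (u.1 * v.1 + u.2.1 * v.2.1,
  (u.1 * v.2.1 + u.2.1 * v.1, u.2.2 * v.2.2 + u.2.2 + v.2.2))%N.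
apply: (realizable_rat2 (t := t)); first by rewrite /t; realize.
move=> [a [b c]] [a' [b' c']]; rewrite /mkrat /t /=.
have c0 : c.+1%:R != 0 :> rat by rewrite pnatr_eq0.
have c0' : c'.+1%:R != 0 :> rat by rewrite pnatr_eq0.
have -> : (c * c' + c + c').+1%:R = c.+1%:R * c'.+1%:R :> rat.
  by rewrite -natrM; congr _%:R; lia.
rewrite !(natrD, natrM); move: c.+1%:R c'.+1%:R c0 c0' => d d' d0 d0'.
by field; rewrite d0 d0'.
Qed.

Lemma realizable_oppr (f : A -> rat) : realizable f -> realizable (fun x => - f x).
Proof.
apply: (realizable_rat1 (t := fun u => (u.2.1, (u.1, u.2.2)))); first by realize.
by move=> u; rewrite /mkrat /= -mulNr opprB.
Qed.

Lemma realizable_invr (f : A -> rat) : realizable f -> realizable (fun x => (f x)^-1).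
Proof.
pose t (u : nat * (nat * nat)) :=
  if (u.2.1 < u.1)%N then (u.2.2.+1, (0, (u.1 - u.2.1).-1))%N else
  if (u.1 < u.2.1)%N then (0, (u.2.2.+1, (u.2.1 - u.1).-1))%N else (0, (0, 0))%N.
apply: (realizable_rat1 (t := t)); first by rewrite /t; realize.
move=> [a [b c]]; rewrite /mkrat /t /= invf_div; case: ltngtP => /= [lt_ba|lt_ab|->].
- by rewrite prednK ?subn_gt0 // subr0 natrB // ltnW.
- by rewrite prednK ?subn_gt0 // sub0r natrB ?mulNr -?mulrN -?invrN ?opprB // ltnW.
by rewrite !subrr mul0r invr0 mulr0.
Qed.

Lemma realizable_eqr (f g : A -> rat) :
  realizable f -> realizable g -> realizable (fun x => f x == g x).
Proof.
move=> rf rg; apply: (eq_realizable (f := fun x => f x - g x == 0)).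
  by move=> x; rewrite subr_eq0.
have [h rh fh] := realizable_addr rf (realizable_oppr rg).
have rt : realizable (fun u : nat * (nat * nat) => u.1 == u.2.1) by realize.
have [k rk tk] := rt; exists (fun n => k (h n)); first exact: computable_comp rk rh.
move=> n; rewrite fh -tk -[num rat_numbered _]/(mkrat (num _ (h n))).
by case: (num _ (h n)) => a [b c]; rewrite /mkrat mulf_eq0 invr_eq0 pnatr_eq0 orbF subr_eq0 eqr_nat.
Qed.

Lemma realizable_decode (f : A -> nat) : realizable f -> realizable (fun x => CodeSeq.decode (f x)).
Proof. by move=> [h rh fh]; exists h => // n; rewrite fh /= map_id. Qed.

End Arithmetic.

Ltac realize_extra ::= first
  [ simple apply realizable_iota | simple apply realizable_fact | simple apply realizable_divn
  | simple apply realizable_modn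
  | simple apply realizable_natr | simple apply realizable_addr | simple apply realizable_mulr
  | simple apply realizable_oppr
  | simple apply realizable_invr | simple apply realizable_eqr | simple apply realizable_decode ].

(** * Deciding relations between presentations *)

Section Parser.

(** Reads a rational number, and returns the rest of the input. *)
Definition parse_rat (s : seq nat) : rat * seq nat :=
  (if nth 0%N s 0 == 0%N then (nth 0%N s 1)%:R / (nth 0%N s 2)%:R
   else - ((nth 0%N s 1)%:R / (nth 0%N s 2)%:R), behead (behead (behead s))).

(** Reads a list preceded by its length, [f] reading one element. *)
Definition parse_list (B : Type) (f : seq nat -> B * seq nat) (s : seq nat) : seq B * seq nat :=
  let st := iter (head 0%N s) (fun st => ((f st.2).1 :: st.1, (f st.2).2)) ([::], behead s) in
  (rev st.1, st.2).

(** Reads an encoded presentation, without its degree. *)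
Definition parse (c : nat) : seq rat * seq (seq rat) :=
  let r := parse_list parse_rat (behead (CodeSeq.decode c)) in
  (r.1, (parse_list (parse_list parse_rat) r.2).1).

Lemma parse_ratK x s : parse_rat (encode_rat x ++ s) = (x, s).
Proof.
rewrite /parse_rat /=; congr pair; rewrite -[RHS]divq_num_den.
have -> : (`|denq x|%N)%:R = (denq x)%:~R :> rat by rewrite natr_absz gtr0_norm ?denq_gt0.
rewrite natr_absz; have [num_lt0|num_ge0] := ltP (numq x) 0.
  by rewrite ltr0_norm // rmorphN mulNr opprK.
by rewrite ger0_norm.
Qed.

Lemma parse_listK (B : Type) (f : seq nat -> B * seq nat) (enc : B -> seq nat) l s :
  (forall b s, f (enc b ++ s) = (b, s)) ->
  parse_list f (size l :: flatten (map enc l) ++ s) = (l, s).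
Proof.
move=> fK; rewrite /parse_list /=; set step := fun st => _.
suff E t : iter (size l) step (t, flatten (map enc l) ++ s) = (catrev l t, s) by rewrite E /= revK.
elim: l t => //= b l IHl t.
by rewrite -iterS iterSr /step /= -catA fK IHl.
Qed.

Lemma parse_encode n p q : parse (encode n p q) = (polyseq p, map polyseq q).
Proof.
rewrite /parse /encode CodeSeq.codeK [behead _]/= (parse_listK p _ parse_ratK).
have -> : [seq encode_poly c | c <- q] =
    [seq size s :: flatten (map encode_rat s) | s <- map polyseq q] by rewrite -map_comp.
rewrite -[flatten _]cats0 -(size_map polyseq) parse_listK // => t s.
exact: parse_listK parse_ratK.
Qed.

Lemma realizable_parse_list (B : numbered) (f : seq nat -> B * seq nat) :
  realizable f -> realizable (parse_list f).
Proof. by move=> rf; rewrite /parse_list; realize. Qed.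

Lemma realizable_parse : realizable parse.
Proof.
have r1 : realizable parse_rat by rewrite /parse_rat; realize.
have r2 := realizable_parse_list r1; have r3 := realizable_parse_list r2.
by rewrite /parse; realize.
Qed.

End Parser.

Section ReducedPolynomials.

(** Polynomials modulo [p], as lists of coefficients of length the degree of
    [p]. *)
Variable p : seq rat.

Definition red_zero : seq rat := mkseq (fun=> 0) (size p).-1.

Definition red_one : seq rat := mkseq (fun i => (nat_of_bool (i == 0%N))%:R) (size p).-1.

(** The product by ['X], reduced by a multiple of [p]. *)
Definition red_mulX (v : seq rat) : seq rat :=
  mkseq (fun i => (if i == 0%N then 0 else nth 0 v i.-1) +
    - (nth 0 v (size p).-2 * (nth 0 p (size p).-1)^-1 * nth 0 p i)) (size p).-1.

(** The sum of [w] and of [c] times [v]. *)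
Definition red_axpy (c : rat) (v w : seq rat) : seq rat :=
  mkseq (fun i => c * nth 0 v i + nth 0 w i) (size p).-1.

(** The product; only [w] needs to be reduced. *)
Definition red_mul (v w : seq rat) : seq rat :=
  foldr (fun c u => red_axpy c w (red_mulX u)) red_zero v.

(** The composition of [f] with [g]. *)
Definition red_comp (f g : seq rat) : seq rat :=
  foldr (fun c u => red_axpy c red_one (red_mul g u)) red_zero f.

Definition red_eq (v w : seq rat) : bool :=
  all (fun i => nth 0 v i == nth 0 w i) (iota 0 (size p).-1).

(** Decides whether the class [y] of [g] is a root of the nonzero polynomial
    [p'], whether [g'] takes at [y] the class of ['X] as value, and whether the members of
    [q'] take at [y] the same values as those of [q] at ['X]. *)
Definition same_presentation (q : seq (seq rat)) (p' : seq rat) (q' : seq (seq rat))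
    (g g' : seq rat) : bool :=
  [&& has (fun c => ~~ (c == 0)) p',
      red_eq (red_comp p' g) red_zero,
      red_eq (red_comp g' g) (red_mul [:: 0; 1] red_one) &
      all (fun i => red_eq (red_comp (nth [::] q' i) g) (red_mul (nth [::] q i) red_one))
        (iota 0 (size q' + size q)%N)].

End ReducedPolynomials.

Section ReducedRealizable.

Variable A : numbered.

Lemma realizable_red_mul (p v w : A -> seq rat) :
  realizable p -> realizable v -> realizable w -> realizable (fun x => red_mul (p x) (v x) (w x)).
Proof. by rewrite /red_mul /red_axpy /red_mulX /red_zero => rp rv rw; realize. Qed.

Lemma realizable_red_eq (p v w : A -> seq rat) :
  realizable p -> realizable v -> realizable w -> realizable (fun x => red_eq (p x) (v x) (w x)).
Proof. by rewrite /red_eq => rp rv rw; realize. Qed.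

End ReducedRealizable.

Lemma realizable_red_comp (A : numbered) (p f g : A -> seq rat) :
  realizable p -> realizable f -> realizable g -> realizable (fun x => red_comp (p x) (f x) (g x)).
Proof.
rewrite /red_comp /red_axpy /red_one /red_zero => rp rf rg; apply: realizable_foldr => //; last by realize.
apply: realizable_mkseq; last by realize.
apply: realizable_addr; first by realize.
apply: realizable_nth; [by realize| |by realize].
apply: realizable_red_mul; by realize.
Qed.

Lemma realizable_same_presentation (A : numbered) (p : A -> seq rat) (q : A -> seq (seq rat))
    (p' : A -> seq rat) (q' : A -> seq (seq rat)) (g g' : A -> seq rat) :
  realizable p -> realizable q -> realizable p' -> realizable q' -> realizable g -> realizable g' ->
  realizable (fun x => same_presentation (p x) (q x) (p' x) (q' x) (g x) (g' x)).
Proof.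
move=> rp rq rp' rq' rg rg'; have r0 : realizable (fun x => red_zero (p x)) by rewrite /red_zero; realize.
have r1 : realizable (fun x => red_one (p x)) by rewrite /red_one; realize.
apply: realizable_and.
  by apply: realizable_has => //; apply: realizable_neg; apply: realizable_eqr; realize.
apply: realizable_and.
  by apply: realizable_red_eq => //; apply: realizable_red_comp.
apply: realizable_and.
  apply: realizable_red_eq => //; first exact: realizable_red_comp.
  by apply: realizable_red_mul => //; apply: realizable_const.
apply: realizable_all; last by realize.
apply: realizable_red_eq; first by realize.
  by apply: realizable_red_comp; realize.
apply: realizable_red_mul; [by realize|by realize|].
exact: (realizable_comp r1 (realizable_fst (realizable_id _))).
Qed.

Section ReducedSemantics.

Variables (K : fieldExtType rat) (a : K) (p : {poly rat}).
Hypotheses (p_irr : irreducible_poly p) (pa : horner_alg a p = 0).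

Let d := (size p).-1.

Let d_gt0 : (0 < d)%N. Proof. by rewrite /d -subn1 subn_gt0; case: p_irr. Qed.

(** The element of [K] given by a list of coefficients. *)
Definition value (s : seq rat) : K := horner_alg a (Poly s).

Lemma value_poly (f : {poly rat}) : value f = horner_alg a f.
Proof. by rewrite /value polyseqK. Qed.

Lemma value_cons c s : value (c :: s) = c%:A + a * value s.
Proof. by rewrite /value /= cons_poly_def rmorphD rmorphM /= horner_algX horner_algC addrC mulrC. Qed.

Lemma value_wide n s : (size s <= n)%N -> value s = \sum_(i < n) (nth 0 s i)%:A * a ^+ i.
Proof.
elim: n s => [|n IHn] [|c s] //= le_sn.
- by rewrite big_ord0 /value rmorph0.
- by rewrite /value rmorph0 big1 // => i _; rewrite nth_nil scale0r mul0r.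
rewrite value_cons big_ord_recl expr0 mulr1 IHn // mulr_sumr; congr (_ + _).
by apply: eq_bigr => i _; rewrite exprS mulrCA.
Qed.

Lemma value_mkseq f n : value (mkseq f n) = \sum_(i < n) (f i)%:A * a ^+ i.
Proof.
by rewrite (value_wide (n := n)) ?size_mkseq //; apply: eq_bigr => i _; rewrite nth_mkseq.
Qed.

Lemma value_red_zero : value (red_zero p) = 0.
Proof. by rewrite value_mkseq big1 // => i _; rewrite scale0r mul0r. Qed.

Lemma value_red_one : value (red_one p) = 1.
Proof.
rewrite value_mkseq (bigD1 (Ordinal d_gt0)) //= big1 => [|i i0].
  by rewrite addr0 expr0 mulr1 scale1r.
by rewrite -[i == _]/(val i == 0%N) in i0; rewrite (negPf i0) scale0r mul0r.
Qed.

Lemma value_red_axpy c v w : (size v <= d)%N -> (size w <= d)%N ->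
  value (red_axpy p c v w) = c%:A * value v + value w.
Proof.
move=> sv sw; rewrite value_mkseq (value_wide sv) (value_wide sw) mulr_sumr -big_split /=.
apply: eq_bigr => i _; rewrite scalerDl mulrDl mulrA; congr (_ * _ + _).
by rewrite -scalerAl mul1r scalerA.
Qed.

Lemma value_red_mulX v : (size v <= d)%N -> value (red_mulX p v) = a * value v.
Proof.
move=> sv; have lc : p`_d != 0 by rewrite -lead_coefE lead_coef_eq0 irredp_neq0.
pose b := v`_d.-1 / p`_d.
have E : \sum_(i < d) (p`_i)%:A * a ^+ i = - ((p`_d)%:A * a ^+ d).
  apply/eqP; rewrite -addr_eq0 -(big_ord_recr d (fun i => (p`_i)%:A * a ^+ i)) -value_wide.
    by rewrite value_poly pa.
  by rewrite /d leqSpred.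
rewrite value_mkseq -/d (eq_bigr (fun i : 'I_d =>
    (if i == 0%N :> nat then 0 else v`_i.-1)%:A * a ^+ i - b%:A * ((p`_i)%:A * a ^+ i))); last first.
  move=> i _; rewrite scalerDl mulrDl; congr (_ + _).
  by rewrite scaleNr mulNr [in RHS]mulrA -[in RHS]scalerAl mul1r scalerA.
rewrite sumrB -mulr_sumr E mulrN opprK mulrA -scalerAl mul1r scalerA.
rewrite /b divfK // (value_wide sv) mulr_sumr; move: d_gt0 sv; case: (d) => // e _ _ /=.
rewrite big_ord_recl scale0r mul0r add0r [RHS]big_ord_recr /=; congr (_ + _).
  by apply: eq_bigr => i _; rewrite /= exprS mulrCA.
by rewrite exprS mulrCA.
Qed.

Lemma size_red_mul v w : size (red_mul p v w) = d.
Proof. by case: v => [|c v]; rewrite /= size_mkseq. Qed.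

Lemma size_red_comp f g : size (red_comp p f g) = d.
Proof. by case: f => [|c f]; rewrite /= size_mkseq. Qed.

Lemma value_red_mul v w : (size w <= d)%N -> value (red_mul p v w) = value v * value w.
Proof.
move=> sw; elim: v => [|c v IHv]; first by rewrite value_red_zero /value rmorph0 mul0r.
rewrite [red_mul _ _ _]/= value_red_axpy ?size_mkseq // value_red_mulX -/(red_mul p v w).
  by rewrite IHv value_cons mulrDl mulrA.
by rewrite size_red_mul.
Qed.

Lemma value_red_comp f g : value (red_comp p f g) = horner_alg (value g) (Poly f).
Proof.
elim: f => [|c f IHf]; first by rewrite value_red_zero rmorph0.
rewrite [red_comp _ _ _]/= value_red_axpy ?size_mkseq //; last by rewrite size_red_mul.
rewrite value_red_mul -/(red_comp p f g); last by rewrite size_red_comp.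
rewrite IHf value_red_one mulr1 /= cons_poly_def rmorphD rmorphM /= horner_algX horner_algC.
by rewrite addrC mulrC.
Qed.

Lemma value_inj v w : size v = d -> size w = d -> value v = value w -> v = w.
Proof.
move=> sv sw E; pose r := Poly v - Poly w.
have ra : horner_alg a r = 0 by rewrite rmorphB /= -![horner_alg a _]/(value _) E subrr.
have r0 : r = 0.
  apply: contraTeq isT => r0.
  have sr : (size r < size p)%N.
    have sp : size p = d.+1 by rewrite /d prednK // ltnW //; case: p_irr.
    rewrite sp ltnS; apply: leq_trans (size_polyD _ _) _; rewrite size_polyN geq_max.
    by rewrite -{1}sv -{1}sw !size_Poly.
  have cop : coprimep p r.
    rewrite /coprimep; apply: contraLR sr => g1; rewrite -leqNgt.
    have := p_irr.2 _ g1 (dvdp_gcdl p r) => /eqp_size <-.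
    exact: dvdp_leq (dvdp_gcdr p r).
  have /Bezout_eq1_coprimepP[u Du] := cop.
  have := congr1 (horner_alg a) Du; rewrite rmorphD !rmorphM /= pa ra !mulr0 addr0 rmorph1.
  by move/eqP; rewrite eq_sym oner_eq0.
apply: (@eq_from_nth _ 0) => [|i _]; first by rewrite sv sw.
by rewrite -(coef_Poly v) -(coef_Poly w); apply/eqP; rewrite -subr_eq0 -coefB -/r r0 coef0.
Qed.

Lemma red_eqP v w : size v = d -> size w = d -> red_eq p v w = (value v == value w).
Proof.
move=> sv sw; apply/idP/eqP => [/allP vw|/(value_inj sv sw) -> //]; last exact/allP.
congr value; apply: (@eq_from_nth _ 0) => [|i lt_i]; first by rewrite sv sw.
by apply/eqP/vw; rewrite mem_iota add0n -/d -sv.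
Qed.

Lemma same_presentationP (q : seq (seq rat)) (p' : seq rat) (q' : seq (seq rat)) (g g' : seq rat) :
  reflect [/\ Poly p' != 0, horner_alg (value g) (Poly p') = 0,
      horner_alg (value g) (Poly g') = a &
      forall i, horner_alg (value g) (Poly (nth [::] q' i)) = value (nth [::] q i)]
    (same_presentation p q p' q' g g').
Proof.
have nz : has (fun c => ~~ (c == 0)) p' = (Poly p' != 0).
  apply/hasP/idP => [[c cp' c0]|p'0].
    apply/eqP=> p'0.
    have := congr1 (fun f : {poly rat} => f`_(index c p')) p'0.
    by rewrite coef_Poly nth_index // coef0 => /eqP; rewrite (negPf c0).
  have : lead_coef (Poly p') != 0 by rewrite lead_coef_eq0.
  rewrite lead_coefE coef_Poly => c0; set i := _.-1 in c0; exists p'`_i => //.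
  by rewrite mem_nth // ltnNge; apply: contra c0 => le_i; rewrite nth_default.
rewrite /same_presentation nz !red_eqP ?size_red_comp ?size_red_mul ?size_mkseq //.
rewrite value_red_zero value_red_mul ?size_mkseq // value_red_one mulr1 !value_red_comp.
have -> : value [:: 0; 1] = a.
  by rewrite !value_cons /value /= rmorph0 scale0r add0r mulr0 addr0 scale1r mulr1.
apply: (iffP and4P) => [[-> /eqP -> /eqP -> /allP qq]|[-> -> -> qq]]; split=> //.
  move=> i; have [lt_i|le_i] := ltnP i (size q' + size q); last first.
    rewrite !nth_default ?(leq_trans _ le_i) ?leq_addl ?leq_addr // /value.
    by rewrite !rmorph0.
  have /qq : i \in iota 0 (size q' + size q) by rewrite mem_iota.
  rewrite red_eqP ?size_red_comp ?size_red_mul ?size_mkseq //.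
  by rewrite value_red_mul ?size_mkseq // value_red_one mulr1 value_red_comp => /eqP.
apply/allP=> i _; rewrite red_eqP ?size_red_comp ?size_red_mul ?size_mkseq //.
by rewrite value_red_mul ?size_mkseq // value_red_one mulr1 value_red_comp qq.
Qed.

End ReducedSemantics.

(** * The degree bound as a computable function *)

(** A digit of [w] in base [M]. *)
Definition digit (M w i : nat) : nat := (w %/ M ^ i %% M)%N.

(** The rational number given by three consecutive digits in base [M]: the positive
    part and the negative part of the numerator, and the denominator.  It is zero
    if the denominator is. *)
Definition rat_digit (M w i : nat) : rat :=
  ((digit M w (3 * i))%:R + - (digit M w (3 * i).+1)%:R) * ((digit M w (3 * i).+2)%:R)^-1.

Definition rat_digits (M w off len : nat) : seq rat :=
  mkseq (fun i => rat_digit M w (off + i)%N) len.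

Lemma digits_exist (M len : nat) (t : nat -> nat) : (forall i, t i < M)%N ->
  exists2 w, (w < M ^ len)%N & forall i, (i < len)%N -> digit M w i = t i.
Proof.
move=> tM; have M_gt0 : (0 < M)%N by apply: leq_ltn_trans (tM 0%N).
elim: len => [|len [w lt_w wE]]; first by exists 0%N.
have Mx i : (0 < M ^ i)%N by rewrite expn_gt0 M_gt0.
exists (t len * M ^ len + w)%N.
  rewrite expnS; apply: (@leq_trans ((t len).+1 * M ^ len)); last by rewrite leq_mul2r tM orbT.
  by rewrite mulSn addnC ltn_add2r.
move=> i; rewrite ltnS leq_eqVlt => /orP[/eqP ->|lt_i].
  by rewrite /digit divnMDl // (divn_small lt_w) addn0 modn_small.
have -> : (M ^ len = M ^ (len - i.+1) * M * M ^ i)%N.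
  by rewrite -expnSr subnSK // -expnD subnK // ltnW.
by rewrite -(wE i lt_i) /digit !mulnA divnMDl // modnMDl.
Qed.

Lemma rat_digit_bounded (N w i : nat) : rat_bounded N.+1 (rat_digit N.+1 w i).
Proof.
rewrite /rat_digit; have lt_d j : (digit N.+1 w j <= N)%N by rewrite -ltnS ltn_mod.
have [->|d0] := eqVneq (digit N.+1 w (3 * i).+2) 0%N; first by rewrite invr0 mulr0.
set a := digit _ _ _; set b := digit _ _ _; set d := digit _ _ _ in d0 *.
have -> : (a%:R + - b%:R) * d%:R^-1 = (a%:Z - b%:Z)%:~R / (d%:Z)%:~R :> rat by rewrite rmorphB.
have [le_a le_b le_d] : [/\ a <= N, b <= N & d <= N]%N by split; apply: lt_d.
by apply: rat_bounded_frac; lia.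
Qed.

Lemma rat_digits_exist (N len : nat) (c : nat -> rat) :
  (forall i, (i < len)%N -> rat_bounded N (c i)) ->
  exists2 w, (w < N.+1 ^ (3 * len))%N & forall i, (i < len)%N -> rat_digit N.+1 w i = c i.
Proof.
move=> cN.
pose t j := let x := c (j %/ 3)%N in if (j < 3 * len)%N then
  match (j %% 3)%N with
  | 0 => if 0 <= numq x then `|numq x|%N else 0%N
  | 1 => if 0 <= numq x then 0%N else `|numq x|%N
  | _ => `|denq x|%N end else 0%N.
have tN j : (t j < N.+1)%N.
  rewrite /t; case: ifP => // lt_j.
  have /cN/andP[le_n le_d] : (j %/ 3 < len)%N by rewrite ltn_divLR // mulnC.
  by case: (j %% 3)%N => [|[|k]]; rewrite ?ltnS //; case: ifP.
have [w lt_w wE] := digits_exist (3 * len) tN; exists w => // i lt_i.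
have tE k : (k < 3)%N -> digit N.+1 w (3 * i + k) = t (3 * i + k)%N.
  move=> lt_k; apply: wE; apply: (@leq_trans (3 * i.+1)); last by rewrite leq_mul2l.
  by rewrite mulnS [(3 + _)%N]addnC ltn_add2l.
have := (tE 0%N isT, tE 1%N isT, tE 2 isT); rewrite /rat_digit addn0 addn1 addn2 => -[[-> ->] ->].
have lt3 k : (k < 3)%N -> (3 * i + k < 3 * len)%N.
  move=> lt_k; apply: (@leq_trans (3 * i.+1)); last by rewrite leq_mul2l.
  by rewrite mulnS [(3 + _)%N]addnC ltn_add2l.
have tEE k : (k < 3)%N -> t (3 * i + k)%N = match k with
  | 0 => if 0 <= numq (c i) then `|numq (c i)|%N else 0%N
  | 1 => if 0 <= numq (c i) then 0%N else `|numq (c i)|%N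
  | _ => `|denq (c i)|%N end.
  by move=> lt_k; rewrite /t lt3 // mulnC divnMDl // divn_small // addn0 modnMDl modn_small.
have := (tEE 0%N isT, tEE 1%N isT, tEE 2 isT); rewrite addn0 addn1 addn2 => -[[-> ->] ->].
have -> : (`|denq (c i)|%N)%:R = (denq (c i))%:~R :> rat by rewrite natr_absz gtr0_norm ?denq_gt0.
rewrite -[RHS]divq_num_den; case: leP => num_ge0; rewrite natr_absz.
  by rewrite ger0_norm // subr0.
by rewrite ltr0_norm // rmorphN opprK add0r.
Qed.

(** The coefficients of the defining polynomial of a presentation of size [N],
    given by the digits of [w1] in base [N.+1]. *)
Definition poly_data (N w1 : nat) : seq rat := rat_digits N.+1 w1 0 N.

(** The coefficients of the polynomials expressing those of [chi]. *)
Definition coef_data (N w2 : nat) : seq (seq rat) :=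
  mkseq (fun i => rat_digits N.+1 w2 (i * N) N) N.

Definition poly_data_bound (N : nat) : nat := (N.+1 ^ (3 * N))%N.

Definition coef_data_bound (N : nat) : nat := (N.+1 ^ (3 * (N * N)))%N.

(** The pair formed by [K] and [chi] has a presentation of size [N].  The
    condition depends on this pair only. *)
Definition presentable (K : fieldExtType rat) (chi : {poly K}) (N : nat) : Prop :=
  exists (y : K) (w1 w2 : nat),
  [/\ (w1 < poly_data_bound N)%N, (w2 < coef_data_bound N)%N, <<1; y>>%VS = fullv &
  [/\ Poly (poly_data N w1) != 0, horner_alg y (Poly (poly_data N w1)) = 0 &
      forall i, chi`_i = horner_alg y (Poly (nth [::] (coef_data N w2) i))]].

Lemma poly_boundedW (M N : nat) (p : {poly rat}) : (M <= N)%N -> poly_bounded M p -> poly_bounded N p.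
Proof.
move=> le_MN [sp cp]; split=> [|i]; first exact: leq_trans le_MN.
by have /andP[le1 le2] := cp i; rewrite /rat_bounded (leq_trans le1) // (leq_trans le2).
Qed.

Lemma rat_digits_bounded (N w off : nat) : poly_bounded N.+1 (Poly (rat_digits N.+1 w off N)).
Proof.
split=> [|i].
  by apply: leq_trans (size_Poly _) _; rewrite size_mkseq.
rewrite coef_Poly; have [lt_i|le_i] := ltnP i N; last by rewrite nth_default ?size_mkseq.
by rewrite nth_mkseq // rat_digit_bounded.
Qed.

Lemma Poly_rat_digits (N w off : nat) (p : {poly rat}) : (size p <= N)%N ->
  (forall i, (i < N)%N -> rat_digit N.+1 w (off + i) = p`_i) ->
  Poly (rat_digits N.+1 w off N) = p.
Proof.
move=> sp cp; apply/polyP=> i; rewrite coef_Poly; have [lt_i|le_i] := ltnP i N.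
  by rewrite nth_mkseq // cp.
by rewrite !nth_default ?size_mkseq // (leq_trans sp).
Qed.

Lemma poly_data_exists (N : nat) (p : {poly rat}) : poly_bounded N p ->
  exists2 w, (w < poly_data_bound N)%N & Poly (poly_data N w) = p.
Proof.
move=> [sp cp]; have [w lt_w wE] := rat_digits_exist (len := N) (fun i _ => cp i).
by exists w => //; apply: Poly_rat_digits.
Qed.

Lemma coef_data_exists (N : nat) (q : seq {poly rat}) :
  (size q <= N)%N -> (forall i, poly_bounded N (nth 0 q i)) ->
  exists2 w, (w < coef_data_bound N)%N &
    forall i, Poly (nth [::] (coef_data N w) i) = nth 0 q i.
Proof.
move=> sq bq; pose c k := (nth 0 q (k %/ N))`_(k %% N).
have [w lt_w wE] := rat_digits_exist (len := N * N) (fun k _ => (bq (k %/ N)%N).2 (k %% N)%N).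
exists w => // i; have [lt_i|le_i] := ltnP i N; last first.
  by rewrite !nth_default ?size_mkseq // (leq_trans sq).
rewrite nth_mkseq //; apply: Poly_rat_digits => [|j lt_j]; first exact: (bq i).1.
rewrite wE; last first.
  apply: (@leq_trans (i.+1 * N)); last by rewrite leq_mul2r lt_i orbT.
  by rewrite mulSn addnC ltn_add2r.
by rewrite divnMDl ?(leq_ltn_trans _ lt_j) // divn_small // addn0 modnMDl modn_small.
Qed.

Lemma presentable_bounded (K : fieldExtType rat) (chi : {poly K}) (N : nat) :
  presentable chi N -> exists y p q, bounded_presentation chi N.+1 y p q.
Proof.
move=> [y [w1 [w2 [_ _ gen_y [p0 py chiq]]]]].
exists y, (Poly (poly_data N w1)), (map (@Poly rat) (coef_data N w2)).
have nthE i : nth 0 (map (@Poly rat) (coef_data N w2)) i = Poly (nth [::] (coef_data N w2) i).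
  have [lt_i|le_i] := ltnP i N; last by rewrite !nth_default ?size_map ?size_iota.
  by rewrite (nth_map [::]) ?size_mkseq.
split; first by split=> // i; rewrite nthE.
split=> [||i]; [exact: rat_digits_bounded | by rewrite !size_map size_iota leqW | rewrite nthE].
have [lt_i|le_i] := ltnP i N; last first.
  by rewrite nth_default ?size_mkseq //; split=> [|j]; rewrite ?size_poly0 ?coef0.
by rewrite nth_mkseq //; apply: rat_digits_bounded.
Qed.

Lemma encode_bounded (n : nat) (p : {poly rat}) (q : {poly {poly rat}}) :
  let N := encode n p q in
  [/\ poly_bounded N p, (size q <= N)%N & forall i, poly_bounded N q`_i].
Proof.
move=> N; have le_N x : x \in n :: encode_poly p ++ size q :: flatten [seq encode_poly c | c <- q] ->
    (x <= N)%N by move=> xs; apply: ltnW; apply: (allP (CodeSeq.ltn_code _)).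
have bnd (f : {poly rat}) : {in encode_poly f, forall x, x <= N}%N -> poly_bounded N f.
  move=> fN; split=> [|i]; first by apply: fN; apply: mem_head.
  have [lt_i|le_i] := ltnP i (size f); last first.
    rewrite nth_default // /rat_bounded /=; apply: (@leq_trans 1) => //.
    by rewrite lt0n muln_eq0 expn_eq0.
  have sub x : x \in encode_rat f`_i -> (x <= N)%N.
    move=> xf; apply: fN; rewrite inE; apply/orP; right.
    by apply/flatten_mapP; exists f`_i => //; apply: mem_nth.
  by rewrite /rat_bounded !sub // !inE eqxx ?orbT.
split.
- by apply: bnd => x xp; apply: le_N; rewrite inE mem_cat xp orbT.
- by apply: le_N; rewrite inE mem_cat mem_head !orbT.
move=> i; have [lt_i|le_i] := ltnP i (size q); last first.
  rewrite nth_default //; apply: bnd => x; rewrite /encode_poly size_poly0 polyseq0 /= inE => /eqP ->.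
  exact: leq0n.
apply: bnd => x xq; apply: le_N; rewrite inE mem_cat [x \in size q :: _]inE.
apply/orP; right; apply/orP; right; apply/orP; right.
by apply/flatten_mapP; exists q`_i => //; apply: mem_nth.
Qed.

Lemma presents_presentable (K : fieldExtType rat) (chi : {poly K}) (n : nat) p q :
  presents chi p q -> presentable chi (encode n p q).
Proof.
move=> [a [gen_a p_irr pa chiq]]; have [bp sq bq] := encode_bounded n p q.
have [w1 lt1 E1] := poly_data_exists bp; have [w2 lt2 E2] := coef_data_exists sq bq.
exists a, w1, w2; split=> //; rewrite E1; split=> //; first exact: irredp_neq0.
by move=> i; rewrite E2 -chiq coef_map.
Qed.

Lemma presentation_exists (K : fieldExtType rat) (chi : {poly K}) :
  exists p q, presents chi p q.
Proof.
have [z Kz] := primitive_element K.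
have /polyOver1P[p Dp] := minPolyOver 1 z.
have /choice[g gP] : forall u : K, exists g : {poly rat}, u = horner_alg z g.
  move=> u; have := memvf u; rewrite -Kz => /Fadjoin_polyP[g /polyOver1P[g' ->] ->].
  by exists g'.
exists p, (\poly_(i < size chi) g chi`_i), z; split.
- exact: Kz.
- split.
    by rewrite -(size_map_poly (in_alg K)) -Dp size_minPoly ltnS adjoin_degreeE dimv1 divn1 adim_gt0.
  move=> f f1 f_p; have /(minPoly_irr _) : map_poly (in_alg K) f %| minPoly 1 z by rewrite Dp dvdp_map.
  rewrite Dp eqp_map => /(_ _)/orP[|//|]; first by apply/polyOver1P; exists f.
  rewrite -(rmorph1 (map_poly (in_alg K))) eqp_map => /eqp_size; rewrite size_poly1 => /eqP.
  by rewrite (negPf f1).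
- by rewrite horner_algE -Dp minPolyxx.
apply/polyP=> i; rewrite coef_map coef_poly /=; case: ltnP => [_|le_i]; first by rewrite -gP.
by rewrite rmorph0 nth_default.
Qed.

(** The least size of a presentation. *)
Definition presentation_size (K : fieldExtType rat) (chi : {poly K}) : nat :=
  if pselect (exists N, `[< presentable chi N >]) is left ex then ex_minn ex else 0%N.

Lemma presentation_sizeP (K : fieldExtType rat) (chi : {poly K}) :
  presentable chi (presentation_size chi) /\
  forall N, presentable chi N -> (presentation_size chi <= N)%N.
Proof.
rewrite /presentation_size; case: pselect => [ex|no]; last first.
  case: no; have [p [q pq]] := presentation_exists chi.
  by exists (encode 0 p q); apply/asboolP/presents_presentable.
by case: ex_minnP => N /asboolP pN minN; split=> // k pk; apply/minN/asboolP.
Qed.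

(** A presentation of size [N] has lengths and coefficients bounded by [N.+1]. *)
Definition size_degree_bound (N : nat) : nat :=
  extension_bound (system_size N.+1) (system_bound N.+1).

Definition degree_bound (K : fieldExtType rat) (n : nat) (chi : {poly K}) : nat :=
  size_degree_bound (presentation_size chi).

(** The polynomials by which a generator of the field is expressed in terms of
    another one are searched among those with these coefficients. *)
Definition coordinate_data (c w : nat) : seq rat :=
  poly_data (coordinate_bound c.+1) w.

Definition coordinate_data_bound (c : nat) : nat := poly_data_bound (coordinate_bound c.+1).

(** Decides whether the pair with presentation [p], [q] has a presentation of
    size [N], where [N] and the sizes of [p] and [q] are at most [c]. *)
Definition presentable_test (c : nat) (pq : seq rat * seq (seq rat)) (N : nat) : bool :=
  has (fun w1 => has (fun w2 => has (fun w3 => has (fun w4 =>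
    same_presentation pq.1 pq.2 (poly_data N w1) (coef_data N w2)
      (coordinate_data c w3) (coordinate_data c w4))
    (iota 0 (coordinate_data_bound c))) (iota 0 (coordinate_data_bound c)))
    (iota 0 (coef_data_bound N))) (iota 0 (poly_data_bound N)).

(** The test succeeds only if a presentation exists since it verifies one; it finds
    one if it exists since the coordinates of the two generators in terms of each
    other are bounded. *)
Lemma presentable_testP (K : fieldExtType rat) (chi : {poly K}) (n : nat) p q (N : nat) :
  presents chi p q -> (N <= encode n p q)%N ->
  presentable_test (encode n p q) (polyseq p, map polyseq q) N <-> presentable chi N.
Proof.
move=> [a [gen_a p_irr pa chiq]] le_N; have [bp sq bq] := encode_bounded n p q.
move: (encode n p q) le_N bp sq bq => c le_N bp sq bq.
have value_q i : value a (nth [::] (map polyseq q) i) = chi`_i.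
  rewrite -chiq coef_map /=; have [lt_i|le_i] := ltnP i (size q).
    by rewrite (nth_map 0) // value_poly.
  by rewrite !nth_default ?size_map // /value !rmorph0.
split=> [/hasP[w1 w1N /hasP[w2 w2N /hasP[w3 _ /hasP[w4 _ /(same_presentationP p_irr pa)]]]]|].
  move: w1N w2N; rewrite !mem_iota !add0n => /= w1N w2N [p0 py ya chiy].
  exists (value a (coordinate_data c w3)), w1, w2; split=> //; last first.
    by split=> // i; rewrite chiy value_q.
  apply/eqP; rewrite eqEsubv subvf /= -gen_a; apply/FadjoinP; split; first exact: sub1v.
  rewrite -[X in X \in _]ya horner_algE mempx_Fadjoin //; apply/polyOver1P.
  by exists (Poly (coordinate_data c w4)).
move=> [y [w1 [w2 [lt1 lt2 gen_y [p0 py chiy]]]]].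
have bp' : poly_bounded c.+1 (Poly (poly_data N w1)).
  by apply: poly_boundedW (rat_digits_bounded _ _ _).
have {}bp : poly_bounded c.+1 p by apply: poly_boundedW bp.
have [g bg Dg] := bounded_coordinates gen_a (irredp_neq0 p_irr) bp pa p0 bp' py.
have [g' bg' Dg'] := bounded_coordinates gen_y p0 bp' py (irredp_neq0 p_irr) bp pa.
have [w3 lt3 E3] := poly_data_exists bg; have [w4 lt4 E4] := poly_data_exists bg'.
have in_iota w b : (w < b)%N -> w \in iota 0 b by rewrite mem_iota.
apply/hasP; exists w1; first exact: in_iota.
apply/hasP; exists w2; first exact: in_iota.
apply/hasP; exists w3; first exact: in_iota.
apply/hasP; exists w4; first exact: in_iota.
apply/(same_presentationP p_irr pa).
have -> : value a (coordinate_data c w3) = y by rewrite Dg /value E3.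
by split=> // [|i]; [rewrite E4 | rewrite value_q chiy].
Qed.

(** The computation of the degree bound from an encoded presentation. *)
Definition degree_bound_code (c : nat) : nat :=
  size_degree_bound (find (presentable_test c (parse c)) (iota 0 c.+1)).

Lemma degree_bound_codeE (K : fieldExtType rat) (n : nat) (chi : {poly K}) p q :
  presents chi p q -> degree_bound_code (encode n p q) = degree_bound n chi.
Proof.
move=> pq; rewrite /degree_bound_code /degree_bound parse_encode; congr size_degree_bound.
have [pN minN] := presentation_sizeP chi; set N := presentation_size chi in pN minN *.
have le_N := minN _ (presents_presentable n pq); set c := encode n p q in le_N *.
have has_c : has (presentable_test c (polyseq p, map polyseq q)) (iota 0 c.+1).
  by apply/hasP; exists N; [rewrite mem_iota ltnS | apply/(presentable_testP pq)].
set k := find _ _; have lt_k : (k < c.+1)%N by rewrite -(size_iota 0 c.+1) -has_find.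
apply/eqP; rewrite eqn_leq; apply/andP; split; last first.
  by apply/minN/(presentable_testP (n := n) pq) => //; have := nth_find 0%N has_c; rewrite nth_iota.
rewrite leqNgt; apply/negP=> lt_Nk; have := before_find 0%N lt_Nk.
rewrite nth_iota ?ltnS // add0n => /negP; apply; exact/(presentable_testP pq).
Qed.

Lemma realizable_rat_digits (A : numbered) (M w off len : A -> nat) :
  realizable M -> realizable w -> realizable off -> realizable len ->
  realizable (fun x => rat_digits (M x) (w x) (off x) (len x)).
Proof. by rewrite /rat_digits /rat_digit /digit => rM rw ro rl; realize. Qed.

Lemma realizable_coordinate_bound (A : numbered) (N : A -> nat) :
  realizable N -> realizable (fun x => coordinate_bound (N x)).
Proof.
by rewrite /coordinate_bound /interpolation_bound /root_denominator /root_bound => rN; realize.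
Qed.

Lemma realizable_coordinate_data_bound (A : numbered) (c : A -> nat) :
  realizable c -> realizable (fun x => coordinate_data_bound (c x)).
Proof.
move=> rc; rewrite /coordinate_data_bound /poly_data_bound.
have rb := realizable_coordinate_bound (realizable_succ rc).
by apply: (realizable_comp (g := fun N => N.+1 ^ (3 * N))%N) rb; realize.
Qed.

Lemma realizable_size_degree_bound (A : numbered) (N : A -> nat) :
  realizable N -> realizable (fun x => size_degree_bound (N x)).
Proof.
rewrite /size_degree_bound /extension_bound /system_bound /system_size /root_denominator /root_bound.
rewrite /conductor_of /root_degree /class_bound /hurwitz /hurwitz_box => rN; realize.
Qed.

Lemma realizable_presentable_test (A : numbered) (c : A -> nat)
    (pq : A -> seq rat * seq (seq rat)) (N : A -> nat) :
  realizable c -> realizable pq -> realizable N ->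
  realizable (fun x => presentable_test (c x) (pq x) (N x)).
Proof.
move=> rc rpq rN; rewrite /presentable_test.
apply: realizable_has; last by rewrite /poly_data_bound; realize.
apply: realizable_has; last by rewrite /coef_data_bound; realize.
do 2 (apply: realizable_has; last by
  apply: realizable_iota; [realize | apply: realizable_coordinate_data_bound; realize]).
apply: realizable_same_presentation; try (by realize).
- by apply: realizable_rat_digits; realize.
- by apply: realizable_mkseq; [apply: realizable_rat_digits|]; realize.
- by apply: realizable_rat_digits; realize; apply: realizable_coordinate_bound; realize.
by apply: realizable_rat_digits; realize; apply: realizable_coordinate_bound; realize.
Qed.

Lemma computable_degree_bound_code : computable degree_bound_code.
Proof.
suff [h rh hE] : realizable degree_bound_code by apply: eq_computable rh => c; apply/esym/hE.
apply: realizable_size_degree_bound; apply: realizable_find; last by realize.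
apply: realizable_presentable_test; try (by realize).
exact: realizable_comp realizable_parse (realizable_fst (realizable_id _)).
Qed.

Lemma conj_char_poly (F : fieldType) n (M N U : 'M[F]_n) :
  U \in unitmx -> U *m M = N *m U -> char_poly M = char_poly N.
Proof.
move=> Uu UM; have Uu' : map_mx polyC U \in unitmx.
  by rewrite unitmxE det_map_mx rmorph_unit.
have E : map_mx polyC U *m char_poly_mx M = char_poly_mx N *m map_mx polyC U.
  by rewrite mulmxBr mulmxBl -scalar_mxC -!map_mxM UM.
have := congr1 determinant E; rewrite !det_mulmx mulrC.
by apply: mulIr; move: Uu'; rewrite unitmxE.
Qed.

Lemma similar_char_poly (K : fieldType) (v : K -> RR) n (M N : 'M[K]_n) :
  similar_at v M N -> char_poly M = char_poly N.
Proof.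
move=> [F [w [iota [_ [U [Uu _ _ UM]]]]]]; apply: (map_poly_inj iota).
by rewrite !map_char_poly; apply: conj_char_poly Uu UM.
Qed.

Lemma place_exists (K : fieldExtType rat) : exists v : K -> RR, place v.
Proof.
have [iota _] := number_field_embedding K.
have [V V2] : exists V : valring algC, 2%:R^-1 \notin V.
  apply: contrapT => noV; have : (2%:R^-1 : algC) \in Aint.
    by apply: AintP => V; apply: contraT => V2; case: noV; exists V.
  move/(Cint_rat_Aint _) => /(_ _)/intrP[|z Dz]; first by rewrite rpredV rpred_nat.
  have : (z * 2)%:~R = 1%:~R :> algC by rewrite rmorphM /= -Dz mulVf // pnatr_eq0.
  by move/intr_inj; lia.
have mV : 2%:R \in vmax V.
  by rewrite -[2%:R]invrK vring_vunit // invr_eq0 pnatr_eq0.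
by have [v [pv _ _]] := valring_place iota (isT : 0 < 2)%N mV; exists v.
Qed.

Theorem theorem4 :
  exists C : forall K : fieldExtType rat, nat -> {poly K} -> nat,
    effective admissible C /\
    forall (K : fieldExtType rat) (n : nat) (chi : {poly K}),
      admissible n chi ->
      forall M N : 'M[K]_n,
        mx_over (@integral K) M -> mx_over (@integral K) N ->
        (forall v : K -> RR, place v -> similar_at v M N) ->
        char_poly M = chi ->
        exists2 d : nat, is_CK M N d & (d <= C K n chi)%N.
Proof.
exists degree_bound; split.
  exists degree_bound_code; split; first exact: computable_degree_bound_code.
  by move=> K n chi _ p q pq; apply: degree_bound_codeE.
move=> K n chi adm M N intM intN sim chiM.
have [pres _] := presentation_sizeP chi; have [y [p [q bpq]]] := presentable_bounded pres.
have [L [phi [s [F [iota [t [[monF szF rF] [s_gal s_bound B_gt0] gen [t_inj t_s chi_t]]]]]]]] :=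
  presentation_system adm bpq.
have chiN : char_poly N = chi.
  have [v pv] := place_exists K.
  by rewrite -chiM; apply/esym/(similar_char_poly (sim v pv)).
have [E simE dimE] : exists2 E : fieldExtType K,
    similar_in_extension E M N & (\dim {:E} <= degree_bound n chi)%N.
  by apply: (similar_in_bounded_extension (iota := iota) (t := t)) monF szF rF s_gal s_bound B_gt0
    gen t_inj t_s _ _ intM intN sim; rewrite ?chiM ?chiN.
pose P d := `[< exists2 E : fieldExtType K, similar_in_extension E M N & \dim {:E} = d >].
have exP : exists d, P d by exists (\dim {:E}); apply/asboolP; exists E.
case: (ex_minnP exP) => d /asboolP exd min_d; exists d.
  by split=> // E' simE'; apply/min_d/asboolP; exists E'.
by apply: leq_trans dimE; apply/min_d/asboolP; exists E.
Qed.
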